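(* Let $\kappa=\frac12$. For every probability measure $\mu$ on $(-1,1)$, every $s\ge0$ and every measurable set $S\subset(-1,1)$, $$\lim_{t\to\infty}\frac1t\int_s^t\mathbb{P}_{\mu,s}(X_u\in S\mid\tau_X>t)\,du=\int_S\mathbb{E}^Z_x(\tau_Z)\,\alpha_{OU}(dx).$$
   Context: For $s\ge 0$ and $x\in\mathbb{R}$, let $\mathbb{P}_{x,s}$ be a probability measure under which $(X_t)_{t\ge s}$ is given by $X_t=\frac{x\sqrt{s+1}+W_{t-s}}{\sqrt{t+1}}$, with $W$ a standard Brownian motion started at $0$. Let $\tau_X:=\inf\{t\ge s:|X_t|=1\}$ and $\mathbb{P}_{\mu,s}=\int\mathbb{P}_{x,s}\mu(dx)$. $Z$ is the Ornstein–Uhlenbeck process with generator $Lf(x)=\frac12f''(x)-\frac12xf'(x)$, $\mathbb{E}^Z_x$ denotes expectation for $Z$ started at $x$, and $\tau_Z:=\inf\{t\ge0:|Z_t|=1\}$. $\alpha_{OU}$ is the unique quasi-stationary distribution of $Z$ absorbed at $(-1,1)^c$, i.e. $\alpha_{OU}(dx)=K(1-x^2)e^{-x^2/2}dx$ on $(-1,1)$ with $K$ normalizing. *)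

(* Defs.v *)
From HB Require Import structures.
From mathcomp Require Import all_boot all_order all_algebra.
From mathcomp Require Import all_classical all_reals all_analysis.
Set Implicit Arguments. Unset Strict Implicit. Unset Printing Implicit Defensive.
Import Order.TTheory GRing.Theory Num.Theory Num.Def.
Import numFieldNormedType.Exports.
Local Open Scope classical_set_scope.
Local Open Scope ring_scope.

Definition is_std_BM {R : realType} {d : measure_display} {Omega : measurableType d}
  (P : probability Omega R) (W : R -> Omega -> R) : Prop :=
  (forall t, 0 <= t -> measurable_fun setT (W t)) /\
  (forall w, W 0 w = 0) /\
  (forall w, {within `[0, +oo[%classic, continuous (fun t => W t w)}) /\
  (forall (n : nat) (ts : nat -> R) (A : nat -> set R),
      0 <= ts 0%N -> (forall i, ts i < ts i.+1) -> (forall i, measurable (A i)) ->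
      P (\bigcap_(i in `I_n) [set w | A i (W (ts i.+1) w - W (ts i) w)]) =
      (\prod_(i < n) normal_prob 0 (Num.sqrt (ts i.+1 - ts i)) (A i))%E).

(* The process X under P_{x,s}: X_t = (x sqrt(s+1) + W_{t-s}) / sqrt(t+1), t >= s *)
Definition Xproc {R : realType} {Omega : Type} (W : R -> Omega -> R)
  (x s t : R) (w : Omega) : R :=
  (x * Num.sqrt (s + 1) + W (t - s) w) / Num.sqrt (t + 1).

Definition tauX {R : realType} {Omega : Type} (W : R -> Omega -> R)
  (x s : R) (w : Omega) : \bar R :=
  ereal_inf [set t%:E | t in [set t | s <= t /\ `|Xproc W x s t w| = 1]].

(* P_{mu,s}(A) = \int P_{x,s}(A) mu(dx), where A x is the event under P_{x,s} *)
Definition Pmu {R : realType} {d : measure_display} {Omega : measurableType d}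
  (P : probability Omega R) (mu : probability R R) (A : R -> set Omega) : \bar R :=
  (\int[mu]_x P (A x))%E.

Definition condprob {R : realType} {d : measure_display} {Omega : measurableType d}
  (P : probability Omega R) (W : R -> Omega -> R) (mu : probability R R)
  (s : R) (S : set R) (u t : R) : R :=
  fine (Pmu P mu (fun x => [set w | S (Xproc W x s u w) /\ (t%:E < tauX W x s w)%E]))
  / fine (Pmu P mu (fun x => [set w | (t%:E < tauX W x s w)%E])).

(* Ornstein-Uhlenbeck process with generator f''/2 - x f'/2 started at x,
   realised from the Brownian motion W: Z_t = e^{-t/2} (x + W_{e^t - 1}). *)
Definition OUproc {R : realType} {Omega : Type} (W : R -> Omega -> R)
  (x t : R) (w : Omega) : R :=
  expR (- t / 2) * (x + W (expR t - 1) w).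

Definition tauZ {R : realType} {Omega : Type} (W : R -> Omega -> R)
  (x : R) (w : Omega) : \bar R :=
  ereal_inf [set t%:E | t in [set t | 0 <= t /\ `|OUproc W x t w| = 1]].

Definition EtauZ {R : realType} {d : measure_display} {Omega : measurableType d}
  (P : probability Omega R) (W : R -> Omega -> R) (x : R) : \bar R :=
  (\int[P]_w tauZ W x w)%E.

Definition alphaOU_unnorm {R : realType} (x : R) : R :=
  (1 - x ^+ 2) * expR (- (x ^+ 2) / 2).

Definition Iopen11 {R : realType} : set R := `]-1, 1[.

Definition alphaOU_K {R : realType} : R :=
  (fine (\int[@lebesgue_measure R]_(x in Iopen11) (alphaOU_unnorm x)%:E)%E)^-1.

Definition alphaOU_density {R : realType} (x : R) : R :=
  if (-1 < x < 1) then alphaOU_K * alphaOU_unnorm x else 0.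

(* Main.v *)
(** In the logarithmic time [v = ln ((t + 1) / (s + 1))] the process [X] is the
    Ornstein-Uhlenbeck process [Z], whatever [s]. Let [T_v f (x)] be the
    expectation of [f (Z_v)] on the event that [|Z| < 1] during [[0, v]]. With
    [r = ln ((u + 1) / (s + 1))] and [v = ln ((t + 1) / (u + 1))], the Markov property
    gives [P_(mu,s) (X_u \in S | tau_X > t) = mu T_r (1_S T_v 1) / mu T_(r+v) 1].

    The function [h x = 1 - x^2] satisfies [T_v h = e^(-v) h], [T_v] is symmetric for
    the weight [e^(-x^2/2)], and explicit super- and subsolutions give
    [T_1 1 <= 3 h] and a lower bound on [T_v (h^2)]. The latter yields a Doeblin
    minorization [T_tau f >= c h \int_(|y| <= 1/10) f] for [f >= 0]; hence [e^v T_v]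
    contracts the oscillation of [f / h], and [e^v T_v f] is uniformly close to
    [h <h, f> / <h, h>] relatively to [h]. So the conditional probability is close,
    as soon as [r] is large, to [G v = e^v <h, 1_S T_v 1> / <h, 1>]. As
    [e^v = (t + 1) / (u + 1)], Tonelli's theorem turns the average over [u] into
    [(t + 1) / t \int_S E (min (v_t, tau_Z)) d alpha_OU], where
    [v_t = ln ((t + 1) / (s + 1))], and monotone convergence concludes.

    All estimates on [T] are proved for the discrete operator that kills the process
    outside [[-c, c]] at the times of a grid, then passed to the limit in the grid
    and in [c]. *)

Require Import Defs.
From HB Require Import structures.
From mathcomp Require Import all_boot all_order all_algebra.
From mathcomp Require Import all_classical all_reals all_analysis.
From mathcomp Require Import measurable_realfun ring lra.
Set Implicit Arguments. Unset Strict Implicit. Unset Printing Implicit Defensive.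
Import Order.TTheory GRing.Theory Num.Theory Num.Def.
Import numFieldNormedType.Exports.
Local Open Scope classical_set_scope.
Local Open Scope ring_scope.

(** * Integrals of bounded measurable functions *)

(** No stochastic calculus is used: the estimates are polynomial inequalities for one Gaussian step,
    iterated. With h = 1 - x^2 and L the generator, L h = - h and L (h^2) = 4 - 4 h - 2 h^2, so the
    test functions are polynomials of degree at most two in h. The obstacle is the overshoot: a step
    may land beyond [-1, 1], where the killed test function is 0 while the polynomial can have the
    wrong sign. It is corrected there by e + D (y - m)^4, with m the mean of the step. A step of
    variance theta pays 3 D theta^2 for the quartic, so a grid of n steps pays O(1/n) in total, and
    the loss proportional to e vanishes when e tends to 0 after the grid limit. The level c < 1 is
    there because survival in (-1, 1) is an open condition: it is exhausted by the closed conditions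
    |Z| <= c, and each of these is the limit of its grid versions by continuity of the paths. The
    same limits make the survival events measurable and remove the starting time s, which does not
    occur in the iterated kernel. *)

Section real_limits.
Context {R : realType} {T : Type} (F : set_system T) {FF : Filter F}.
Implicit Types f g : T -> R.

Lemma rcvgD f g (a b : R) : f @ F --> a -> g @ F --> b ->
  (fun x => f x + g x) @ F --> a + b.
Proof. exact: (@cvgD _ R^o). Qed.

Lemma rcvgB f g (a b : R) : f @ F --> a -> g @ F --> b ->
  (fun x => f x - g x) @ F --> a - b.
Proof. exact: (@cvgB _ R^o). Qed.

Lemma rcvgM f g (a b : R) : f @ F --> a -> g @ F --> b ->
  (fun x => f x * g x) @ F --> a * b.
Proof. exact: cvgM. Qed.

Lemma rcvgZ c f (a : R) : f @ F --> a -> (fun x => c * f x) @ F --> c * a.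
Proof. by move=> fa; apply: rcvgM => //; exact: cvg_cst. Qed.

Lemma rcvg_eq f g (a : R) : f =1 g -> f @ F --> a -> g @ F --> a.
Proof. by move=> /funext->. Qed.

End real_limits.

(** * Measures with a density *)

Section density.
Local Open Scope ereal_scope.
Context d (T : measurableType d) (R : realType).
Variables (m m' : {measure set T -> \bar R}) (g : T -> R).
Hypothesis g0 : forall x, (0 <= g x)%R.
Hypothesis mg : measurable_fun setT g.
Hypothesis m'E : forall A, measurable A -> m' A = \int[m]_(x in A) (g x)%:E.

Import HBNNSimple.

Let density_nnsfun (h : {nnsfun T >-> R}) :
  \int[m']_x (h x)%:E = \int[m]_x ((h x)%:E * (g x)%:E).
Proof.
under [LHS]eq_integral do rewrite fimfunE -fsumEFin//.
rewrite [LHS]ge0_integral_fsum//; last 2 first.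
  - by move=> r; exact/measurable_EFinP/measurableT_comp.
  - by move=> n x _; rewrite EFinM nnfun_muleindic_ge0.
under [RHS]eq_integral.
  move=> x xD; rewrite fimfunE -fsumEFin// ge0_mule_fsuml; last first.
    by move=> r; rewrite EFinM nnfun_muleindic_ge0.
  over.
rewrite [RHS]ge0_integral_fsum//; last 2 first.
  - move=> r; apply: emeasurable_funM; last exact/measurable_EFinP.
    exact/measurable_EFinP/measurableT_comp.
  - by move=> n x _; apply: mule_ge0; [rewrite EFinM nnfun_muleindic_ge0|rewrite lee_fin].
apply: eq_fsbigr => r _.
have [r0|r0] := ltP r 0%R.
  rewrite preimage_nnfun0//= ?integral0_eq//.
  - by move=> x _; rewrite indicE in_set0 mulr0 mul0e.
  - by move=> x _; rewrite indicE in_set0 mulr0.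
have mr : measurable (h @^-1` [set r]) by [].
under eq_integral do rewrite EFinM.
rewrite ge0_integralZl//; last exact/measurable_EFinP/measurable_indic.
rewrite integral_indic// setIT m'E//.
under [RHS]eq_integral do rewrite EFinM -muleA.
rewrite ge0_integralZl//; last 2 first.
  - apply: emeasurable_funM; last exact/measurable_EFinP.
    exact/measurable_EFinP/measurable_indic.
  - by move=> x _; rewrite mule_ge0// lee_fin.
congr (_ * _); rewrite integral_mkcond.
apply: eq_integral => x _; rewrite patchE indicE.
by case: ifPn => _; rewrite ?mul1e ?mul0e.
Qed.

(** Simple functions, then monotone convergence. Three kinds of density occur below: the normal
    density, an indicator (a restricted measure) and a constant (proportional laws). *)
Lemma ge0_integral_density (f : T -> \bar R) :
  measurable_fun setT f -> (forall x, 0 <= f x) ->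
  \int[m']_x f x = \int[m]_x (f x * (g x)%:E).
Proof.
move=> mf f0.
pose f_ := nnsfun_approx measurableT mf.
transitivity (limn (fun n => \int[m']_x (f_ n x)%:E)).
  rewrite -monotone_convergence//.
  - apply: eq_integral => y _; apply/esym/cvg_lim => //.
    exact: cvg_nnsfun_approx.
  - by move=> n; exact/measurable_EFinP/measurable_funP.
  - by move=> n y _; rewrite lee_fin.
  - by move=> y _ a b ab; rewrite lee_fin; exact/lefP/nd_nnsfun_approx.
rewrite [X in limn X](_ : _ = fun n => \int[m]_x ((f_ n x)%:E * (g x)%:E)); last first.
  by apply/funext => n; rewrite density_nnsfun.
rewrite -monotone_convergence//.
- apply: eq_integral => y _; apply/cvg_lim => //.
  by apply: cvgeZr => //; exact: cvg_nnsfun_approx.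
- move=> n; apply: emeasurable_funM; last exact/measurable_EFinP.
  by exact/measurable_EFinP/measurable_funP.
- by move=> n y _; rewrite mule_ge0// lee_fin.
- move=> y _ a b ab; rewrite lee_pmul// ?lee_fin//.
  exact/lefP/nd_nnsfun_approx.
Qed.

End density.

Section bounded_measurable.
Context {R : realType}.

(** Such functions are integrable against every finite measure, so that linearity, comparison and
    Fubini's theorem apply to them without integrability hypotheses. *)
Definition bmf d (T : measurableType d) (f : T -> R) :=
  measurable_fun setT f /\ exists M : R, forall x, `|f x| <= M.

Section one.
Context d (T : measurableType d).
Implicit Types f g : T -> R.

Lemma bmf_cst c : bmf (fun _ : T => c).
Proof. by split => //; exists `|c|. Qed.

Lemma bmfD f g : bmf f -> bmf g -> bmf (fun x => f x + g x).
Proof.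
move=> [mf [M Mf]] [mg [N Ng]]; split; first exact: measurable_funD.
by exists (M + N) => x; rewrite (le_trans (ler_normD _ _))// lerD.
Qed.

Lemma bmfM f g : bmf f -> bmf g -> bmf (fun x => f x * g x).
Proof.
move=> [mf [M Mf]] [mg [N Ng]]; split; first exact: measurable_funM.
by exists (M * N) => x; rewrite normrM ler_pM.
Qed.

Lemma bmfZ c f : bmf f -> bmf (fun x => c * f x).
Proof. by move=> bf; apply: bmfM => //; exact: bmf_cst. Qed.

Lemma bmfB f g : bmf f -> bmf g -> bmf (fun x => f x - g x).
Proof.
move=> [mf [M Mf]] [mg [N Ng]]; split; first exact: measurable_funB.
by exists (M + N) => x; rewrite (le_trans (ler_normB _ _))// lerD.
Qed.

Lemma bmf_indic (A : set T) : measurable A -> bmf (\1_A : T -> R).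
Proof.
move=> mA; split; first exact: measurable_indic.
by exists 1 => x; rewrite indicE; case: (_ \in _); rewrite ?normr0 ?normr1.
Qed.

Lemma bmf_comp d' (T' : measurableType d') (f : T' -> R) (g : T -> T') :
  bmf f -> measurable_fun setT g -> bmf (fun x => f (g x)).
Proof.
move=> [mf [M Mf]] mg; split; first exact: measurableT_comp.
by exists M => x; exact: Mf.
Qed.

Lemma bmf_itv f (a b : R) : measurable_fun setT f ->
  (forall x, a <= f x <= b) -> bmf f.
Proof.
move=> mf ab; split => //; exists (`|a| + `|b|) => x.
have /andP[ax xb] := ab x; rewrite ler_norml; apply/andP; split.
  rewrite (le_trans _ ax)// (le_trans _ (_ : - `|a| <= a))//.
    by rewrite lerN2 lerDl.
  by rewrite lerNl -normrN ler_norm.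
by rewrite (le_trans xb)// (le_trans (ler_norm b))// lerDr.
Qed.

Variable m : {finite_measure set T -> \bar R}.

Lemma bmf_integrable f : bmf f -> m.-integrable setT (EFin \o f).
Proof.
move=> [mf [M Mf]]; apply: measurable_bounded_integrable => //.
  by rewrite ltey_eq fin_num_measure.
exists M; split; first exact: num_real.
by move=> N MN x _ /=; rewrite (le_trans (Mf x))// ltW.
Qed.

Lemma EFin_bmf f : bmf f ->
  (\int[m]_x (f x)%:E = (\int[m]_x f x)%:E)%E.
Proof.
by move=> bf; rewrite /Rintegral fineK//; apply: integrable_fin_num => //;
  exact: bmf_integrable.
Qed.

Lemma bmf_intD f g : bmf f -> bmf g ->
  \int[m]_x (f x + g x) = \int[m]_x f x + \int[m]_x g x.
Proof. by move=> bf bg; rewrite RintegralD//; exact: bmf_integrable. Qed.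

Lemma bmf_intB f g : bmf f -> bmf g ->
  \int[m]_x (f x - g x) = \int[m]_x f x - \int[m]_x g x.
Proof. by move=> bf bg; rewrite RintegralB//; exact: bmf_integrable. Qed.

Lemma bmf_intZ c f : bmf f -> \int[m]_x (c * f x) = c * \int[m]_x f x.
Proof. by move=> bf; rewrite RintegralZl//; exact: bmf_integrable. Qed.

Lemma bmf_le f g : bmf f -> bmf g -> (forall x, f x <= g x) ->
  \int[m]_x f x <= \int[m]_x g x.
Proof. by move=> bf bg fg; apply: le_Rintegral => //; exact: bmf_integrable. Qed.

Lemma int_ge0 f : (forall x, 0 <= f x) -> 0 <= \int[m]_x f x.
Proof. by move=> f0; exact: Rintegral_ge0. Qed.

Lemma bmf_int_cst c : \int[m]_x c = c * fine (m setT).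
Proof. by rewrite Rintegral_cst. Qed.

(** Dominated convergence by a constant. That the limit is again in [bmf] is half of the point: the
    survival events, given by uncountably many conditions, obtain their measurability from it. *)
Lemma bmf_cvg (f_ : nat -> T -> R) f (M : R) : (forall n, measurable_fun setT (f_ n)) ->
  (forall n x, `|f_ n x| <= M) -> (forall x, f_ ^~ x @ \oo --> f x) ->
  bmf f /\ (fun n => \int[m]_x f_ n x) @ \oo --> \int[m]_x f x.
Proof.
move=> mf_ Mf cf.
have mf : measurable_fun setT f by apply: (measurable_fun_cvg mf_) => x _; exact: cf.
have Mfx x : `|f x| <= M.
  by apply: (cvgr_to_le (cvg_norm (cf x))); near=> n; exact: Mf.
split; first by split => //; exists M.
have [||||| _ _ cvg] := @dominated_convergence _ T R m setT measurableT
   (fun n => EFin \o f_ n) (EFin \o f) (fun=> M%:E).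
- by move=> n; exact/measurable_EFinP.
- exact/measurable_EFinP.
- by apply: aeW => x _; apply: cvg_EFin; [near=> n|exact: cf].
- by apply: bmf_integrable; exact: bmf_cst.
- by apply: aeW => x n _; rewrite lee_fin.
apply: fine_cvg; rewrite fineK//.
apply: integrable_fin_num => //; apply: bmf_integrable; split => //.
by exists M.
Unshelve. all: by end_near. Qed.

End one.

Lemma prob_int_cst d (T : measurableType d) (P : probability T R) c :
  \int[P]_x c = c.
Proof. by rewrite Rintegral_cst// [X in fine X]probability_setT mulr1. Qed.

End bounded_measurable.

Section two_measures.
Context {R : realType} d1 d2 (T1 : measurableType d1) (T2 : measurableType d2).
Variables (m1 : {finite_measure set T1 -> \bar R})
  (m2 : {finite_measure set T2 -> \bar R}).
Variable f : T1 * T2 -> R.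
Hypothesis bf : bmf f.

Lemma bmf_pair1 x : bmf (fun y => f (x, y)).
Proof.
have [mf [M Mf]] := bf; split; last by exists M => y; exact: Mf.
exact: measurableT_comp.
Qed.

Lemma bmf_pair2 y : bmf (fun x => f (x, y)).
Proof.
have [mf [M Mf]] := bf; split; last by exists M => x; exact: Mf.
exact: measurableT_comp.
Qed.

Lemma bmf_prod_integrable : (m1 \x m2)%E.-integrable setT (EFin \o f).
Proof.
have [mf [M Mf]] := bf.
apply: measurable_bounded_integrable => //.
  suff : ((m1 \x m2)%E (setT `*` setT) < +oo)%E by rewrite setXTT.
  by rewrite product_measure1E// lte_mul_pinfty// ?ltey_eq fin_num_measure.
exists M; split; first exact: num_real.
by move=> N MN x _ /=; rewrite (le_trans (Mf x))// ltW.
Qed.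

(** Measurability of partial integrals is available for nonnegative functions: [f + M] is one, and
    the integral of [M] is subtracted afterwards. *)
Lemma bmf_int2 : bmf (fun x => \int[m2]_y f (x, y)).
Proof.
have [mf [M Mf]] := bf.
have M0 x : 0 <= f x + M by have := Mf x; rewrite ler_norml => /andP[]; lra.
have mf' : measurable_fun setT (EFin \o (fun x => f x + M)).
  by apply/measurable_EFinP; exact: measurable_funD.
split; last first.
  exists (M * fine (m2 setT)) => x.
  rewrite (le_trans (le_normr_Rintegral _ _))//.
    exact/bmf_integrable/bmf_pair1.
  rewrite -bmf_int_cst; apply: bmf_le => //.
    have [mfx [N Nf]] := bmf_pair1 x.
    by split; [exact: measurableT_comp|exists N => y; rewrite normr_id].
  exact: bmf_cst.
have := measurable_fun_fubini_tonelli_F (m2 := m2) _ mf'.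
move=> /(_ _)/wrap[x|mF]; first by rewrite /= lee_fin.
rewrite (_ : (fun x => _) =
   (fun x => fine (fubini_F m2 (EFin \o (fun x => f x + M)) x) - M * fine (m2 setT))).
  by apply: measurable_funB => //; exact: measurableT_comp.
apply/funext => x; rewrite /fubini_F /=.
rewrite EFin_bmf /=; last by apply: bmfD; [exact: bmf_pair1|exact: bmf_cst].
by rewrite bmf_intD ?bmf_int_cst ?addrK//; [exact: bmf_pair1|exact: bmf_cst].
Qed.

End two_measures.

Lemma bmf_Fubini {R : realType} d1 d2 (T1 : measurableType d1)
  (T2 : measurableType d2) (m1 : {finite_measure set T1 -> \bar R})
  (m2 : {finite_measure set T2 -> \bar R}) (f : T1 * T2 -> R) : bmf f ->
  \int[m1]_x \int[m2]_y f (x, y) = \int[m2]_y \int[m1]_x f (x, y).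
Proof.
move=> bf; have := Fubini (bmf_prod_integrable m1 m2 bf).
rewrite (eq_integral (fun x => (\int[m2]_y f (x, y))%:E)); last first.
  by move=> x _; rewrite -EFin_bmf//; exact: bmf_pair1.
rewrite [X in _ = X -> _](eq_integral (fun y => (\int[m1]_x f (x, y))%:E)); last first.
  by move=> y _; rewrite -EFin_bmf//; exact: bmf_pair2.
by rewrite /Rintegral => ->.
Qed.

Section image_measure.
Context d1 d2 (T1 : measurableType d1) (T2 : measurableType d2) (R : realType).
Variables (m : {finite_measure set T1 -> \bar R}) (f : T1 -> T2).
Hypothesis mf : measurable_fun setT f.

(** The pushforward with the measurability of [f] as an argument, so that it carries the structure
    of a finite measure and can enter a product measure. *)
Definition image_measure of measurable_fun setT f : set T2 -> \bar R :=
  pushforward m f.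

Let mpre A : measurable A -> measurable (f @^-1` A).
Proof. by move=> mA; rewrite -[X in measurable X]setTI; exact: mf. Qed.

Let image0 : image_measure mf set0 = 0%E.
Proof. by rewrite /image_measure /pushforward preimage_set0 measure0. Qed.

Let image_ge0 A : (0 <= image_measure mf A)%E.
Proof. exact: measure_ge0. Qed.

Let image_sigma_additive : semi_sigma_additive (image_measure mf).
Proof.
move=> F mF tF mUF; rewrite /image_measure /pushforward preimage_bigcup.
apply: measure_semi_sigma_additive.
- by move=> n; exact: mpre.
- apply/trivIsetP => /= i j _ _ ij; rewrite -preimage_setI.
  by move/trivIsetP : tF => /(_ _ _ _ _ ij) ->//; rewrite preimage_set0.
- by rewrite -preimage_bigcup; exact: mpre.
Qed.

HB.instance Definition _ := isMeasure.Build _ _ _ (image_measure mf)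
  image0 image_ge0 image_sigma_additive.

Let finite_image : fin_num_fun (image_measure mf).
Proof.
move=> A mA; rewrite /image_measure/= /pushforward fin_num_measure//.
by rewrite -[X in measurable X]setTI; exact: mf.
Qed.

HB.instance Definition _ :=
  @Measure_isFinite.Build _ _ _ (image_measure mf) finite_image.

Lemma ge0_integral_image (g : T2 -> \bar R) : measurable_fun setT g ->
  (forall y, (0 <= g y)%E) ->
  (\int[image_measure mf]_y g y = \int[m]_x g (f x))%E.
Proof. by move=> mg g0; rewrite /image_measure ge0_integral_pushforward. Qed.

End image_measure.

(** * Integrating out an independent variable *)

Section freezing.
Context {R : realType} d d1 d2 (Omega : measurableType d)
  (T1 : measurableType d1) (T2 : measurableType d2).
Variables (P : probability Omega R) (N : probability T2 R).
Variables (G : set Omega) (X : Omega -> T1) (Y : Omega -> T2).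
Hypotheses (mG : measurable G) (mX : measurable_fun setT X)
  (mY : measurable_fun setT Y).
Hypothesis XY : forall A C, measurable A -> measurable C ->
  P (G `&` X @^-1` A `&` Y @^-1` C) = (P (G `&` X @^-1` A) * N C)%E.

Let PG : {finite_measure set Omega -> \bar R} :=
  mfrestr mG (le_lt_trans (probability_le1 P mG) (ltry 1)).

Let PGE (f : Omega -> \bar R) : measurable_fun setT f -> (forall x, (0 <= f x)%E) ->
  (\int[PG]_w f w = \int[P]_w (f w * (\1_G w)%:E))%E.
Proof.
move=> mf f0; apply: ge0_integral_density => //.
  by move=> A mA; rewrite integral_indic// /PG /= /mfrestr /mrestr setIC.
Qed.

Let XY' (A : set T1) (C : set T2) : measurable A -> measurable C ->
  pushforward PG (fun w => (X w, Y w)) (A `*` C) = (pushforward PG X A * N C)%E.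
Proof.
move=> mA mC; rewrite /pushforward /= /mfrestr /mrestr.
rewrite [in RHS]setIC -XY//; congr (P _).
by apply/seteqP; split => [w [[? ?] ?]|w [[? ?] ?]].
Qed.

(** Under [P] restricted to [G], the law of [(X, Y)] is the product of the law of [X] and [N],
    because both agree on rectangles; Tonelli's theorem then integrates over the second variable
    with [X] frozen. *)
Lemma ge0_freezing (F : T1 * T2 -> \bar R) : measurable_fun setT F ->
  (forall z, (0 <= F z)%E) ->
  (\int[P]_w (F (X w, Y w) * (\1_G w)%:E) =
   \int[P]_w ((\int[N]_y F (X w, y)) * (\1_G w)%:E))%E.
Proof.
move=> mF F0.
have mXY : measurable_fun setT (fun w => (X w, Y w)) by exact: measurable_fun_pair.
rewrite -PGE//; last exact: measurableT_comp.
rewrite -PGE//; last 2 first.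
  apply: (measurableT_comp (f := fun x => \int[N]_y F (x, y))%E) => //.
  exact: (measurable_fun_fubini_tonelli_F (m2 := N) F).
  by move=> w; exact: integral_ge0.
transitivity (\int[image_measure PG mXY]_z F z)%E.
  by rewrite ge0_integral_image.
rewrite (eq_measure_integral (image_measure PG mX \x N)%E); last first.
  by move=> A mA _; apply/esym/product_measure_unique => //; exact: XY'.
rewrite fubini_tonelli1// ge0_integral_image//;
  first exact: (measurable_fun_fubini_tonelli_F (m2 := N) F).
by move=> x; exact: integral_ge0.
Qed.

Lemma freezing (F : T1 * T2 -> R) : bmf F ->
  \int[P]_w (\1_G w * F (X w, Y w)) =
  \int[P]_w (\1_G w * \int[N]_y F (X w, y)).
Proof.
move=> bF; have [mF [M FM]] := bF.
have bG := bmf_indic (R := R) mG.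
have mXY : measurable_fun setT (fun w => (X w, Y w)) by exact: measurable_fun_pair.
have bi : bmf (fun w => \int[N]_y F (X w, y)).
  exact: (bmf_comp (bmf_int2 N bF)).
have bFXY : bmf (fun w => F (X w, Y w)) by exact: (bmf_comp bF).
have FM0 z : 0 <= F z + M by have := FM z; rewrite ler_norml => /andP[]; lra.
have := @ge0_freezing (fun z => (F z + M)%:E).
move=> /(_ _ _)/wrap[||].
- by apply/measurable_EFinP; apply: measurable_funD.
- by move=> z; rewrite lee_fin.
rewrite (eq_integral (fun w => (\1_G w * F (X w, Y w) + M * \1_G w)%:E)); last first.
  by move=> w _; rewrite -EFinM; congr EFin; ring.
rewrite [X in _ = X -> _](eq_integral
  (fun w => (\1_G w * \int[N]_y F (X w, y) + M * \1_G w)%:E)); last first.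
  move=> w _; rewrite EFin_bmf; last first.
    by apply: bmfD; [exact: bmf_pair1|exact: bmf_cst].
  rewrite bmf_intD; [|exact: bmf_pair1|exact: bmf_cst].
  rewrite -EFinM prob_int_cst; congr EFin; ring.
rewrite !EFin_bmf; [|by apply: bmfD; [exact: bmfM|exact: bmfZ]..].
rewrite !bmf_intD; [|by [exact: bmfM|exact: bmfZ]..].
by move=> h; apply: (addIr (\int[P]_x (M * \1_G x))); exact: EFin_inj.
Qed.

End freezing.

(** * Normal laws *)

Section affine_substitution.
Context {R : realType}.
Local Notation leb := (@lebesgue_measure R).

Definition affine (a b y : R) : measurableTypeR R := a + b * y.

(** The affine image of Lebesgue measure, rescaled by the slope, gives intervals their length, and
    this determines Lebesgue measure. *)
Lemma lebesgue_measure_affine (a b : R) (b0 : 0 < b) (A : set R) : measurable A ->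
  leb A = (b%:E * pushforward leb (affine a b) A)%E.
Proof.
move=> mA.
have mphi : measurable_fun setT (affine a b).
  by apply: measurable_funD => //; exact: measurable_funM.
pose pf : {measure set (measurableTypeR R) -> \bar R} :=
  pushforward leb (affine a b).
change (leb A = mscale (NngNum (ltW b0)) (pf mphi) A).
apply: lebesgue_measure_unique => //= _ [[x y]] _ <-.
rewrite /mscale/= /pushforward/=.
rewrite (_ : _ @^-1` _ = `](x - a) / b, (y - a) / b]%classic); last first.
  apply/seteqP; split => z /=; rewrite /affine !in_itv/= ltr_pdivrMr// ler_pdivlMr// => /andP[u v];
    by apply/andP; split; lra.
rewrite !lebesgue_measure_itv/= !lte_fin ltr_pM2r ?invr_gt0// ltrD2r.
case: ifPn => xy; last by rewrite mule0.
by rewrite -!EFinD -EFinM; congr EFin; field; exact: lt0r_neq0.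
Qed.

Lemma ge0_integral_affine (a b : R) (f : R -> \bar R) : 0 < b ->
  measurable_fun setT f -> (forall y, (0 <= f y)%E) ->
  (\int[leb]_y f y = \int[leb]_y (b%:E * f (a + b * y)%R))%E.
Proof.
move=> b0 mf f0.
have mphi : measurable_fun setT (affine a b).
  by apply: measurable_funD => //; exact: measurable_funM.
rewrite ge0_integralZl//; last 2 first.
  exact: (measurableT_comp mf mphi).
  by rewrite lee_fin ltW.
pose pf : {measure set (measurableTypeR R) -> \bar R} :=
  pushforward leb (affine a b).
transitivity (\int[mscale (NngNum (ltW b0)) (pf mphi)]_y f y)%E.
  by apply: eq_measure_integral => A mA _; exact: lebesgue_measure_affine.
rewrite ge0_integral_mscale//=; congr (_ * _)%E.
by rewrite ge0_integral_pushforward.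
Qed.

Lemma ge0_integral_normal_prob (m s : R) (f : R -> \bar R) :
  measurable_fun setT f -> (forall y, (0 <= f y)%E) ->
  (\int[normal_prob m s]_y f y = \int[leb]_y (f y * (normal_pdf m s y)%:E))%E.
Proof.
move=> mf f0; apply: ge0_integral_density => //.
- by move=> x; exact: normal_pdf_ge0.
- exact: measurable_normal_pdf.
Qed.

Lemma normal_pdf_affine (m s z : R) : 0 < s ->
  s * normal_pdf m s (m + s * z) = normal_pdf 0 1 z.
Proof.
move=> s0; rewrite !normal_pdfE ?oner_neq0 ?gt_eqF// /normal_fun /normal_peak.
rewrite expr1n mul1r mulrA; congr (_ * expR _); last first.
  rewrite subr0 addrAC subrr add0r exprMn -mulr_natr; field.
  by rewrite gt_eqF.
rewrite -mulrnAr sqrtrM ?sqr_ge0// sqrtr_sqr gtr0_norm// invfM mulrA divff ?mul1r//.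
by rewrite gt_eqF.
Qed.

Lemma ge0_integral_normal_std (m s : R) (f : R -> \bar R) : 0 < s ->
  measurable_fun setT f -> (forall y, (0 <= f y)%E) ->
  (\int[normal_prob m s]_y f y = \int[normal_prob 0 1]_z f (m + s * z)%R)%E.
Proof.
move=> s0 mf f0.
have mfa : measurable_fun setT (fun z => f (m + s * z)%R).
  apply: (measurableT_comp mf).
  by apply: measurable_funD => //; exact: measurable_funM.
rewrite (ge0_integral_normal_prob m s mf f0).
rewrite (@ge0_integral_normal_prob 0 1 _ mfa); last by move=> z; exact: f0.
rewrite (ge0_integral_affine m s0); last 2 first.
  apply: emeasurable_funM => //.
  by apply/measurable_EFinP; exact: measurable_normal_pdf.
  by move=> y; rewrite mule_ge0// lee_fin normal_pdf_ge0.
apply: eq_integral => z _.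
by rewrite muleCA -EFinM normal_pdf_affine.
Qed.

End affine_substitution.

Section bmf_shift.
Context {R : realType} d (T : measurableType d).

(** Carries an identity between integrals of nonnegative functions over to bounded ones: a constant
    [M] adds the same amount to both sides, as both measures have mass 1. *)
Lemma bmf_ge0_eq d' (T' : measurableType d') (m : probability T R)
  (m' : probability T' R) (f : T -> R) (g : T' -> R) :
  bmf f -> bmf g ->
  (forall M : R, (forall x, 0 <= f x + M) -> (forall x, 0 <= g x + M) ->
    (\int[m]_x (f x + M)%:E = \int[m']_x (g x + M)%:E)%E) ->
  \int[m]_x f x = \int[m']_x g x.
Proof.
move=> bf bg H; have [_ [M1 M1f]] := bf; have [_ [M2 M2g]] := bg.
have fM x : 0 <= f x + (`|M1| + `|M2|).
  have := M1f x; rewrite ler_norml => /andP[+ _].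
  have := ler_norm M1; have := normr_ge0 M2; lra.
have gM x : 0 <= g x + (`|M1| + `|M2|).
  have := M2g x; rewrite ler_norml => /andP[+ _].
  have := ler_norm M2; have := normr_ge0 M1; lra.
have := H _ fM gM.
rewrite !EFin_bmf ?bmf_intD ?prob_int_cst//;
  try solve [exact: bmf_cst|by apply: bmfD => //; exact: bmf_cst].
move=> h; apply: (addIr (`|M1| + `|M2|)); exact: EFin_inj.
Qed.

End bmf_shift.

Section gauss.
Context {R : realType}.
Local Notation leb := (@lebesgue_measure R).
Local Notation N01 := (normal_prob (0 : R) 1).

Lemma measurable_affine (a b : R) : measurable_fun setT (fun z : R => a + b * z).
Proof. by apply: measurable_funD => //; exact: measurable_funM. Qed.

Lemma integral_normal_std (m s : R) (f : R -> R) : 0 < s -> bmf f ->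
  \int[normal_prob m s]_y f y = \int[N01]_z f (m + s * z).
Proof.
move=> s0 bf; apply: bmf_ge0_eq; first exact: bf.
  exact: (bmf_comp bf (measurable_affine m s)).
move=> M fM _; rewrite (ge0_integral_normal_std _ s0)//.
apply/measurable_EFinP; apply: measurable_funD => //; exact: bf.1.
Qed.

End gauss.

(** * Gaussian moment inequalities of degree four *)

Section gauss_moments.
Context {R : realType}.
Local Notation leb := (@lebesgue_measure R).
Local Notation N01 := (normal_prob (0 : R) 1).

Lemma FTC2_is_derive (F f : R -> R) (a b : R) : a < b ->
  (forall x : R, is_derive x 1 F (f x)) -> continuous f ->
  (\int[leb]_(x in `[a, b]) (f x)%:E = (F b - F a)%:E)%E.
Proof.
move=> ab dF cf.
have cF : continuous F.
  move=> x; apply: differentiable_continuous; apply/derivable1_diffP.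
  by have [] := dF x.
rewrite (@continuous_FTC2 R f F)//.
- exact: continuous_subspaceT.
- split.
  + by move=> x _; have [] := dF x.
  + by apply: cvg_at_right_filter; exact: cF.
  + by apply: cvg_at_left_filter; exact: cF.
- by move=> x _; rewrite derive1E; have [_ ->] := dF x.
Qed.

Lemma bmf_pdf_integrable (m s : R) (f : R -> R) : bmf f ->
  leb.-integrable setT (EFin \o (fun y => f y * normal_pdf m s y)).
Proof.
move=> [mf [M Mf]].
have mpdf : measurable_fun setT (normal_pdf m s) by exact: measurable_normal_pdf.
have H := integrableZl measurableT M (integrable_normal_pdf m s).
apply: (le_integrable _ _ _ H).
- exact: measurableT.
- by apply/measurable_EFinP; exact: measurable_funM.
- move=> y _ /=; rewrite lee_fin !normrM ler_wpM2r//.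
  by rewrite (le_trans (Mf y))// ler_norm.
Qed.

Lemma integral_normal_leb (m s : R) (f : R -> R) : bmf f ->
  \int[normal_prob m s]_y f y = \int[leb]_y (f y * normal_pdf m s y).
Proof.
move=> bf; have [mf [M Mf]] := bf.
have mpdf : measurable_fun setT (normal_pdf m s) by exact: measurable_normal_pdf.
have ipdf := integrable_normal_pdf m s.
have fM y : 0 <= f y + M by have := Mf y; rewrite ler_norml => /andP[]; lra.
have mfM : measurable_fun setT (fun y => (f y + M)%:E).
  by apply/measurable_EFinP; exact: measurable_funD.
have ifpdf := bmf_pdf_integrable m s bf.
have := @ge0_integral_normal_prob R m s (fun y => (f y + M)%:E) mfM.
move=> /(_ _)/wrap[y|]; first by rewrite lee_fin.
rewrite EFin_bmf; last by apply: bmfD; [split => //; exists M|exact: bmf_cst].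
rewrite bmf_intD; [|by split => //; exists M|exact: bmf_cst].
rewrite prob_int_cst.
rewrite (eq_integral (fun y : measurableTypeR R => (f y * normal_pdf m s y)%:E + M%:E * (normal_pdf m s y)%:E)%E); last first.
  by move=> y _; rewrite -!EFinM -EFinD mulrDl.
rewrite integralD//; last exact: integrableZl.
rewrite integralZl// integral_normal_pdf mule1.
rewrite -[X in (X + _)%E]fineK; last exact: integrable_fin_num.
by rewrite -EFinD => h; apply: (addIr M); exact: EFin_inj.
Qed.

Let phi (z : R) := normal_pdf 0 1 z.

Let phiE z : phi z = normal_peak 1 * expR (- z ^+ 2 / 2).
Proof.
by rewrite /phi normal_pdfE ?oner_neq0// /normal_fun subr0 expr1n.
Qed.

Let quartic (a : nat -> R) (z : R) :=
  a 0%N + a 1%N * z + a 2%N * z ^+ 2 + a 3%N * z ^+ 3 + a 4%N * z ^+ 4.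

(** Times the normal density, this is a primitive of [quartic a - mean a] times the normal density;
    [mean a] comes from the Gaussian moments 1, 0, 1, 0, 3. *)
Let primitive (a : nat -> R) (z : R) :=
  - (a 1%N + a 2%N * z + a 3%N * (z ^+ 2 + 2) + a 4%N * (z ^+ 3 + 3 * z)).

Let mean (a : nat -> R) := a 0%N + a 2%N + 3 * a 4%N.

Let is_derive_primitive a (z : R) :
  is_derive z 1 (fun z => primitive a z * phi z) ((quartic a z - mean a) * phi z).
Proof.
have -> : (fun z => primitive a z * phi z) =
    (fun z => primitive a z * (normal_peak 1 * expR (- z ^+ 2 / 2))).
  by apply/funext => y; rewrite phiE.
rewrite phiE /primitive.
apply: is_derive_eq.
rewrite /quartic /mean /GRing.scale /=.
by field.
Qed.

Let continuous_quartic a : continuous (fun z => (quartic a z - mean a) * phi z).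
Proof.
have -> : (fun z => (quartic a z - mean a) * phi z) =
    (fun z => (quartic a z - mean a) * (normal_peak 1 * expR (- z ^+ 2 / 2))).
  by apply/funext => y; rewrite phiE.
rewrite /quartic => z; apply: differentiable_continuous; apply/derivable1_diffP.
exact: ex_derive.
Qed.

Let primitive_bound a (z : R) : 1 <= `|z| ->
  `|primitive a z * phi z| <=
  16 * (`|a 1%N| + `|a 2%N| + 3 * `|a 3%N| + 4 * `|a 4%N|) / `|z|.
Proof.
move=> z1.
set C := `|a 1%N| + _ + _ + _.
have z0 : 0 < `|z| by lra.
have C0 : 0 <= C by rewrite /C !addr_ge0// mulr_ge0.
have sq : z ^+ 2 = `|z| ^+ 2 by rewrite -normrX ger0_norm// sqr_ge0.
have Qb : `|primitive a z| <= C * `|z| ^+ 3.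
  rewrite /primitive normrN.
  have t1 : `|a 1%N| <= `|a 1%N| * `|z| ^+ 3 by rewrite ler_peMr// exprn_ege1.
  have t2 : `|a 2%N * z| <= `|a 2%N| * `|z| ^+ 3.
    by rewrite normrM ler_wpM2l// -[leLHS]expr1 ler_weXn2l.
  have t3 : `|a 3%N * (z ^+ 2 + 2)| <= 3 * `|a 3%N| * `|z| ^+ 3.
    rewrite normrM mulrAC [leRHS]mulrC ler_wpM2l// sq ger0_norm; last by rewrite addr_ge0// sqr_ge0.
    have : `|z| ^+ 2 <= `|z| ^+ 3 by rewrite ler_weXn2l.
    have : 1 <= `|z| ^+ 3 by rewrite exprn_ege1.
    lra.
  have t4 : `|a 4%N * (z ^+ 3 + 3 * z)| <= 4 * `|a 4%N| * `|z| ^+ 3.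
    rewrite normrM mulrAC [leRHS]mulrC ler_wpM2l// (le_trans (ler_normD _ _))//.
    rewrite normrX normrM (ger0_norm (_ : 0 <= 3))//.
    have : `|z| <= `|z| ^+ 3 by rewrite -[leLHS]expr1 ler_weXn2l.
    lra.
  rewrite (le_trans (ler_normD _ _))// (le_trans (lerD (ler_normD _ _) (lexx _)))//.
  rewrite (le_trans (lerD (lerD (ler_normD _ _) (lexx _)) (lexx _)))//.
  by rewrite (le_trans (lerD (lerD (lerD t1 t2) t3) t4))// -!mulrDl.
have pb : phi z <= 16 / `|z| ^+ 4.
  rewrite phiE (@le_trans _ _ (expR (- z ^+ 2 / 2)))//.
    rewrite ler_piMl ?expR_ge0// /normal_peak expr1n mul1r invf_le1.
      rewrite -[leLHS]sqrtr1 ler_sqrt; last by rewrite mulrn_wge0// pi_ge0.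
      by have := @pi_ge2 R; rewrite -mulr_natr; lra.
    by rewrite sqrtr_gt0 mulrn_wgt0// pi_gt0.
  rewrite mulNr expRN.
  (* The square of exp (z^2 / 4) >= z^2 / 4; this is the origin of the constant 16. *)
  have e4 : (z ^+ 2 / 4) ^+ 2 <= expR (z ^+ 2 / 2).
    rewrite (_ : z ^+ 2 / 2 = z ^+ 2 / 4 + z ^+ 2 / 4); last by field.
    rewrite expRD -expr2 ler_sqr ?nnegrE ?expR_ge0 ?divr_ge0 ?sqr_ge0//.
    by rewrite (le_trans _ (expR_ge1Dx _))// lerDr.
  rewrite -[leRHS]invrK lef_pV2 ?posrE ?expR_gt0 ?invr_gt0 ?divr_gt0 ?exprn_gt0//.
  rewrite (le_trans _ e4)// le_eqVlt; apply/orP; left; apply/eqP.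
  by rewrite sq; field; rewrite gt_eqF.
rewrite normrM (ger0_norm (normal_pdf_ge0 _ _ _)).
rewrite (le_trans (ler_pM _ _ Qb pb))//; first by rewrite normal_pdf_ge0.
by rewrite le_eqVlt; apply/orP; left; apply/eqP; field; rewrite gt_eqF.
Qed.

(** Stated for a bounded [g] below a quartic, so that no unbounded function is integrated over the
    line: on [-n, n] the fundamental theorem of calculus bounds the integral of [g - mean a] by
    boundary terms, which tend to 0. *)
Lemma normal_moments_le (g : R -> R) (a0 a1 a2 a3 a4 : R) : bmf g ->
  (forall z, g z <= a0 + a1 * z + a2 * z ^+ 2 + a3 * z ^+ 3 + a4 * z ^+ 4) ->
  \int[N01]_z g z <= a0 + a2 + 3 * a4.
Proof.
move=> bg gq.
pose a n := [:: a0; a1; a2; a3; a4]`_n.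
have ga z : g z <= quartic a z by exact: gq.
pose B n : set R := `[- n.+1%:R, n.+1%:R]%classic.
have mB n : measurable (B n) by exact: measurable_itv.
have bB n : bmf (\1_(B n) : R -> R) by exact: bmf_indic.
have cvgB z : (fun n => (\1_(B n) z : R)) @ \oo --> (1 : R).
  apply: cvg_near_cst; near=> n.
  rewrite indicE mem_set// /B /= in_itv/= -ler_norml.
  rewrite (@le_trans _ _ n%:R)// ?ler_nat//.
  by near: n; exact: nbhs_infty_ger.
have [mg [M Mg]] := bg.
have cvgg : (fun n => \int[N01]_z (\1_(B n) z * (g z - mean a))) @ \oo -->
    \int[N01]_z (g z - mean a).
  apply: (bmf_cvg (M := M + `|mean a|) _ _ _ _).2.
  - by move=> n; apply: measurable_funM; [exact: (bB n).1|exact: measurable_funB].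
  - move=> n z; rewrite normrM ger0_norm// (le_trans (ler_piMl _ _))//.
    by rewrite (le_trans (ler_normB _ _))// lerD.
  - move=> z; rewrite -[X in _ --> X]mul1r; apply: cvgM; first exact: cvgB.
    exact: cvg_cst.
have step n : \int[N01]_z (\1_(B n) z * (g z - mean a)) <=
   primitive a n.+1%:R * phi n.+1%:R - primitive a (- n.+1%:R) * phi (- n.+1%:R).
  rewrite integral_normal_leb; last first.
    by apply: bmfM => //; apply: bmfB => //; exact: bmf_cst.
  have n0 : (0 : R) < n.+1%:R by rewrite ltr0n.
  have nn : - n.+1%:R < n.+1%:R :> R by rewrite gtrN.
  have := @FTC2_is_derive (fun z => primitive a z * phi z)
    (fun z => (quartic a z - mean a) * phi z) _ _ nn (is_derive_primitive a)
    (@continuous_quartic a).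
  move=> FTC.
  have iq : leb.-integrable (B n) (EFin \o (fun z => (quartic a z - mean a) * phi z)).
    apply: continuous_compact_integrable; first exact: segment_compact.
    by apply: continuous_subspaceT; exact: continuous_quartic.
  have E : \int[leb]_(y in B n) ((quartic a y - mean a) * phi y) =
      primitive a n.+1%:R * phi n.+1%:R - primitive a (- n.+1%:R) * phi (- n.+1%:R).
    by rewrite /Rintegral FTC.
  rewrite -E [leRHS]Rintegral_mkcond; apply: le_Rintegral.
  - exact: measurableT.
  - apply: bmf_pdf_integrable; apply: bmfM; first exact: bB.
    by apply: bmfB => //; exact: bmf_cst.
  - rewrite -restrict_EFin; apply/(integrable_mkcond _ _).1; [exact: mB|exact: iq].
  - move=> y _; rewrite patchE indicE; case: ifPn => _; last by rewrite !mul0r.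
    by rewrite mul1r ler_wpM2r ?normal_pdf_ge0// lerD2r.
have lim0 : (fun n => primitive a n.+1%:R * phi n.+1%:R -
    primitive a (- n.+1%:R) * phi (- n.+1%:R)) @ \oo --> (0 : R).
  set C := 16 * (`|a 1%N| + `|a 2%N| + 3 * `|a 3%N| + 4 * `|a 4%N|).
  have ch : (fun n => C * n.+1%:R^-1 : R) @ \oo --> (0 : R).
    by rewrite -(mulr0 C); apply: cvgM; [exact: cvg_cst|exact: cvg_harmonic].
  pose u (e : R) n : R := primitive a (e * n.+1%:R) * phi (e * n.+1%:R).
  have c1 (e : R) : `|e| = 1 -> u e @ \oo --> (0 : R).
    move=> e1; apply: norm_cvg0; apply: (squeeze_cvgr _ (cvg_cst (0 : R)) ch).
    apply: nearW => n; rewrite normr_ge0/=.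
    have := @primitive_bound a (e * n.+1%:R).
    by rewrite normrM e1 mul1r ger0_norm//; apply; rewrite ler1n.
  apply: (rcvg_eq (f := fun n => u 1 n - u (-1) n)).
    by move=> n; rewrite /u mul1r mulN1r.
  rewrite -[X in _ --> X](subr0 (0 : R)).
  by apply: rcvgB; apply: c1; rewrite ?normrN1 ?normr1.
have := ler_cvg_to cvgg lim0 (nearW _ step).
rewrite bmf_intB ?prob_int_cst//; last exact: bmf_cst.
by move=> h; rewrite -subr_le0; exact: h.
Unshelve. all: by end_near. Qed.

End gauss_moments.

(** * The Ornstein-Uhlenbeck transition operator, free and killed *)

Section OU_kernel.
Context {R : realType}.
Local Notation leb := (@lebesgue_measure R).
Local Notation N01 := (normal_prob (0 : R) 1).

(* The transition operator of the unkilled Ornstein-Uhlenbeck process: from [x],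
   after time [d], the law is normal with mean [exp(-d/2) x] and variance
   [1 - exp(-d)]. *)
Definition ouK (d : R) (f : R -> R) (x : R) : R :=
  \int[N01]_z f (expR (- d / 2) * x + Num.sqrt (1 - expR (- d)) * z).

Implicit Types (d x c a : R) (f g : R -> R).

Let shift d (z : R * R) := expR (- d / 2) * z.1 + Num.sqrt (1 - expR (- d)) * z.2.

Let bmf_shift d (f : R -> R) : bmf f -> bmf (fun z => f (shift d z)).
Proof.
move=> bf; apply: (bmf_comp bf).
by apply: measurable_funD; apply: measurable_funM.
Qed.

Lemma bmf_ouK d f : bmf f -> bmf (ouK d f).
Proof. by move=> bf; apply: (bmf_int2 N01 (bmf_shift d bf)). Qed.

Lemma bmf_ou_arg d x f : bmf f ->
  bmf (fun z : R => f (expR (- d / 2) * x + Num.sqrt (1 - expR (- d)) * z)).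
Proof. by move=> bf; exact: (bmf_pair1 (bmf_shift d bf)). Qed.

Lemma ouKD d f g x : bmf f -> bmf g ->
  ouK d (fun y => f y + g y) x = ouK d f x + ouK d g x.
Proof.
by move=> bf bg; rewrite /ouK bmf_intD//; exact: bmf_ou_arg.
Qed.

Lemma ouKZ d c f x : bmf f -> ouK d (fun y => c * f y) x = c * ouK d f x.
Proof. by move=> bf; rewrite /ouK bmf_intZ//; exact: bmf_ou_arg. Qed.

Lemma ouK_cst d c x : ouK d (fun=> c) x = c.
Proof. by rewrite /ouK prob_int_cst. Qed.

Lemma ouK_le d f g x : bmf f -> bmf g -> (forall y, f y <= g y) ->
  ouK d f x <= ouK d g x.
Proof.
by move=> bf bg fg; apply: bmf_le; [exact: bmf_ou_arg|exact: bmf_ou_arg|].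
Qed.

Lemma ouK_ge0 d f x : (forall y, 0 <= f y) -> 0 <= ouK d f x.
Proof. by move=> f0; exact: int_ge0. Qed.

(** The deviation [u] from the mean has second moment [1 - expR (- d)], fourth moment three times
    its square, and vanishing odd moments. Lower bounds follow by passing to the opposite
    function. *)
Lemma ouK_poly_le d f x a0 a1 a2 a3 a4 : 0 <= d -> bmf f ->
  let u y := y - expR (- d / 2) * x in
  (forall y, f y <= a0 + a1 * u y + a2 * u y ^+ 2 + a3 * u y ^+ 3 + a4 * u y ^+ 4) ->
  ouK d f x <= a0 + a2 * (1 - expR (- d)) + 3 * a4 * (1 - expR (- d)) ^+ 2.
Proof.
move=> d0 bf u fu; set th := 1 - _; set sg := Num.sqrt th.
have th0 : 0 <= th by rewrite subr_ge0 -expR0 ler_expR oppr_le0.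
have sg2 : sg ^+ 2 = th by rewrite sqr_sqrtr.
have := @normal_moments_le R (fun z => f (expR (- d / 2) * x + sg * z))
  a0 (a1 * sg) (a2 * sg ^+ 2) (a3 * sg ^+ 3) (a4 * sg ^+ 4).
move=> /(_ (bmf_ou_arg d x bf)) /(_ _)/wrap[z|].
  have uE : u (expR (- d / 2) * x + sg * z) = sg * z by rewrite /u; ring.
  apply: (le_trans (fu _)); rewrite uE le_eqVlt; apply/orP; left; apply/eqP.
  by ring.
by rewrite -/(ouK d f x) sg2 (_ : sg ^+ 4 = th ^+ 2) ?mulrA// -sg2 -exprM.
Qed.

Lemma ouK_density d f x : 0 < d -> bmf f ->
  ouK d f x = \int[leb]_y
    (f y * normal_pdf (expR (- d / 2) * x) (Num.sqrt (1 - expR (- d))) y).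
Proof.
move=> d0 bf.
have s0 : 0 < Num.sqrt (1 - expR (- d)).
  by rewrite sqrtr_gt0 subr_gt0 -expR0 ltr_expR oppr_lt0.
exact: etrans (esym (integral_normal_std _ s0 bf)) (integral_normal_leb _ _ bf).
Qed.

End OU_kernel.

(** * Comparison principles for the operator killed on a grid *)

Section killed_iterates.
Context {R : realType}.
Implicit Types (c d e x y rho : R) (f g F : R -> R) (n : nat).

Definition seg c : set R := `[- c, c]%classic.

Lemma segP c x : seg c x <-> `|x| <= c.
Proof. by rewrite /seg /= in_itv/= ler_norml. Qed.

Lemma measurable_seg c : measurable (seg c).
Proof. exact: measurable_itv. Qed.

(** One step of length [d], killed on arrival: the indicator bears on the new position only and the
    starting point is unconstrained, whence the hypotheses |x| <= c below. *)
Definition killK c d f : R -> R := ouK d (fun y => \1_(seg c) y * f y).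

Lemma bmf_restr c f : bmf f -> bmf (fun y => \1_(seg c) y * f y).
Proof. by move=> bf; apply: bmfM => //; apply: bmf_indic; exact: measurable_seg. Qed.

Lemma bmf_killK c d f : bmf f -> bmf (killK c d f).
Proof. by move=> bf; apply: bmf_ouK; exact: bmf_restr. Qed.

Lemma bmf_iter c d f n : bmf f -> bmf (iter n (killK c d) f).
Proof. by move=> bf; elim: n => //= n; exact: bmf_killK. Qed.

Lemma indic_seg c y : (\1_(seg c) y : R) = if `|y| <= c then 1 else 0.
Proof.
rewrite indicE; case: ifPn => h; first by rewrite mem_set//; apply/segP.
by rewrite memNset//; apply/segP/negP.
Qed.

Lemma killK_le c d f g x : bmf f -> bmf g ->
  (forall y, `|y| <= c -> f y <= g y) -> killK c d f x <= killK c d g x.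
Proof.
move=> bf bg fg; apply: ouK_le; [exact: bmf_restr|exact: bmf_restr|move=> y].
by rewrite indic_seg; case: ifPn => yc; rewrite ?mul0r// !mul1r fg.
Qed.

Lemma killKD c d f g x : bmf f -> bmf g ->
  killK c d (fun y => f y + g y) x = killK c d f x + killK c d g x.
Proof.
move=> bf bg; rewrite /killK -ouKD; [|exact: bmf_restr..].
by congr (ouK d _ x); apply/funext => y; rewrite mulrDr.
Qed.

Lemma killKZ c d a f x : bmf f ->
  killK c d (fun y => a * f y) x = a * killK c d f x.
Proof.
move=> bf; rewrite /killK -ouKZ; last exact: bmf_restr.
by congr (ouK d _ x); apply/funext => y; rewrite mulrCA.
Qed.

Lemma killK_cst_le c d a x : 0 <= a -> killK c d (fun=> a) x <= a.
Proof.
move=> a0; rewrite -[leRHS](ouK_cst d a x); apply: ouK_le.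
- exact/bmf_restr/bmf_cst.
- exact: bmf_cst.
- by move=> y; rewrite indic_seg; case: ifPn; rewrite ?mul1r ?mul0r.
Qed.

Lemma killK_ge0 c d f x : (forall y, `|y| <= c -> 0 <= f y) -> 0 <= killK c d f x.
Proof.
move=> f0; apply: ouK_ge0 => y; rewrite indic_seg.
by case: ifPn => yc; rewrite ?mul0r// mul1r f0.
Qed.

Lemma iter_killK_le c d f g n x : bmf f -> bmf g -> `|x| <= c ->
  (forall y, `|y| <= c -> f y <= g y) ->
  iter n (killK c d) f x <= iter n (killK c d) g x.
Proof.
move=> bf bg xc fg; elim: n x xc => [|n IH] x xc /=; first exact: fg.
by apply: killK_le => //; exact: bmf_iter.
Qed.

Lemma iter_killK_ge0 c d f n x : `|x| <= c ->
  (forall y, `|y| <= c -> 0 <= f y) -> 0 <= iter n (killK c d) f x.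
Proof.
by move=> xc f0; elim: n x xc => [|n IH] x xc /=; [exact: f0|exact: killK_ge0].
Qed.

Lemma iter_killKZ c d a f n x : bmf f ->
  iter n (killK c d) (fun y => a * f y) x = a * iter n (killK c d) f x.
Proof.
move=> bf; elim: n x => //= n IH x.
by rewrite (funext IH) killKZ//; exact: bmf_iter.
Qed.

(** A discrete maximum principle: an approximate supersolution of rate [rho] stays one under
    iteration. The one-step errors merely add up, because [rho <= 1] and killing does not increase
    nonnegative constants. *)
Lemma iter_killK_sup c d F rho e n x : bmf F -> 0 <= rho <= 1 -> 0 <= e ->
  (forall x, `|x| <= c -> killK c d F x <= rho * F x + e) -> `|x| <= c ->
  iter n (killK c d) F x <= rho ^+ n * F x + n%:R * e.
Proof.
move=> bF /andP[r0 r1] e0 H; elim: n x => [|n IH] x xc /=.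
  by rewrite expr0 mul1r mul0r addr0.
have bn : bmf (fun y => rho ^+ n * F y + n%:R * e).
  by apply: bmfD; [exact: bmfZ|exact: bmf_cst].
apply: (@le_trans _ _ (killK c d (fun y => rho ^+ n * F y + n%:R * e) x)).
  by apply: killK_le => //; exact: bmf_iter.
rewrite killKD; [|exact: bmfZ|exact: bmf_cst].
rewrite killKZ//.
have h1 := H x xc; have h2 := @killK_cst_le c d (n%:R * e) x (mulr_ge0 (ler0n _ _) e0).
apply: (le_trans (lerD (ler_wpM2l (exprn_ge0 n r0) h1) h2)).
rewrite mulrDr exprSr mulrA -addrA lerD2l -natr1 mulrDl mul1r addrC lerD2l.
by rewrite ler_piMl// exprn_ile1.
Qed.

Lemma iter_killK_sub c d F rho e n x : bmf F -> 0 <= rho <= 1 -> 0 <= e ->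
  (forall x, `|x| <= c -> rho * F x - e <= killK c d F x) -> `|x| <= c ->
  rho ^+ n * F x - n%:R * e <= iter n (killK c d) F x.
Proof.
move=> bF r01 e0 H xc.
have := @iter_killK_sup c d (fun y => -1 * F y) rho e n x (bmfZ _ bF) r01 e0.
move=> /(_ _ xc)/wrap[y yc|]; first by rewrite killKZ//; have := H y yc; lra.
by rewrite iter_killKZ//; lra.
Qed.

End killed_iterates.

(** * Explicit super- and subsolutions *)

Section polynomial_test_functions.
Context {R : realType}.
Implicit Types (c d e x y t : R) (f g F : R -> R) (n : nat).

Definition hfun x : R := 1 - x ^+ 2.

(** One step maps h to (1 - th) h and h^2 to (1 - th)^2 h^2 - 4 th (1 - th) h + 2 th (2 - th): the
    discrete forms of L h = - h and L (h^2) = 4 - 4 h - 2 h^2. The quartic around the mean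
    contributes 3 th^2. *)
Lemma ouK_hpoly_le d g x al be ga D : 0 <= d -> bmf g ->
  (forall y, g y <= al * hfun y ^+ 2 + be * hfun y + ga
    + D * (y - expR (- d / 2) * x) ^+ 4) ->
  forall th, th = 1 - expR (- d) ->
  ouK d g x <= al * ((1 - th) ^+ 2 * hfun x ^+ 2 - 4 * th * (1 - th) * hfun x
     + 2 * th * (2 - th)) + be * ((1 - th) * hfun x) + ga + 3 * D * th ^+ 2.
Proof.
move=> d0 bg H th thE; set m := expR (- d / 2) * x.
have := @ouK_poly_le R d g x (al * (1 - m ^+ 2) ^+ 2 + be * (1 - m ^+ 2) + ga)
  (- 4 * al * m * (1 - m ^+ 2) - 2 * be * m)
  (al * (6 * m ^+ 2 - 2) - be) (4 * al * m) (al + D) d0 bg.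
move=> /(_ _)/wrap[y|].
  apply: (le_trans (H y)); rewrite le_eqVlt; apply/orP; left; apply/eqP.
  by rewrite /hfun -/m; ring.
have q : 1 - th = expR (- d / 2) ^+ 2.
  by rewrite thE subKr -expRM_natl; congr expR; rewrite mulrA; field.
move=> h; apply: (le_trans h); rewrite -thE.
have mq : m ^+ 2 = (1 - th) * x ^+ 2 by rewrite q /m exprMn.
rewrite mq le_eqVlt; apply/orP; left; apply/eqP; rewrite /hfun; ring.
Qed.

End polynomial_test_functions.

Section iterate_estimates.
Context {R : realType}.
Implicit Types (c d e x y t kap : R) (f g F : R -> R) (n : nat).

(** Cutting h off outside [-1, 1] makes it bounded and nonnegative. *)
Definition hb x : R := \1_(seg 1) x * hfun x.

Lemma hbE x : `|x| <= 1 -> hb x = hfun x.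
Proof. by move=> x1; rewrite /hb indic_seg x1 mul1r. Qed.

Lemma hfun01 x : `|x| <= 1 -> 0 <= hfun x <= 1.
Proof.
move=> x1; have : x ^+ 2 <= 1 by rewrite -[leRHS](expr1n _ 2) -real_normK ?num_real// ler_sqr ?nnegrE.
by have := sqr_ge0 x; rewrite /hfun => *; apply/andP; split; lra.
Qed.

Lemma hb01 x : 0 <= hb x <= 1.
Proof.
rewrite /hb indic_seg; case: ifPn => [/hfun01|_]; first by rewrite mul1r.
by rewrite mul0r lexx ler01.
Qed.

Lemma measurable_hfun : measurable_fun setT (hfun : R -> R).
Proof. by apply: measurable_funB => //; exact: measurable_funX. Qed.

Lemma bmf_hb : bmf (hb : R -> R).
Proof.
apply: (@bmf_itv _ _ _ _ 0 1); last exact: hb01.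
apply: measurable_funM; last exact: measurable_hfun.
by apply: measurable_indic; exact: measurable_seg.
Qed.

(** The overshoot is of first order in |y| - 1, which no quartic dominates near |y| = 1: hence the
    additive [e]. As h < 0 here, h^2 - 3/2 h dominates the three expressions that occur below, - h,
    h^2 / 4 - 3/2 h and h^2 - 4/5 h. *)
Lemma quartic_tail e : 0 < e -> exists2 D, 0 <= D &
  forall m y, `|m| <= 1 -> 1 < `|y| ->
  (hfun y) ^+ 2 - 3 / 2 * hfun y <= e + D * (y - m) ^+ 4.
Proof.
(* With a = |y| - 1 the left-hand side is 3 a + 11/2 a^2 + 4 a^3 + a^4, hence at most 27/2 a if a <=
   del and at most 27/2 a^4 / del^3 otherwise; 14 and 15 leave some room. *)
move=> e0; pose del := Num.min 1 (e / 15).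
have del0 : 0 < del by rewrite lt_min ltr01 divr_gt0.
have del1 : del <= 1 by rewrite ge_min lexx.
have dele : del <= e / 15 by rewrite ge_min lexx orbT.
exists (14 / del ^+ 3); first by rewrite divr_ge0// exprn_ge0// ltW.
move=> m y m1 y1; pose a := `|y| - 1.
have a0 : 0 < a by rewrite subr_gt0.
have hE : hfun y = - (2 * a + a ^+ 2).
  by rewrite /hfun /a -(real_normK (num_real y)); ring.
have ay : a ^+ 4 <= (y - m) ^+ 4.
  have : a <= `|y - m| by have := lerB_dist y m; rewrite /a; lra.
  move=> /(lerXn2r 4); rewrite !nnegrE => /(_ (ltW a0) (normr_ge0 _)).
  by rewrite -normrX (ger0_norm (_ : 0 <= (y - m) ^+ 4))// exprn_even_ge0.
have D0 : 0 <= 14 / del ^+ 3 by rewrite divr_ge0// exprn_ge0// ltW.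
apply: (@le_trans _ _ (e + 14 / del ^+ 3 * a ^+ 4)); last by rewrite lerD2l ler_wpM2l.
rewrite hE; have [ad|ad] := leP a del.
  apply: (@le_trans _ _ e); last by rewrite lerDl mulr_ge0// exprn_ge0// ltW.
  have a1 : a <= 1 by lra.
  have a2 : a ^+ 2 <= a by rewrite expr2 ler_piMl// ltW.
  have a3 : a ^+ 3 <= a by rewrite exprS ler_piMr ?exprn_ile1// ltW.
  have a4 : a ^+ 4 <= a by rewrite exprS ler_piMr ?exprn_ile1// ltW.
  have -> : (- (2 * a + a ^+ 2)) ^+ 2 - 3 / 2 * - (2 * a + a ^+ 2) =
    4 * a ^+ 2 + 4 * a ^+ 3 + a ^+ 4 + 3 * a + 3 / 2 * a ^+ 2 by field.
  lra.
apply: (@le_trans _ _ (14 / del ^+ 3 * a ^+ 4)); last by rewrite lerDr ltW.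
have b1 : 1 <= a / del by rewrite ler_pdivlMr ?mul1r// ltW.
set b := a / del in b1.
have ab : a = b * del by rewrite /b divfK// gt_eqF.
have -> : 14 / del ^+ 3 * a ^+ 4 = 14 * del * b ^+ 4.
  by rewrite ab; field; rewrite gt_eqF.
have k4 k : (k <= 4)%N -> b ^+ k <= b ^+ 4 by move=> k4; rewrite ler_weXn2l.
have := k4 1%N isT; have := k4 2%N isT; have := k4 3%N isT; rewrite expr1 => b3 b2 b11.
have -> : (- (2 * a + a ^+ 2)) ^+ 2 - 3 / 2 * - (2 * a + a ^+ 2) =
  del * (11 / 2 * (del * b ^+ 2) + 4 * (del ^+ 2 * b ^+ 3) + del ^+ 3 * b ^+ 4 + 3 * b).
  by rewrite ab; field.
rewrite (_ : 14 * del * b ^+ 4 = del * (14 * b ^+ 4)); last by ring.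
apply: ler_wpM2l; first exact: ltW.
have d2 : del ^+ 2 <= 1 by rewrite exprn_ile1// ltW.
have d3 : del ^+ 3 <= 1 by rewrite exprn_ile1// ltW.
have bp k : 0 <= b ^+ k by rewrite exprn_ge0//; lra.
have := ler_wpM2r (bp 2%N) del1; have := ler_wpM2r (bp 3%N) d2.
have := ler_wpM2r (bp 4%N) d3; have := bp 4%N.
lra.
Qed.

Lemma ou_mean_le d x : 0 <= d -> `|x| <= 1 -> `|expR (- d / 2) * x| <= 1.
Proof.
move=> d0 x1; rewrite normrM (ger0_norm (expR_ge0 _)) mulr_ile1 ?expR_ge0//.
by rewrite -[leRHS]expR0 ler_expR; lra.
Qed.

Lemma theta01 d : 0 <= d -> 0 <= 1 - expR (- d) <= 1.
Proof.
move=> d0; have := expR_gt0 (- d); have : expR (- d) <= 1 by rewrite -[leRHS]expR0 ler_expR; lra.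
by move=> *; apply/andP; split; lra.
Qed.

(** [hb + e] is a supersolution of rate [expR (- d)]: where the killed function is 0, h + e + D (y -
    m)^4 is still nonnegative. The constant [e] does not decay at that rate, which costs e (1 - exp
    (- d)) per step. *)
Lemma iter_h_le e : 0 < e -> exists2 D, 0 <= D & forall c d n x,
  0 <= d -> c <= 1 -> `|x| <= c ->
  iter n (killK c d) hb x <= expR (- d) ^+ n * (hfun x + e) +
    n%:R * (e * (1 - expR (- d)) + 3 * D * (1 - expR (- d)) ^+ 2).
Proof.
move=> e0; have [D D0 HD] := quartic_tail e0; exists D => // c d n x d0 c1 xc.
have /andP[th0 th1] := theta01 d0; set th := 1 - _ in th0 th1 *.
have qE : expR (- d) = 1 - th by rewrite /th subKr.
have bF : bmf (fun y => hb y + e) by apply: bmfD; [exact: bmf_hb|exact: bmf_cst].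
apply: (@le_trans _ _ (iter n (killK c d) (fun y => hb y + e) x)).
  apply: iter_killK_le => //; first exact: bmf_hb.
  by move=> y _; rewrite lerDl ltW.
rewrite -hbE; last by lra.
apply: (iter_killK_sup (F := fun y => hb y + e)) => //.
- by rewrite qE subr_ge0 th1 gerBl.
- by rewrite addr_ge0 ?mulr_ge0 ?exprn_ge0// ltW.
move=> z zc; have z1 : `|z| <= 1 by lra.
have := @ouK_hpoly_le R d (fun y => \1_(seg c) y * (hb y + e)) z 0 1 e D d0 (bmf_restr _ bF).
move=> /(_ _)/wrap[y|].
  rewrite mul0r add0r mul1r.
  have D4 : 0 <= D * (y - expR (- d / 2) * z) ^+ 4 by rewrite mulr_ge0// exprn_even_ge0.
  rewrite indic_seg; case: ifPn => yc.
    by rewrite mul1r hbE; lra.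
  rewrite mul0r; have [y1|y1] := leP `|y| 1; first by have /andP[] := hfun01 y1; lra.
  have := HD _ _ (ou_mean_le d0 z1) y1.
  have := sqr_ge0 (hfun y); have : hfun y < 0.
    by rewrite /hfun subr_lt0 -(real_normK (num_real y)) exprn_egt1.
  lra.
move=> /(_ _ erefl)/le_trans; apply.
by rewrite -/th hbE// qE mul0r; lra.
Qed.

(** For the lower bound killing is harmless: [1 - e <= c ^+ 2] makes h - e nonpositive outside
    [-c, c], so that replacing it by 0 only increases it, and there is no quartic correction. *)
Lemma iter_h_ge e c d n x : 0 <= e -> 0 <= d -> 0 <= c <= 1 -> 1 - e <= c ^+ 2 -> `|x| <= c ->
  expR (- d) ^+ n * (hfun x - e) - n%:R * (e * (1 - expR (- d)))
    <= iter n (killK c d) hb x.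
Proof.
move=> e0 d0 /andP[c0 c1] ce xc.
have /andP[th0 th1] := theta01 d0; set th := 1 - _ in th0 th1 *.
have qE : expR (- d) = 1 - th by rewrite /th subKr.
have bF : bmf (fun y => hb y - e) by apply: bmfB; [exact: bmf_hb|exact: bmf_cst].
apply: (@le_trans _ _ (iter n (killK c d) (fun y => hb y - e) x)); last first.
  apply: iter_killK_le => //; first exact: bmf_hb.
  by move=> y _; rewrite gerBl.
rewrite -hbE; last by lra.
apply: (iter_killK_sub (F := fun y => hb y - e)) => //.
- by rewrite qE subr_ge0 th1 gerBl.
- by rewrite mulr_ge0.
move=> z zc; have z1 : `|z| <= 1 by lra.
have := @ouK_hpoly_le R d (fun y => -1 * (\1_(seg c) y * (hb y - e))) z 0 (-1) e 0 d0
  (bmfZ _ (bmf_restr _ bF)).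
move=> /(_ _)/wrap[y|].
  rewrite !mul0r add0r addr0 indic_seg; case: ifPn => yc.
    by rewrite mul1r hbE; lra.
  have : c ^+ 2 <= y ^+ 2.
    rewrite -(real_normK (num_real y)) ler_sqr ?nnegrE//.
    by rewrite ltW// ltNge.
  by rewrite /hfun; lra.
move=> /(_ _ erefl); rewrite ouKZ; last exact: bmf_restr.
by rewrite -/th hbE// -/(killK c d (fun y => hb y - e) z) qE mul0r; lra.
Qed.

Lemma iter_one_le1 c d n x : `|x| <= c -> iter n (killK c d) (fun _ : R => 1) x <= 1.
Proof.
move=> xc; rewrite -[leRHS](addr0 1).
have := @iter_killK_sup R c d (fun _ : R => 1) 1 0 n x (bmf_cst _ _).
rewrite ler01 lexx expr1n !mul1r mulr0; apply => // z zc.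
by rewrite addr0; exact: killK_cst_le.
Qed.

(** A Lyapunov argument: [F] loses at least [kap] at each step made alive, so [kap] times the
    expected number of such steps is at most [F]. Survival becomes less likely as the number of
    steps grows, whence the factor [n]. *)
Lemma iter_killK_drift c d F kap n x : bmf F -> 0 <= kap ->
  (forall x, `|x| <= c -> 0 <= F x) ->
  (forall x, `|x| <= c -> killK c d F x <= F x - kap) -> `|x| <= c ->
  n%:R * kap * iter n (killK c d) (fun _ : R => 1) x <= F x.
Proof.
move=> bF k0 F0 HF xc.
have b1 : bmf (fun _ : R => 1 : R) by exact: bmf_cst.
suff: n%:R * kap * iter n (killK c d) (fun _ : R => 1) x + iter n (killK c d) F x <= F x.
  by have := iter_killK_ge0 d n xc F0; lra.
elim: n x xc => [|n IH] x xc /=; first by rewrite !mul0r add0r.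
have bn : bmf (fun y => n%:R * kap * iter n (killK c d) (fun _ : R => 1) y).
  by apply: bmfZ; exact: bmf_iter.
have bFn : bmf (iter n (killK c d) F) by exact: bmf_iter.
have le1 : killK c d (iter n (killK c d) (fun _ : R => 1)) x <= 1.
  exact: (@iter_one_le1 c d n.+1).
have : killK c d (fun y => n%:R * kap * iter n (killK c d) (fun _ : R => 1) y +
     iter n (killK c d) F y) x <= killK c d F x.
  by apply: killK_le => //; exact: bmfD.
rewrite killKD// killKZ; last exact: bmf_iter.
have := HF x xc; have := ler_wpM2l k0 le1; rewrite -natr1; lra.
Qed.

(** L h = - h vanishes at the boundary, so h alone has no uniform drift; F = 3/2 h - 1/4 h^2
    satisfies L F = - 1 - h / 2 + h^2 / 2 <= - 1 on [-1, 1]. Half of this drift absorbs the term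
    th^2 / 2 of the exact mean, and the term with [D] is kept. *)
Lemma iter_1_le e : 0 < e -> exists2 D, 0 <= D & forall c d n x,
  0 <= d -> c <= 1 -> `|x| <= c -> 6 * D * (1 - expR (- d)) <= 1 ->
  n%:R * ((1 - expR (- d)) / 2 - 3 * D * (1 - expR (- d)) ^+ 2) *
    iter n (killK c d) (fun _ : R => 1) x <= 3 / 2 * hfun x + e.
Proof.
move=> e0; have [D D0 HD] := quartic_tail e0; exists D => // c d n x d0 c1 xc.
have /andP[th0 th1] := theta01 d0; set th := 1 - _ in th0 th1 *.
have qE : expR (- d) = 1 - th by rewrite /th subKr.
move=> Dth.
pose F y := 3 / 2 * hb y - 1 / 4 * (hb y * hb y) + e.
have bh := bmf_hb.
have bF : bmf F.
  apply: bmfD; last exact: bmf_cst.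
  by apply: bmfB; apply: bmfZ => //; exact: bmfM.
have k0 : 0 <= th / 2 - 3 * D * th ^+ 2.
  by have := ler_wpM2r th0 Dth; rewrite expr2; lra.
apply: (@le_trans _ _ (F x)); last first.
  rewrite /F hbE; last by lra.
  by have := sqr_ge0 (hfun x); rewrite expr2; lra.
apply: iter_killK_drift => //.
  move=> y yc; rewrite /F; have := hb01 y; move: (hb y) => h /andP[h0 h1].
  by have := mulr_ge0 h0 h0; have := ler_wpM2l h0 h1; lra.
move=> z zc; have z1 : `|z| <= 1 by lra.
have := @ouK_hpoly_le R d (fun y => \1_(seg c) y * F y) z (- (1 / 4)) (3 / 2) e D d0 (bmf_restr _ bF).
move=> /(_ _)/wrap[y|].
  have D4 : 0 <= D * (y - expR (- d / 2) * z) ^+ 4 by rewrite mulr_ge0// exprn_even_ge0.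
  rewrite indic_seg /F; case: ifPn => yc.
    by rewrite mul1r hbE; lra.
  rewrite mul0r; have [y1|y1] := leP `|y| 1.
    have /andP[h0 h1] := hfun01 y1.
    by have := ler_wpM2l h0 h1; rewrite -expr2; lra.
  have := HD _ _ (ou_mean_le d0 z1) y1.
  have := sqr_ge0 (hfun y).
  lra.
move=> /(_ _ erefl)/le_trans; apply.
rewrite -/th /F hbE//.
have /andP[] := hfun01 z1; move: (hfun z) => h h0 h1.
have hh := ler_wpM2l h0 h1; have hs := mulr_ge0 h0 h0.
have t1 : th * (h * h) <= th * h by rewrite ler_wpM2l// -[leRHS]mulr1.
have t2 : th ^+ 2 * (4 * h + h * h) >= 0 by rewrite mulr_ge0 ?exprn_ge0//; lra.
have t3 : th * th <= th by rewrite -[leRHS]mulr1 ler_wpM2l.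
have t4 : 0 <= th * h by rewrite mulr_ge0.
rewrite !expr2 in t2 *; lra.
Qed.

(** For f = h^2 - 4/5 h one has L f + 8 f = 4 - 48/5 h + 6 h^2 = 6 (h - 4/5)^2 + 4/25 > 0, so f is a
    subsolution of rate 8. It is nonpositive where 0 <= h <= 4/5, in particular for 1/2 <= |y| <= 1,
    so that killing there increases it. Finally f >= - 4/5 h bounds the initial value. *)
Lemma iter_h2_ge e : 0 < e -> exists2 D, 0 <= D & forall c d n x,
  0 <= d -> 1 / 2 <= c <= 1 -> `|x| <= c -> 100 * (1 - expR (- d)) <= 8 ->
  - expR (- 8 * d) ^+ n * (4 / 5 * hfun x + e) -
     n%:R * (8 * e * (1 - expR (- d)) + 3 * D * (1 - expR (- d)) ^+ 2) <=
  iter n (killK c d) (fun y => hb y * hb y - 4 / 5 * hb y) x.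
Proof.
move=> e0; have [D D0 HD] := quartic_tail e0; exists D => // c d n x d0 /andP[c0 c1] xc.
have /andP[th0 th1] := theta01 d0.
(* Bernoulli's inequality, by squaring three times with u^2 >= 2 u - 1; it turns the one-step rate 1
   - 8 th into exp (- 8 d). *)
have q8 : 1 - 8 * (1 - expR (- d)) <= expR (- 8 * d).
  have -> : expR (- 8 * d) = expR (- d) ^+ 8 by rewrite -expRM_natl; congr expR; ring.
  move: (expR (- d)) => q.
  have sq (u : R) : 2 * u - 1 <= u ^+ 2 by have := sqr_ge0 (u - 1); rewrite sqrrB; lra.
  have := sq q; have := sq (q ^+ 2); have := sq (q ^+ 4); rewrite -!exprM; lra.
set th := 1 - expR (- d) in th0 th1 q8 *.
have qE : expR (- d) = 1 - th by rewrite /th subKr.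
move=> th8.
pose f y := hb y * hb y - 4 / 5 * hb y.
have bh := bmf_hb.
have bf : bmf f by apply: bmfB; [exact: bmfM|exact: bmfZ].
have bF : bmf (fun y => f y - e) by apply: bmfB => //; exact: bmf_cst.
apply: (@le_trans _ _ (iter n (killK c d) (fun y => f y - e) x)); last first.
  apply: iter_killK_le => //.
  by move=> y _; rewrite /f gerBl ltW.
have K : (1 - 8 * th) ^+ n * (f x - e) - n%:R * (8 * e * th + 3 * D * th ^+ 2) <=
    iter n (killK c d) (fun y => f y - e) x.
  apply: (iter_killK_sub (F := fun y => f y - e)) => //.
  - by apply/andP; split; lra.
  - by rewrite addr_ge0 ?mulr_ge0 ?exprn_ge0// ltW.
  move=> z zc; have z1 : `|z| <= 1 by lra.
  have := @ouK_hpoly_le R d (fun y => -1 * (\1_(seg c) y * (f y - e))) z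
    (-1) (4 / 5) e D d0 (bmfZ _ (bmf_restr _ bF)).
  move=> /(_ _)/wrap[y|].
    have D4 : 0 <= D * (y - expR (- d / 2) * z) ^+ 4 by rewrite mulr_ge0// exprn_even_ge0.
    rewrite indic_seg /f; case: ifPn => yc.
      by rewrite mul1r hbE; lra.
    rewrite mul0r mulr0; have [y1|y1] := leP `|y| 1.
      have /andP[h0 h1] := hfun01 y1.
      have cy : (1 / 2) ^+ 2 <= y ^+ 2.
        rewrite -(real_normK (num_real y)) ler_sqr ?nnegrE//.
        by rewrite (le_trans c0)// ltW// ltNge.
      have h45 : hfun y <= 4 / 5 by move: cy; rewrite /hfun expr_div_n expr1n; lra.
      by have := ler_wpM2l h0 h45; rewrite -expr2; lra.
    have := HD _ _ (ou_mean_le d0 z1) y1.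
    have := sqr_ge0 (hfun y); have : hfun y < 0.
      by rewrite /hfun subr_lt0 -(real_normK (num_real y)) exprn_egt1.
    lra.
  move=> /(_ _ erefl); rewrite ouKZ; last exact: bmf_restr.
  rewrite -/th -/(killK c d (fun y => f y - e) z) /f hbE//.
  have /andP[] := hfun01 z1; move: (hfun z) => h h0 h1.
  have hh := ler_wpM2l h0 h1; have hs := mulr_ge0 h0 h0.
  have key : 0 <= th * (4 - 48 / 5 * h + 6 * h ^+ 2 + th * (h ^+ 2 + 4 * h - 2)).
    rewrite mulr_ge0//.
    have s : 4 - 48 / 5 * h + 6 * h ^+ 2 >= 4 / 25.
      have := sqr_ge0 (h - 4 / 5); rewrite sqrrB !expr2; lra.
    have u : th * (h ^+ 2 + 4 * h - 2) >= th * (-2).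
      by rewrite ler_wpM2l//; rewrite expr2; lra.
    lra.
  move: key; rewrite !expr2; lra.
apply: le_trans K; rewrite lerD2r.
have p0 : 0 <= 1 - 8 * th by lra.
have x1 : `|x| <= 1 by lra.
have /andP[h0 h1] := hfun01 x1.
have fx : - (4 / 5 * hfun x + e) <= f x - e.
  by rewrite /f hbE//; have := mulr_ge0 h0 h0; lra.
apply: (@le_trans _ _ ((1 - 8 * th) ^+ n * - (4 / 5 * hfun x + e))); last first.
  by rewrite ler_wpM2l// exprn_ge0.
rewrite [leLHS]mulNr mulrN lerN2 ler_wpM2r//; first by lra.
by rewrite lerXn2r ?nnegrE ?expR_ge0.
Qed.

End iterate_estimates.

Section restricted_measure.
Context {R : realType} d (T : measurableType d).
Variables (mu : {measure set T -> \bar R}) (D : set T).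
Hypotheses (mD : measurable D) (Doo : (mu D < +oo)%E).

Lemma integral_mfrestr (f : T -> R) : bmf f ->
  \int[mfrestr mD Doo]_x f x = \int[mu]_(x in D) f x.
Proof.
move=> bf; have [mf [M Mf]] := bf.
have fM x : 0 <= f x + M by have := Mf x; rewrite ler_norml => /andP[]; lra.
have iD g : bmf g -> mu.-integrable D (EFin \o g).
  move=> [mg [N Ng]]; apply: measurable_bounded_integrable => //.
    exact: measurable_funTS.
  exists N; split; first exact: num_real.
  by move=> K NK x _ /=; rewrite (le_trans (Ng x))// ltW.
have bM : bmf (fun x => f x + M) by apply: bmfD => //; exact: bmf_cst.
have E : (\int[mfrestr mD Doo]_x (f x + M)%:E = \int[mu]_(x in D) (f x + M)%:E)%E.
  rewrite (@ge0_integral_density _ _ _ mu _ \1_D) => //.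
  - rewrite [RHS]integral_mkcond; apply: eq_integral => x _.
    by rewrite patchE indicE; case: ifPn => _; rewrite ?mule1 ?mule0.
  - by move=> A mA; rewrite integral_indic// /= /mfrestr /mrestr setIC.
  - apply/measurable_EFinP; exact: bM.1.
have E2 : \int[mfrestr mD Doo]_x (f x + M) = \int[mu]_(x in D) (f x + M).
  by rewrite /Rintegral E.
move: E2; rewrite bmf_intD//; last exact: bmf_cst.
rewrite RintegralD//; [|exact: iD|exact/iD/bmf_cst].
rewrite bmf_int_cst Rintegral_cst//= /mfrestr /mrestr setTI.
exact: addIr.
Qed.

End restricted_measure.

(** * Reversibility of the killed operator on (-1, 1) *)

Section open_interval.
Context {R : realType}.
Local Notation leb := (@lebesgue_measure R).
Implicit Types (c d x y : R) (f g : R -> R) (n : nat).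

Lemma measurable_I : measurable (Iopen11 : set R).
Proof. exact: measurable_itv. Qed.

Lemma lebesgue_I : (leb (Iopen11 : set R) < +oo)%E.
Proof. by rewrite /Iopen11 lebesgue_measure_itv/=; case: ifPn => _; rewrite ltry. Qed.

Definition lamI : {finite_measure set (measurableTypeR R) -> \bar R} :=
  mfrestr (measurable_I : measurable (Iopen11 : set (measurableTypeR R))) lebesgue_I.

Lemma lamIE f : bmf f -> \int[lamI]_x f x = \int[leb]_(x in Iopen11) f x.
Proof. by move=> bf; apply: (@integral_mfrestr R _ (measurableTypeR R) leb Iopen11). Qed.

Lemma IP x : Iopen11 x <-> `|x| < 1.
Proof. by rewrite /Iopen11 /= in_itv/= ltr_norml. Qed.

Definition ou_pdf d x y := normal_pdf (expR (- d / 2) * x) (Num.sqrt (1 - expR (- d))) y.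

Lemma ou_sd_gt0 d : 0 < d -> 0 < Num.sqrt (1 - expR (- d)).
Proof. by move=> d0; rewrite sqrtr_gt0 subr_gt0 -[ltRHS]expR0 ltr_expR oppr_lt0. Qed.

Lemma ou_pdfE d x y : 0 < d -> ou_pdf d x y =
  normal_peak (Num.sqrt (1 - expR (- d))) *
  expR (- (y - expR (- d / 2) * x) ^+ 2 / (2 * (1 - expR (- d)))).
Proof.
move=> d0; have s0 := ou_sd_gt0 d0.
rewrite /ou_pdf normal_pdfE ?gt_eqF// /normal_fun; congr (_ * expR (_ / _)).
rewrite sqr_sqrtr ?mulr_natl//.
by rewrite subr_ge0 -[leRHS]expR0 ler_expR oppr_le0 ltW.
Qed.

(** Up to a constant, the stationary density of the unkilled process. *)
Definition gam x : R := expR (- x ^+ 2 / 2).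

(** Detailed balance: with q = exp (- d / 2), both exponents are - (x^2 - 2 q x y + y^2) / (2 (1 -
    q^2)). *)
Lemma gam_sym d x y : 0 < d -> gam x * ou_pdf d x y = gam y * ou_pdf d y x.
Proof.
move=> d0; rewrite !ou_pdfE// /gam mulrCA [RHS]mulrCA -!expRD.
congr (_ * expR _).
have q : expR (- d) = expR (- d / 2) ^+ 2.
  by rewrite -expRM_natl; congr expR; field.
have q1 : 1 - expR (- d) != 0.
  by rewrite subr_eq0 eq_sym lt_eqF// -[ltRHS]expR0 ltr_expR oppr_lt0.
by move: q1; rewrite q => q1; field.
Qed.

Lemma bmf_gam : bmf gam.
Proof.
apply: (@bmf_itv _ _ _ _ 0 1).
  apply: measurableT_comp => //; apply: measurable_funM => //.
  by apply: measurableT_comp => //; exact: measurable_funX.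
move=> x; rewrite expR_ge0/= -[leRHS]expR0 ler_expR.
by have := sqr_ge0 x; lra.
Qed.

Lemma bmf_ou_pdf d : 0 < d -> bmf (fun z : R * R => ou_pdf d z.1 z.2).
Proof.
move=> d0; apply: (@bmf_itv _ _ _ _ 0 (normal_peak (Num.sqrt (1 - expR (- d))))).
  rewrite (_ : (fun _ => _) = fun z : R * R => normal_peak (Num.sqrt (1 - expR (- d))) *
    expR (- (z.2 - expR (- d / 2) * z.1) ^+ 2 / (2 * (1 - expR (- d))))); last first.
    by apply/funext => z; rewrite ou_pdfE.
  apply: measurable_funM => //; apply: measurableT_comp => //.
  apply: measurable_funM => //; apply: measurableT_comp => //.
  apply: measurable_funX; apply: measurable_funB => //.
  exact: measurable_funM.
move=> z; rewrite normal_pdf_ge0 normal_pdf_ub// gt_eqF// ou_sd_gt0//.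
Qed.

Lemma ouK_lamI c d f x : 0 < d -> c < 1 -> bmf f ->
  killK c d f x = \int[lamI]_y (\1_(seg c) y * f y * ou_pdf d x y).
Proof.
move=> d0 c1 bf; rewrite lamIE; last first.
  by apply: bmfM; [exact: bmf_restr|exact: (bmf_pair1 (bmf_ou_pdf d0) x)].
rewrite /killK ouK_density//; last exact: bmf_restr.
rewrite [RHS]Rintegral_mkcond; apply: eq_Rintegral => y _.
rewrite patchE; case: ifPn => // /negP yI.
rewrite indic_seg; case: ifPn => yc; last by rewrite !mul0r.
by exfalso; apply: yI; apply/mem_set/IP; exact: le_lt_trans c1.
Qed.

(** The indicator in front of [g] constrains the departure as [killK] constrains the arrival;
    detailed balance then makes the double integral symmetric. *)
Lemma killK_sym c d f g : 0 < d -> c < 1 -> bmf f -> bmf g ->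
  \int[lamI]_x (gam x * (\1_(seg c) x * g x) * killK c d f x) =
  \int[lamI]_x (gam x * (\1_(seg c) x * f x) * killK c d g x).
Proof.
move=> d0 c1 bf bg.
have b1 := bmf_restr c bf; have b2 := bmf_restr c bg.
have bp x : bmf (fun y => ou_pdf d x y) by exact: (bmf_pair1 (bmf_ou_pdf d0) x).
have key f' g' : bmf f' -> bmf g' ->
  \int[lamI]_x (gam x * (\1_(seg c) x * g' x) * killK c d f' x) =
  \int[lamI]_x \int[lamI]_y
    ((gam x * (\1_(seg c) x * g' x)) * (\1_(seg c) y * f' y * ou_pdf d x y)).
  move=> bf' bg'; apply: eq_Rintegral => x _; rewrite ouK_lamI// bmf_intZ//.
  by apply: bmfM; [exact: bmf_restr|exact: bp].
rewrite (key _ _ bf bg) (key _ _ bg bf).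
rewrite (@bmf_Fubini _ _ _ _ _ lamI lamI (fun z : R * R =>
  (gam z.1 * (\1_(seg c) z.1 * g z.1)) * (\1_(seg c) z.2 * f z.2 * ou_pdf d z.1 z.2))); last first.
  have m1 : measurable_fun setT (fun z : R * R => z.1) by exact: measurable_fst.
  have m2 : measurable_fun setT (fun z : R * R => z.2) by exact: measurable_snd.
  apply: bmfM; first by apply: bmfM; [exact: (bmf_comp bmf_gam m1)|exact: (bmf_comp b2 m1)].
  by apply: bmfM; [exact: (bmf_comp b1 m2)|exact: bmf_ou_pdf].
apply: eq_Rintegral => y _; apply: eq_Rintegral => x _ /=.
transitivity ((\1_(seg c) x * g x) * (\1_(seg c) y * f y) * (gam x * ou_pdf d x y)).
  by ring.
by rewrite gam_sym//; ring.
Qed.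

Lemma iter_killK_sym c d f g n : 0 < d -> c < 1 -> bmf f -> bmf g ->
  \int[lamI]_x (gam x * (\1_(seg c) x * g x) * iter n (killK c d) f x) =
  \int[lamI]_x (gam x * (\1_(seg c) x * f x) * iter n (killK c d) g x).
Proof.
move=> d0 c1; elim: n f g => [|n IH] f g bf bg.
  by apply: eq_Rintegral => x _ /=; ring.
rewrite iterSr IH//; last exact: bmf_killK.
rewrite [RHS]/= [RHS]killK_sym//; last exact: bmf_iter.
by apply: eq_Rintegral => x _ /=; ring.
Qed.

End open_interval.

(** * Lower bound for the killed operator near the origin *)

Section minorization.
Context {R : realType}.
Local Notation leb := (@lebesgue_measure R).
Implicit Types (c d t x y z : R) (f g : R -> R) (n : nat).

Lemma ouK0 f x : ouK 0 f x = f x.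
Proof.
rewrite /ouK -[RHS](prob_int_cst (normal_prob (0 : R) 1)); apply: eq_Rintegral => z _.
by rewrite oppr0 mul0r expR0 mul1r subrr sqrtr0 mul0r addr0.
Qed.

(* Killing only loses the paths that have left [seg c], and by the semigroup
   property such a path contributes at most the supremum of the free transition
   operator outside [seg c]. *)
Lemma iter_killK_ge_free c d f n x B : 0 < d -> bmf f -> (forall y, 0 <= f y) ->
  (forall a b g y, 0 < a -> 0 < b -> bmf g -> ouK a (ouK b g) y = ouK (a + b) g y) ->
  0 <= B -> (forall y, c < `|y| -> f y = 0) ->
  (forall j z, (0 < j <= n)%N -> c < `|z| -> ouK (d *+ j) f z <= B) ->
  `|x| <= c ->
  ouK (d *+ n) f x - B <= iter n (killK c d) f x.
Proof.
move=> d0 bf f0 sg B0 supp; elim: n x => [|n IH] x Hn xc.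
  by rewrite mulr0n ouK0 /=; lra.
have bn : bmf (ouK (d *+ n) f) by exact: bmf_ouK.
have -> : ouK (d *+ n.+1) f x = ouK d (ouK (d *+ n) f) x.
  case: n IH Hn bn => [|n] IH Hn bn.
    by rewrite mulr0n mulr1n (funext (ouK0 f)).
  have dn : 0 < d *+ n.+1 by rewrite mulrn_wgt0.
  by rewrite (sg _ _ _ _ d0 dn bf) -mulrS.
rewrite /= lerBlDr -[X in _ <= _ + X](ouK_cst d B x) -ouKD; last 2 first.
- exact/bmf_restr/bmf_iter.
- exact: bmf_cst.
apply: ouK_le => //.
  by apply: bmfD; [exact/bmf_restr/bmf_iter|exact: bmf_cst].
move=> y; rewrite indic_seg; case: ifPn => yc.
  rewrite mul1r -lerBlDr; apply: IH => // j z /andP[j0 jn].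
  by apply: Hn; rewrite j0 (leq_trans jn).
rewrite mul0r add0r; move: yc; rewrite -ltNge => yc.
case: n {IH bn} Hn => [|n] Hn; first by rewrite mulr0n ouK0 supp.
by apply: Hn => //=.
Qed.

Let supp_int (F : R -> R) : (forall y, 1 / 10 < `|y| -> F y = 0) ->
  \int[leb]_y F y = \int[leb]_(y in seg (1 / 10)) F y.
Proof.
move=> F0; rewrite [RHS]Rintegral_mkcond; apply: eq_Rintegral => y _.
rewrite patchE; case: ifPn => // /negP yI; apply: F0; rewrite ltNge.
by apply/negP => y1; apply: yI; apply/mem_set/segP.
Qed.

Let seg_integrable f : bmf f -> leb.-integrable (seg (1 / 10)) (EFin \o f).
Proof.
move=> [mf [M Mf]]; apply: measurable_bounded_integrable.
- exact: measurable_seg.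
- by rewrite /= /seg lebesgue_measure_itv/=; case: ifPn => _; rewrite ?ltry.
- exact: measurable_funTS.
- exists M; split; first exact: num_real.
  by move=> N MN x _ /=; rewrite (le_trans (Mf x))// ltW.
Qed.

Let weighted_le f (p q : R -> R) : bmf f -> (forall y, 0 <= f y) ->
  (forall y, 1 / 10 < `|y| -> f y = 0) -> bmf p -> bmf q ->
  (forall y, `|y| <= 1 / 10 -> p y <= q y) ->
  \int[leb]_y (f y * p y) <= \int[leb]_y (f y * q y).
Proof.
move=> bf f0 supp bp bq pq.
rewrite !supp_int//; last 2 first.
  by move=> y /supp ->; rewrite mul0r.
  by move=> y /supp ->; rewrite mul0r.
apply: le_Rintegral.
- exact: measurable_seg.
- by apply: seg_integrable; exact: bmfM.
- by apply: seg_integrable; exact: bmfM.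
- by move=> y /segP y1; rewrite ler_wpM2l// pq.
Qed.

Let weighted_cst f k : bmf f -> (forall y, 1 / 10 < `|y| -> f y = 0) ->
  \int[leb]_y (f y * k) = k * \int[leb]_y f y.
Proof.
move=> bf supp; rewrite !supp_int//; last first.
  by move=> y /supp ->; rewrite mul0r.
by rewrite [RHS]mulrC; apply: RintegralZr; [exact: measurable_seg|exact: seg_integrable].
Qed.

Lemma normal_peakE (s : R) : 0 < s -> normal_peak s = normal_peak 1 / s.
Proof.
move=> s0; rewrite /normal_peak expr1n mul1r -mulrnAr sqrtrM ?sqr_ge0//.
by rewrite sqrtr_sqr gtr0_norm// invfM mulrC.
Qed.

(** Reaching |y| <= 1/10 from |x| <= 1/2 at time [t] is at least twice as likely as from |z| >=
    19/20 at any time up to [t]. The distances to the mean, at most 3/5 and at least 4/5, give the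
    exponents 9/50 and 8/25 over the variance. The factor 2 leaves something once the killed paths
    are subtracted. *)
Lemma ouK_free_bounds t : 0 < t -> 100 * t <= 7 -> exists2 kap, 0 < kap &
  (forall f x, bmf f -> (forall y, 0 <= f y) -> (forall y, 1 / 10 < `|y| -> f y = 0) ->
     `|x| <= 1 / 2 -> 2 * kap * \int[leb]_y f y <= ouK t f x) /\
  (forall f r z, bmf f -> (forall y, 0 <= f y) -> (forall y, 1 / 10 < `|y| -> f y = 0) ->
     0 < r -> r <= t -> 19 / 20 <= `|z| ->
     ouK r f z <= kap * \int[leb]_y f y).
Proof.
move=> t0 t7; set V := fun r : R => 1 - expR (- r).
have V0 r : 0 < r -> 0 < V r by move=> r0; rewrite subr_gt0 -[ltRHS]expR0 ltr_expR oppr_lt0.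
have Vr r : V r <= r by have := expR_ge1Dx (- r); rewrite /V; lra.
have VV r : r <= t -> V r <= V t by move=> rt; rewrite lerB// ler_expR lerN2.
set sd := fun r : R => Num.sqrt (V r).
have sd0 r : 0 < r -> 0 < sd r by exact: ou_sd_gt0.
have sdV r : 0 < r -> V r = sd r ^+ 2 by move=> r0; rewrite sqr_sqrtr// ltW// V0.
pose P1 : R := normal_peak 1.
have P10 : 0 < P1 by rewrite normal_peak_gt0// oner_neq0.
(* Half the normal density at time [t] at distance 3/5 from the mean. *)
pose kap := P1 / sd t * expR (- (9 / 50) / V t) / 2.
exists kap; first by rewrite divr_gt0// mulr_gt0 ?expR_gt0// divr_gt0// sd0.
have bpdf r x : 0 < r -> bmf (fun y => ou_pdf r x y).
  by move=> r0; exact: (bmf_pair1 (bmf_ou_pdf r0) x).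
have ouKE r f x : 0 < r -> bmf f -> ouK r f x = \int[leb]_y (f y * ou_pdf r x y).
  by move=> r0 bf; exact: ouK_density.
split.
  move=> f x bf f0 supp x2.
  rewrite (ouKE _ _ _ t0 bf) -(weighted_cst _ bf supp); apply: weighted_le => //.
  - exact: bmf_cst.
  - exact: bpdf.
  move=> y y1; rewrite ou_pdfE// normal_peakE ?sd0// /kap.
  have dbl (u : R) : 2 * (u / 2) = u by field.
  rewrite dbl -/P1 -/(V t) -/(sd t).
  apply: ler_wpM2l; first by apply: ltW; rewrite divr_gt0// sd0.
  rewrite ler_expR.
  have : `|y - expR (- t / 2) * x| <= 3 / 5.
    have m1 : `|expR (- t / 2) * x| <= `|x|.
      by rewrite normrM (ger0_norm (expR_ge0 _)) ler_piMl// -[leRHS]expR0 ler_expR; lra.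
    by rewrite (le_trans (ler_normB _ _))//; lra.
  have := V0 _ t0; move: (V t) => v v0 => yx.
  have y2 : (y - expR (- t / 2) * x) ^+ 2 <= 9 / 25.
    rewrite -(real_normK (num_real _)) (_ : 9 / 25 = (3 / 5) ^+ 2) ?ler_sqr ?nnegrE//.
    by field.
  rewrite [leLHS]mulNr [leRHS]mulNr lerN2 ler_pdivrMr ?mulr_gt0// (_ : _ / v * _ = 9 / 25)//.
  by field; rewrite gt_eqF.
move=> f r z bf f0 supp r0 rt zc.
rewrite (ouKE _ _ _ r0 bf) -(weighted_cst _ bf supp); apply: weighted_le => //.
- exact: bpdf.
- exact: bmf_cst.
move=> y y1; rewrite ou_pdfE// normal_peakE ?sd0// -/P1.
have e80 : expR (- (y - expR (- r / 2) * z) ^+ 2 / (2 * V r)) <= expR (- (8 / 25) / V r).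
  have yz : 4 / 5 <= `|y - expR (- r / 2) * z|.
    (* 193/200 is 1 - t/2 at t = 7/100, and 193/200 times 19/20 exceeds 4/5 + 1/10. *)
    have e95 : 193 / 200 <= expR (- r / 2) by have := expR_ge1Dx (- r / 2); lra.
    have : 193 / 200 * (19 / 20) <= `|expR (- r / 2) * z|.
      have c1 : 0 <= 193 / 200 :> R by lra.
      have c2 : 0 <= 19 / 20 :> R by lra.
      by rewrite normrM (ger0_norm (expR_ge0 _)); exact: (ler_pM c1 c2 e95 zc).
    by have := lerB_dist (expR (- r / 2) * z) y; rewrite distrC; lra.
  have := V0 _ r0; move: (V r) => v v0.
  have y2 : 16 / 25 <= (y - expR (- r / 2) * z) ^+ 2.
    rewrite -(real_normK (num_real (y - _))) (_ : 16 / 25 = (4 / 5) ^+ 2) ?ler_sqr ?nnegrE//.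
    by field.
  rewrite ler_expR [leLHS]mulNr [leRHS]mulNr lerN2 ler_pdivlMr ?mulr_gt0// (_ : _ / v * _ = 16 / 25)//.
  by field; rewrite gt_eqF.
apply: (@le_trans _ _ (P1 / sd r * expR (- (8 / 25) / V r))).
  by apply: ler_wpM2l => //; apply: ltW; rewrite divr_gt0// sd0.
have mono : expR (- (9 / 50) / V r) <= expR (- (9 / 50) / V t).
  by rewrite ler_expR !mulNr lerN2 ler_pM2l// lef_pV2 ?posrE ?V0// VV.
(* The surplus 7/50 = 8/25 - 9/50 in the exponent compensates the ratio of the standard deviations a
   <= b: as exp u >= u, it suffices that a b <= 7/100, and a b is at most the variance at time
   [t]. *)
have half : expR (- (8 / 25) / V r) / sd r <= expR (- (9 / 50) / V r) / sd t / 2.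
  have := sd0 _ r0; have := sd0 _ t0; have := VV _ rt; have := Vr t.
  rewrite (sdV _ r0) (sdV _ t0); move: (sd r) (sd t) => a b bt ab b0 a0.
  have a_b : a <= b by move: ab; rewrite ler_sqr ?nnegrE; [|exact: ltW|exact: ltW].
  have ab7 : a * b <= 7 / 100.
    by have := ler_wpM2r (ltW b0) a_b; rewrite -expr2; lra.
  have e1 : 7 / 50 / a ^+ 2 <= expR (7 / 50 / a ^+ 2).
    by rewrite (le_trans _ (expR_ge1Dx _))// lerDr.
  rewrite (_ : - (9 / 50) / a ^+ 2 = - (8 / 25) / a ^+ 2 + 7 / 50 / a ^+ 2); last first.
    by field; rewrite gt_eqF.
  rewrite expRD; move: e1; set E := expR (7 / 50 / _) => e1.
  have k : a^-1 <= E / b / 2.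
    rewrite ler_pdivlMr// ler_pdivlMr//; apply: le_trans e1.
    rewrite ler_pdivlMr ?exprn_gt0// (_ : _ * b * _ = 2 * (a * b)); first by lra.
    by field; rewrite gt_eqF.
  rewrite (_ : _ * E / b / 2 = expR (- (8 / 25) / a ^+ 2) * (E / b / 2)); last by ring.
  by apply: ler_wpM2l => //; exact: expR_ge0.
have s1 : 0 <= (sd t)^-1 by rewrite invr_ge0 ltW// sd0.
have := ler_wpM2r s1 mono; rewrite /kap; move: half.
set E1 := expR _; set E2 := expR _; set E3 := expR _ => half m2.
rewrite (_ : P1 / sd r * E1 = P1 * (E1 / sd r)); last by ring.
rewrite (_ : P1 / sd t * E3 / 2 = P1 * (E3 / sd t / 2)); last by ring.
by apply: ler_wpM2l; [exact: ltW|lra].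
Qed.

End minorization.

(** * From Brownian increments to iterated kernels *)

Section independent_increments.
Context {R : realType} (d : measure_display) (Omega : measurableType d)
  (P : probability Omega R) (W : R -> Omega -> R) (hW : is_std_BM P W).

Lemma BM_measurable t : 0 <= t -> measurable_fun setT (W t).
Proof. by case: hW => h _; exact: h. Qed.

Lemma BM_0 w : W 0 w = 0.
Proof. by case: hW => _ [h _]; exact: h. Qed.

Lemma measurable_preimT d' (T : measurableType d') (f : Omega -> T) (A : set T) :
  measurable_fun setT f -> measurable A -> measurable (f @^-1` A).
Proof. by move=> mf mA; rewrite -[X in measurable X]setTI; exact: mf. Qed.

(** Meant for [G1] the past together with conditions on later increments and [G2] the past alone:
    both integrals depend only on the law of [X] on these events, and the two laws are
    proportional. *)
Lemma bmf_scale_law d' (T : measurableType d') (G1 G2 : set Omega) (X : Omega -> T)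
  (p : R) (phi : T -> R) : measurable G1 -> measurable G2 -> measurable_fun setT X ->
  0 <= p -> (forall B, measurable B -> P (G1 `&` X @^-1` B) = (p%:E * P (G2 `&` X @^-1` B))%E) ->
  bmf phi ->
  \int[P]_w (\1_G1 w * phi (X w)) = p * \int[P]_w (\1_G2 w * phi (X w)).
Proof.
move=> mG1 mG2 mX p0 H bphi; have [mphi [M Mphi]] := bphi.
have poo (G : set Omega) : measurable G -> (P G < +oo)%E.
  by move=> mG; rewrite (le_lt_trans (probability_le1 P mG)) ?ltry.
pose m1 := image_measure (mfrestr mG1 (poo _ mG1)) mX.
pose m2 := image_measure (mfrestr mG2 (poo _ mG2)) mX.
have mI G (mG : measurable G) (f : T -> R) : bmf f ->
    \int[image_measure (mfrestr mG (poo _ mG)) mX]_x f x =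
    \int[P]_w (\1_G w * f (X w)).
  move=> bf; have [mf [N Nf]] := bf.
  have b1 : bmf (\1_G : Omega -> R) by exact: bmf_indic.
  have f0 y : 0 <= f y + N by have := Nf y; rewrite ler_norml => /andP[]; lra.
  have bfX : bmf (fun w => f (X w)) by exact: bmf_comp.
  have E : (\int[image_measure (mfrestr mG (poo _ mG)) mX]_x (f x + N)%:E =
      \int[P]_w (\1_G w * f (X w) + N * \1_G w)%:E)%E.
    rewrite ge0_integral_image//; last first.
      by apply/measurable_EFinP; exact: measurable_funD.
    rewrite (@ge0_integral_density _ _ _ P _ \1_G) => //.
    - by apply: eq_integral => w _; rewrite -EFinM; congr EFin; ring.
    - by move=> A mA; rewrite integral_indic// /= /mfrestr /mrestr setIC.
    - by apply/measurable_EFinP; apply: measurable_funD => //; exact: bfX.1.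
    - by move=> w; rewrite lee_fin.
  have E2 : \int[image_measure (mfrestr mG (poo _ mG)) mX]_x (f x + N) =
    \int[P]_w (\1_G w * f (X w) + N * \1_G w) by rewrite /Rintegral E.
  move: E2; rewrite !bmf_intD//; [|exact: bmfM|exact: bmfZ|exact: bmf_cst].
  rewrite bmf_intZ// bmf_int_cst => h.
  have h2 : N * fine (image_measure (mfrestr mG (poo _ mG)) mX setT) = N * \int[P]_x \1_G x.
    rewrite /image_measure /pushforward /= /mfrestr /mrestr preimage_setT setTI.
    by rewrite /Rintegral integral_indic// setIT.
  by move: h; rewrite h2; exact: addIr.
rewrite -!mI//.
have f0 y : 0 <= phi y + M by have := Mphi y; rewrite ler_norml => /andP[]; lra.
have bM : bmf (fun y => phi y + M) by apply: bmfD => //; exact: bmf_cst.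
have E : (\int[m1]_x (phi x + M)%:E = \int[m2]_x (p * (phi x + M))%:E)%E.
  rewrite (@ge0_integral_density _ _ _ m2 _ (fun=> p)) => //.
  - by apply: eq_integral => y _; rewrite -EFinM mulrC.
  - move=> A mA; rewrite integral_cst// /m1 /m2 /image_measure /pushforward /=.
    by rewrite /mfrestr /mrestr setIC H// setIC.
  - by apply/measurable_EFinP; exact: bM.1.
have E2 : \int[m1]_x (phi x + M) = \int[m2]_x (p * (phi x + M)).
  by rewrite /Rintegral E.
have E3 : M * fine (m1 setT) = p * (M * fine (m2 setT)).
  rewrite /m1 /m2 /image_measure /pushforward /= /mfrestr /mrestr preimage_setT !setTI.
  have := H setT measurableT; rewrite preimage_setT !setIT => ->.
  rewrite fineM//; last by rewrite fin_num_measure.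
  by rewrite mulrCA.
move: E2; rewrite bmf_intZ// !bmf_intD//; try exact: bmf_cst.
by rewrite !bmf_int_cst mulrDr E3; exact: addIr.
Qed.

Variable ts : nat -> R.
Hypotheses (ts0 : ts 0%N = 0) (tsS : forall i, ts i < ts i.+1).

Let ts_ge0 i : 0 <= ts i.
Proof. by elim: i => [|i IH]; rewrite ?ts0// (le_trans IH)// ltW. Qed.

Definition incr i w := W (ts i.+1) w - W (ts i) w.
Definition incr_law i : probability (measurableTypeR R) R :=
  normal_prob 0 (Num.sqrt (ts i.+1 - ts i)).

Let m_incr i : measurable_fun setT (incr i).
Proof. by apply: measurable_funB; exact: BM_measurable. Qed.

(** Conditions on the values of [W] up to index [k], whereas [future] bears on the increments with
    index from [k] to [m - 1]: the Markov property concerns values, the definition of Brownian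
    motion increments. *)
Definition past k (A : nat -> set R) : set Omega :=
  \bigcap_(j in `I_k.+1) [set w | A j (W (ts j) w)].

Definition future k m (C : nat -> set R) : set Omega :=
  \bigcap_(i in `I_m) [set w | (k <= i)%N -> C i (incr i w)].

Lemma measurable_past k A : (forall j, measurable (A j)) -> measurable (past k A).
Proof.
move=> mA; apply: bigcap_measurable; first by exists 0%N.
move=> j _; apply: (measurable_preimT (f := W (ts j))) => //; exact: BM_measurable.
Qed.

Lemma measurable_future k m C : (forall j, measurable (C j)) -> measurable (future k m C).
Proof.
move=> mC; have [->|m0] := eqVneq m 0%N.
  rewrite /future (_ : `I_0 = set0) ?bigcap_set0; first exact: measurableT.
  by apply/seteqP; split.
apply: bigcap_measurable; first by exists 0%N; rewrite /= lt0n.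
move=> j _; have [kj|kj] := leqP k j.
  rewrite (_ : [set w | _] = incr j @^-1` C j); first exact: measurable_preimT.
  by apply/seteqP; split => w /=; [apply|move=> ? _].
rewrite (_ : [set w | _] = setT); first exact: measurableT.
by apply/seteqP; split => w //= _; rewrite leqNgt kj.
Qed.

Lemma pastS k A : past k.+1 A = past k A `&` [set w | A k.+1 (W (ts k.+1) w)].
Proof.
apply/seteqP; split => w.
  move=> h; split; last by apply: h => /=.
  by move=> j /= jk; apply: h => /=; rewrite ltnW.
move=> [h hk] j /=; rewrite ltnS leq_eqVlt => /predU1P[->//|jk]; exact: h.
Qed.

(** The induction on [k] turns one value at a time into increments: the value at index [k + 1] is
    the value at index [k] plus [incr k], and freezing integrates out [incr k] while the conditions
    on later increments stay in the event. [A], [C] and [m] are general because the step uses the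
    induction hypothesis with modified sets. *)
Lemma past_future_indep k m A C : (forall j, measurable (A j)) ->
  (forall j, measurable (C j)) ->
  P (past k A `&` future k m C) =
  (P (past k A) * \prod_(i < m) (if (k <= i)%N then incr_law i (C i) else 1))%E.
Proof.
elim: k m A C => [|k IH] m A C mA mC.
  have mF := measurable_future 0 m mC.
  have PF : P (future 0 m C) =
      (\prod_(i < m) (if (0 <= i)%N then incr_law i (C i) else 1))%E.
    have [_ [_ [_ h]]] := hW; rewrite /future.
    have := h m ts C; rewrite ts0 lexx => /(_ isT tsS mC) <-; congr (P _).
    by apply/seteqP; split => w hw j jm; [exact: hw|move=> _; exact: hw].
  have past0 : past 0 A = setT \/ past 0 A = set0.
    have [a0|a0] := pselect (A 0%N 0); [left|right]; apply/seteqP; split => w //=.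
      by move=> _ j /=; rewrite ltnS leqn0 => /eqP ->; rewrite ts0 BM_0.
    by move=> /(_ 0%N) /= /(_ isT); rewrite ts0 BM_0.
  case: past0 => ->; first by rewrite setTI probability_setT mul1e.
  by rewrite set0I measure0 mul0e.
pose p := fine (\prod_(i < m) (if (k.+1 <= i)%N then incr_law i (C i) else 1))%E.
have pE n l (D : nat -> set R) : (forall j, measurable (D j)) ->
    ((\prod_(i < n) (if (l <= i)%N then incr_law i (D i) else 1)) \is a fin_num)%E.
  move=> mD; elim/big_ind: _ => //; first by move=> x y; exact: fin_numM.
  by move=> i _; case: ifP => // _; apply: fin_num_measure; exact: mD.
have p0 : 0 <= p.
  rewrite fine_ge0//; elim/big_ind: _ => //; first by move=> x y; exact: mule_ge0.
  by move=> i _; case: ifP.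
have peE : p%:E = (\prod_(i < m) (if (k.+1 <= i)%N then incr_law i (C i) else 1))%E.
  by rewrite fineK// pE.
(* the joint law of [W_k] and the next increment on the past, with or without
   conditions on the later increments *)
have rect B D m' : measurable B -> measurable D ->
  P (past k A `&` future k.+1 m' C `&` (W (ts k) @^-1` B) `&` (incr k @^-1` D)) =
  (P (past k A `&` (W (ts k) @^-1` B)) * incr_law k D *
    \prod_(i < m') (if (k.+1 <= i)%N then incr_law i (C i) else 1))%E.
  move=> mB mD.
  pose A' j := if j == k then A j `&` B else A j.
  have mA' j : measurable (A' j).
    by rewrite /A'; case: ifP => // _; exact: measurableI.
  pose C' j := if j == k then D else if (j < m')%N then C j else setT.
  have mC' j : measurable (C' j).
    by rewrite /C'; case: ifP => // _; case: ifP.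
  have pA' : past k A `&` (W (ts k) @^-1` B) = past k A'.
    apply/seteqP; split => w.
      move=> [h b] j jk; rewrite /= /A'; case: ifP => [/eqP ->|_]; last exact: h.
      by split => //; exact: (h k (ltnSn k)).
    move=> h; split; last by have := h k (ltnSn k); rewrite /= /A' eqxx => -[].
    by move=> j jk; have := h j jk; rewrite /= /A'; case: ifP => // _ [].
  (* When [m' <= k], the increment [incr k] is not among those of the event; the range is extended
     to [k.+1], and indices from [m'] on other than [k] carry the full set. *)
  have fC' : future k.+1 m' C `&` (incr k @^-1` D) = future k (maxn m' k.+1) C'.
    apply/seteqP; split => w.
      move=> [h b] j jm kj; rewrite /C'; case: ifPn => [/eqP ->//|jk].
      case: ifPn => // jm'; apply: h => //.
      by rewrite ltn_neqAle eq_sym jk.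
    move=> h; split; last first.
      by have := h k; rewrite /= leq_max ltnSn orbT => /(_ isT (leqnn k)); rewrite /C' eqxx.
    move=> j jm' kj; have := h j; rewrite /= leq_max jm' => /(_ isT (ltnW kj)).
    by rewrite /C' gtn_eqF// jm'.
  rewrite (setIAC (past k A)) pA' -setIA fC' IH// -muleA; congr (_ * _)%E.
  rewrite -(big_mkord xpredT (fun i => if (k <= i)%N then incr_law i (C' i) else 1%E)).
  rewrite -(big_mkord xpredT (fun i => if (k < i)%N then incr_law i (C i) else 1%E)).
  rewrite (@big_cat_nat _ _ _ k.+1) ?leq_maxr//= big_nat_recr//=.
  have C'k : C' k = D by rewrite /C' eqxx.
  rewrite leqnn C'k big1_seq ?mul1e; last first.
    by move=> i /=; rewrite mem_index_iota /= => ik; rewrite leqNgt ik.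
  congr (_ * _)%E.
  have [mk|mk] := leqP m' k.+1.
    rewrite big_geq// big1_seq// => i /=; rewrite mem_index_iota /= => im.
    by rewrite ltnNge -ltnS (leq_trans im mk).
  rewrite [RHS](@big_cat_nat _ _ _ k.+1) ?(ltnW mk)//= [X in (X * _)%E]big1_seq ?mul1e; last first.
    by move=> i /=; rewrite mem_index_iota /= ltnS => ik; rewrite ltnNge ik.
  rewrite big_nat_cond [RHS]big_nat_cond; apply: eq_bigr => i /andP[/andP[ki im] _].
  by rewrite ki ltnW// /C' gtn_eqF// im.
pose X w := (W (ts k) w : R); pose Y := incr k.
have mX : measurable_fun setT X by exact: BM_measurable.
have mY : measurable_fun setT Y by exact: m_incr.
pose F (z : R * R) : R := \1_(A k.+1) (z.1 + z.2).
have bF : bmf F.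
  apply: (bmf_comp (g := fun z : R * R => z.1 + z.2)); first exact: bmf_indic.
  by apply: measurable_funD; [exact: measurable_fst|exact: measurable_snd].
have mpk := measurable_past k mA; have mfk m' := measurable_future k.+1 m' mC.
have PE (G : set Omega) : measurable G ->
    P (G `&` [set w | A k.+1 (W (ts k.+1) w)]) = (\int[P]_w (\1_G w * F (X w, Y w)))%:E.
  move=> mG; have mAk : measurable [set w | A k.+1 (W (ts k.+1) w)].
    by apply: (measurable_preimT (f := W (ts k.+1))) => //; exact: BM_measurable.
  rewrite -EFin_bmf; last first.
    apply: bmfM; first exact: bmf_indic.
    by apply: (bmf_comp bF); exact: measurable_fun_pair.
  rewrite -(setIT (G `&` _)) -integral_indic ?setIT//; last exact: measurableI.
  apply: eq_integral => w _; congr EFin.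
  rewrite /F /X /Y /incr /= addrC subrK !indicE in_setI.
  rewrite (_ : (w \in [set w | _]) = (W (ts k.+1) w \in A k.+1)).
    by case: (w \in G); rewrite ?mul1r ?mul0r.
  by apply/idP/idP => /set_mem h; apply/mem_set.
have fr m' : \int[P]_w (\1_(past k A `&` future k.+1 m' C) w * F (X w, Y w)) =
    \int[P]_w (\1_(past k A `&` future k.+1 m' C) w * \int[incr_law k]_y F (X w, y)).
  apply: (freezing (X := X) (Y := Y) (N := incr_law k) _ mX mY _ bF).
    exact: measurableI.
  move=> B D mB mD; rewrite rect//.
  have := rect B setT m' mB measurableT.
  rewrite preimage_setT setIT [incr_law k setT]probability_setT mule1 => ->.
  by rewrite -!muleA; congr (_ * _)%E; rewrite muleC.
have f0 : future k.+1 0 C = setT by apply/seteqP; split => // w _ j.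
rewrite pastS [in LHS]setIAC PE; last exact: measurableI.
rewrite (PE _ mpk) fr -peE -EFinM [in RHS]mulrC; congr EFin.
(* At 0 the same identity holds without the future; the two integrals differ by the factor [p]. *)
have := fr 0%N; rewrite f0 setIT => ->.
apply: (bmf_scale_law (phi := fun x => \int[incr_law k]_y F (x, y)) _ mpk mX p0).
- exact: measurableI.
- move=> B mB; have := rect B setT m mB measurableT.
  rewrite preimage_setT setIT [incr_law k setT]probability_setT mule1 => ->.
  by rewrite peE muleC.
- exact: (bmf_int2 (incr_law k) bF).
Qed.

Lemma past_step k A (F : R * R -> R) : (forall j, measurable (A j)) -> bmf F ->
  \int[P]_w (\1_(past k A) w * F (W (ts k) w, incr k w)) =
  \int[P]_w (\1_(past k A) w * \int[incr_law k]_y F (W (ts k) w, y)).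
Proof.
move=> mA bF; apply: (freezing (X := W (ts k)) (Y := incr k) (N := incr_law k) _ _ _ _ bF).
- exact: measurable_past.
- exact: BM_measurable.
- exact: m_incr.
move=> B D mB mD.
pose A' j := if j == k then A j `&` B else A j.
have mA' j : measurable (A' j) by rewrite /A'; case: ifP => // _; exact: measurableI.
have pA' : past k A `&` (W (ts k) @^-1` B) = past k A'.
  apply/seteqP; split => w.
    move=> [h b] j jk; rewrite /= /A'; case: ifP => [/eqP ->|_]; last exact: h.
    by split => //; exact: (h k (ltnSn k)).
  move=> h; split; last by have := h k (ltnSn k); rewrite /= /A' eqxx => -[].
  by move=> j jk; have := h j jk; rewrite /= /A'; case: ifP => // _ [].
have fD : incr k @^-1` D = future k k.+1 (fun=> D).
  apply/seteqP; split => w.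
    move=> h j; rewrite /= ltnS => jk kj.
    by rewrite (_ : j = k)//; apply/eqP; rewrite eqn_leq jk.
  by move=> /(_ k (ltnSn k)) /= /(_ (leqnn k)).
rewrite pA' fD past_future_indep//; congr (_ * _)%E.
rewrite big_ord_recr/= leqnn big1 ?mul1e// => i _.
by rewrite leqNgt ltn_ord.
Qed.

End independent_increments.

(** * The process at the times of a grid *)

Section OU_on_grid.
Context {R : realType} (d : measure_display) (Omega : measurableType d)
  (P : probability Omega R) (W : R -> Omega -> R) (hW : is_std_BM P W).
Variables (s x : R) (s0 : 0 <= s).
Implicit Types (c v r a b : R) (f g : R -> R) (n m j : nat).

(* [X] in logarithmic time: an Ornstein-Uhlenbeck process started at [x],
   whatever the starting time [s] of [X]. *)
Definition Zs v w : R := Xproc W x s ((s + 1) * expR v - 1) w.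

Let s1 : 0 < s + 1. Proof. by rewrite ltr_wpDl. Qed.

Let rho v := Num.sqrt (s + 1) * expR (v / 2).

Let rho_gt0 v : 0 < rho v. Proof. by rewrite mulr_gt0 ?expR_gt0 ?sqrtr_gt0. Qed.

Let rho_sq v : rho v ^+ 2 = (s + 1) * expR v.
Proof.
rewrite exprMn sqr_sqrtr ?(ltW s1)// -expRM_natl; congr (_ * expR _).
by field.
Qed.

Lemma ZsE v w : Zs v w = (x * Num.sqrt (s + 1) + W ((s + 1) * (expR v - 1)) w) / rho v.
Proof.
rewrite /Zs /Xproc; congr ((_ + W _ _) / _); first by ring.
by rewrite subrK -rho_sq sqrtr_sqr gtr0_norm.
Qed.

Lemma Zs0 w : Zs 0 w = x.
Proof.
rewrite ZsE expR0 subrr mulr0 (BM_0 hW) addr0 /rho mul0r expR0 mulr1.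
by rewrite mulfK// gt_eqF// sqrtr_gt0.
Qed.

Lemma measurable_Zs v : 0 <= v -> measurable_fun setT (Zs v).
Proof.
move=> v0; rewrite (_ : Zs v = fun w => (x * Num.sqrt (s + 1) + W ((s + 1) * (expR v - 1)) w) / rho v); last first.
  by apply/funext => w; rewrite ZsE.
apply: measurable_funM => //; apply: measurable_funD => //.
apply: (BM_measurable hW); rewrite mulr_ge0 ?(ltW s1)// subr_ge0.
by rewrite -[leLHS]expR0 ler_expR.
Qed.

Section steps.
Variable v : nat -> R.
Hypotheses (v0 : v 0%N = 0) (vS : forall i, v i < v i.+1).

Let v_ge0 i : 0 <= v i.
Proof. by elim: i => [|i IH]; rewrite ?v0// (le_trans IH)// ltW. Qed.

Definition zpast n (A : nat -> set R) : set Omega :=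
  \bigcap_(j in `I_n.+1) [set w | A j (Zs (v j) w)].

Let ts j := (s + 1) * (expR (v j) - 1).

Let ts0 : ts 0%N = 0. Proof. by rewrite /ts v0 expR0 subrr mulr0. Qed.

Let tsS j : ts j < ts j.+1.
Proof. by rewrite ltr_pM2l// ltrD2r ltr_expR. Qed.

Let pre (A : nat -> set R) j : set R :=
  (fun y => (x * Num.sqrt (s + 1) + y) / rho (v j)) @^-1` A j.

Let measurable_pre A : (forall j, measurable (A j)) -> forall j, measurable (pre A j).
Proof.
move=> mA j; apply: measurable_preimT => //.
by apply: measurable_funM => //; exact: measurable_funD.
Qed.

Lemma zpastE n A : zpast n A = past W ts n (pre A).
Proof.
by rewrite /zpast /past; apply/seteqP; split => w h j jn; have := h j jn;
  rewrite /= /pre /= ZsE.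
Qed.

Lemma measurable_zpast n A : (forall j, measurable (A j)) -> measurable (zpast n A).
Proof.
move=> mA; rewrite zpastE; apply: (measurable_past hW ts0 tsS).
exact: measurable_pre.
Qed.

(** The increment of [W] over the step has variance (s + 1) (exp (v (n + 1)) - exp (v n)); divided
    by the square of [rho (v n.+1)] this is 1 - exp (- dt), and [s] disappears. *)
Lemma zpast_step n A f : (forall j, measurable (A j)) -> bmf f ->
  \int[P]_w (\1_(zpast n A) w * f (Zs (v n.+1) w)) =
  \int[P]_w (\1_(zpast n A) w * ouK (v n.+1 - v n) f (Zs (v n) w)).
Proof.
move=> mA bf; set dt := v n.+1 - v n.
have dt0 : 0 < dt by rewrite subr_gt0.
pose F (z : R * R) := f ((x * Num.sqrt (s + 1) + (z.1 + z.2)) / rho (v n.+1)).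
have bF : bmf F.
  apply: (bmf_comp bf); apply: measurable_funM => //; apply: measurable_funD => //.
  by apply: measurable_funD; [exact: measurable_fst|exact: measurable_snd].
have := past_step hW ts0 tsS n (measurable_pre mA) bF.
rewrite -zpastE => h.
transitivity (\int[P]_w (\1_(zpast n A) w * F (W (ts n) w, incr W ts n w))).
  by apply: eq_Rintegral => w _; rewrite ZsE /F /incr /= (addrC (W (ts n) w)) subrK.
suff key w : \int[incr_law ts n]_y F (W (ts n) w, y) = ouK dt f (Zs (v n) w).
  by rewrite h; apply: eq_Rintegral => w _; rewrite key.
set del := ts n.+1 - ts n.
have del0 : 0 < del by rewrite subr_gt0.
have sd0 : 0 < Num.sqrt del by rewrite sqrtr_gt0.
rewrite /incr_law -/del (@integral_normal_std _ 0 _ _ sd0); last first.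
  exact: (bmf_pair1 bF).
rewrite /ouK; apply: eq_Rintegral => z _; congr f.
rewrite /= add0r ZsE -/(ts n) addrA mulrDl; congr (_ + _).
  have -> : rho (v n.+1) = rho (v n) * expR (dt / 2).
    by rewrite /rho -mulrA -expRD; congr (_ * expR _); rewrite /dt; field.
  have := rho_gt0 (v n); have := expR_gt0 (dt / 2).
  rewrite mulNr expRN; move: (expR _) (rho _) => e r e0 r0.
  by field; rewrite !gt_eqF.
rewrite mulrAC; congr (_ * _).
have r0 := rho_gt0 (v n.+1).
rewrite -[rho _]gtr0_norm// -sqrtr_sqr -sqrtrV; last by rewrite sqr_ge0.
rewrite -sqrtrM; last exact: ltW.
congr Num.sqrt; rewrite rho_sq /del /ts.
have -> : expR (- dt) = expR (v n) / expR (v n.+1).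
  by rewrite -expRN -expRD; congr expR; rewrite /dt; ring.
by field; rewrite !gt_eqF// expR_gt0.
Qed.

Lemma zpast_iter n m A c dt f : (forall j, measurable (A j)) -> bmf f ->
  (forall j, (n <= j < n + m)%N -> v j.+1 - v j = dt /\ A j.+1 = seg c) ->
  \int[P]_w (\1_(zpast (n + m) A) w * f (Zs (v (n + m)%N) w)) =
  \int[P]_w (\1_(zpast n A) w * iter m (killK c dt) f (Zs (v n) w)).
Proof.
move=> mA; elim: m f => [|m IH] f bf H; first by rewrite addn0.
rewrite addnS iterSr -IH; last 2 first.
- exact: bmf_killK.
- by move=> j /andP[nj jm]; apply: H; rewrite nj addnS ltnW.
have [dtE AE] := H (n + m)%N (introT andP (conj (leq_addr m n) (eq_leq (esym (addnS n m))))).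
rewrite /killK -dtE -zpast_step//; last exact: bmf_restr.
apply: eq_Rintegral => w _; rewrite mulrA; congr (_ * _).
rewrite !indicE -natrM; congr (_%:R); rewrite mulnb; congr nat_of_bool.
apply/idP/andP => [/set_mem h|[/set_mem h1 /set_mem h2]].
  split; apply/mem_set; last by rewrite -AE; exact: (h (n + m).+1 (ltnSn _)).
  by move=> j /= jm; apply: h => /=; rewrite ltnW.
apply/mem_set => j /=; rewrite ltnS leq_eqVlt => /predU1P[->|jm].
  by rewrite AE.
exact: h1.
Qed.

End steps.

(** The times are j v / (n + 1) with 1 <= j <= n + 1: as in [killK] the starting point carries no
    condition, and the endpoint [v] carries one. *)
Definition grid c v n : set Omega :=
  \bigcap_(j in `I_n.+1) [set w | `|Zs (v / n.+1%:R * j.+1%:R) w| <= c].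

Definition grid2 c v v' m : set Omega :=
  \bigcap_(j in `I_m.+1) [set w | `|Zs (v + v' / m.+1%:R * j.+1%:R) w| <= c].

(** A grid with two step lengths, v / (n + 1) up to [v] and v' / (m + 1) afterwards; it never stops,
    since strict monotonicity is required at all indices. *)
Let times v v' n m j := if (j <= n.+1)%N then v / n.+1%:R * j%:R
  else v + v' / m.+1%:R * (j - n.+1)%:R.

Let times0 v v' n m : times v v' n m 0 = 0.
Proof. by rewrite /times /= mulr0. Qed.

Let times_step1 v v' n m j : (j <= n)%N -> times v v' n m j.+1 - times v v' n m j = v / n.+1%:R.
Proof.
move=> jn; rewrite /times ltnS jn (leq_trans jn)// -mulrBr -natrB// subSnn.
by rewrite mulr1.
Qed.

Let times_step2 v v' n m j : (n < j)%N -> times v v' n m j.+1 - times v v' n m j = v' / m.+1%:R.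
Proof.
move=> nj; rewrite /times ltnS leqNgt nj /= subSn//.
case: ifPn => [jn|_].
  have -> : j = n.+1 by apply/eqP; rewrite eqn_leq jn.
  by rewrite subnn mulr1 divfK ?pnatr_eq0// addrAC subrr add0r.
by rewrite opprD addrACA subrr add0r -mulrBr -natrB// subSnn mulr1.
Qed.

Let timesS v v' n m j : 0 < v -> 0 < v' -> times v v' n m j < times v v' n m j.+1.
Proof.
move=> v0 v0'; rewrite -subr_gt0; have [jn|nj] := leqP j n.
  by rewrite times_step1// divr_gt0.
by rewrite times_step2// divr_gt0.
Qed.

(** [S] enters at index [n.+1] only, which is the time [v]. *)
Let sets c (S : set R) n j : set R :=
  if j == 0%N then setT else if j == n.+1 then seg c `&` S else seg c.

Let measurable_sets c S n j : measurable S -> measurable (sets c S n j).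
Proof.
move=> mS; rewrite /sets; case: ifP => // _; case: ifP => // _.
  by apply: measurableI => //; exact: measurable_seg.
exact: measurable_seg.
Qed.

Let timesL v v' n m j : (j <= n.+1)%N -> times v v' n m j = v / n.+1%:R * j%:R.
Proof. by rewrite /times => ->. Qed.

Let times_mid v v' n m : times v v' n m n.+1 = v.
Proof. by rewrite timesL// divfK ?pnatr_eq0. Qed.

Let timesR v v' n m j : times v v' n m (n.+1 + j.+1) = v + v' / m.+1%:R * j.+1%:R.
Proof. by rewrite /times addnS leqNgt ltnS leq_addr/= -addnS addKn. Qed.

Let setsE c S n j : sets c S n j.+1 = if j == n then seg c `&` S else seg c.
Proof. by []. Qed.

Let setsR c S n j : sets c S n (n.+1 + j.+1) = seg c.
Proof. by rewrite addnS setsE addSn gtn_eqF// ltnS leq_addr. Qed.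

Let zpast_sets c S n m v v' : zpast (times v v' n m) n.+1 (sets c S n) =
  grid c v n `&` [set w | S (Zs v w)].
Proof.
apply/seteqP; split => w.
  move=> h; split.
    move=> j jn; have := h j.+1 jn; rewrite /= timesL// setsE => hj.
    by apply/segP; move: hj; case: ifP => // _ [].
  by have := h n.+1 (ltnSn _); rewrite /= times_mid setsE eqxx => -[].
move=> [h hS] [_|j jn]; first by [].
have /segP hj := h j jn.
rewrite /= timesL// setsE; case: eqVneq => [jE|_]; last exact: hj.
by split; [exact: hj|rewrite jE divfK ?pnatr_eq0].
Qed.

Let zpast_sets2 c S n m v v' : zpast (times v v' n m) (n.+1 + m.+1) (sets c S n) =
  grid c v n `&` [set w | S (Zs v w)] `&` grid2 c v v' m.
Proof.
rewrite -(zpast_sets c S n m v v'); apply/seteqP; split => w.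
  move=> h; split.
    by move=> j jn; apply: h; rewrite /= (leq_trans jn)// ltnS leq_addr.
  move=> j jm; have /= := h (n.+1 + j.+1)%N; rewrite ltnS leq_add2l => /(_ jm).
  by rewrite setsR timesR => /segP.
move=> [h1 h2] j jm; have [jn|nj] := leqP j n.+1; first exact: (h1 j).
have jE : j = (n.+1 + (j - n.+2).+1)%N by rewrite addnS -addSn subnKC.
have jm' : (j - n.+2 < m.+1)%N by move: jm; rewrite {1}jE /= ltnS leq_add2l.
move: (j - n.+2)%N jE jm' => i -> im'.
by have /segP := h2 _ im'; rewrite /= setsR timesR.
Qed.

Lemma measurable_grid c v n : 0 < v -> measurable (grid c v n).
Proof.
move=> v0; have := @measurable_zpast (times v 1 n 0) (times0 _ _ _ _) _ n.+1 (sets c setT n).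
rewrite zpast_sets (_ : [set w | _] = setT) ?setIT; last by apply/seteqP; split.
by apply => j; [exact: timesS|exact: measurable_sets].
Qed.

Lemma measurable_grid_and c S n m v v' : 0 < v -> 0 < v' -> measurable S ->
  measurable (grid c v n `&` [set w | S (Zs v w)] `&` grid2 c v v' m).
Proof.
move=> v0 v0' mS; rewrite -zpast_sets2; apply: measurable_zpast => //.
by move=> j; exact: timesS.
by move=> j; exact: measurable_sets.
Qed.

Lemma grid_iter c v n f : 0 < v -> bmf f ->
  \int[P]_w (\1_(grid c v n) w * f (Zs v w)) = iter n.+1 (killK c (v / n.+1%:R)) f x.
Proof.
move=> v0 bf.
have := @zpast_iter (times v 1 n 0) (times0 _ _ _ _) (fun j => timesS _ _ _ v0 ltr01)
  0 n.+1 (sets c setT n) c (v / n.+1%:R) f (fun j => measurable_sets c n j measurableT) bf.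
rewrite add0n zpast_sets (_ : [set w | _] = setT) ?setIT; last by apply/seteqP; split.
move=> /(_ _)/wrap[j /= jn|].
  by rewrite times_step1// /sets /= setIT; split => //; case: ifP.
rewrite [X in Zs X](_ : _ = v); last exact: times_mid.
move=> ->; rewrite -[RHS](prob_int_cst P); apply: eq_Rintegral => w _.
by rewrite times0 Zs0 indicE mem_set ?mul1r// => -[].
Qed.

Lemma grid2_iter c S n m v v' f : 0 < v -> 0 < v' -> measurable S -> bmf f ->
  \int[P]_w (\1_(grid c v n `&` [set w | S (Zs v w)] `&` grid2 c v v' m) w * f (Zs (v + v') w)) =
  \int[P]_w (\1_(grid c v n `&` [set w | S (Zs v w)]) w * iter m.+1 (killK c (v' / m.+1%:R)) f (Zs v w)).
Proof.
move=> v0 v0' mS bf.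
have := @zpast_iter (times v v' n m) (times0 _ _ _ _) (fun j => timesS _ _ _ v0 v0')
  n.+1 m.+1 (sets c S n) c (v' / m.+1%:R) f (fun j => measurable_sets c n j mS) bf.
move=> /(_ _)/wrap[j /= /andP[nj jm]|].
  rewrite times_step2//; split => //.
  by rewrite setsE gtn_eqF.
have E : times v v' n m (n.+1 + m.+1) = v + v' by rewrite timesR divfK ?pnatr_eq0.
by rewrite zpast_sets zpast_sets2 E times_mid.
Qed.

Lemma ouK_free v f : 0 < v -> bmf f -> \int[P]_w f (Zs v w) = ouK v f x.
Proof.
move=> v0 bf.
have := @zpast_step (times v 1 0 0) (times0 _ _ _ _) (fun j => timesS _ _ _ v0 ltr01)
  0 (fun=> setT) f (fun=> measurableT) bf.
have -> : zpast (times v 1 0 0) 0 (fun=> setT) = setT by apply/seteqP; split.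
rewrite times_step1// divr1 times0 /times /= mulr1 divr1.
under eq_Rintegral do rewrite indicT mul1r.
move=> ->; rewrite -[RHS](prob_int_cst P); apply: eq_Rintegral => w _.
by rewrite indicT mul1r Zs0.
Qed.

(** Chapman-Kolmogorov without convolving normal densities: both sides are the mean of f at Z_(a +
    b), by the Markov property at time [a]. *)
Lemma ouK_semigroup a b f : 0 < a -> 0 < b -> bmf f ->
  ouK a (ouK b f) x = ouK (a + b) f x.
Proof.
move=> a0 b0 bf; rewrite -ouK_free//; last exact: bmf_ouK.
rewrite -ouK_free//; last exact: addr_gt0.
have := @zpast_step (times a b 0 0) (times0 _ _ _ _) (fun j => timesS _ _ _ a0 b0)
  1 (fun=> setT) f (fun=> measurableT) bf.
have -> : zpast (times a b 0 0) 1 (fun=> setT) = setT by apply/seteqP; split.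
rewrite times_step2// divr1 /times /= !mulr1 !divr1 => h; symmetry.
have e F : \int[P]_w ((\1_[set: Omega] w : R) * F w) = \int[P]_w F w.
  by apply: eq_Rintegral => w _; rewrite indicT mul1r.
by rewrite !e in h.
Qed.

End OU_on_grid.

(** * The killed semigroup *)

Section grid_limits.
Context {R : realType}.
Implicit Types (z : R -> R) (a v c r : R).

(** A neighbourhood of [r] also exceeds [c], and a fine grid has a time in it, the last one up to
    [r]. As |z a| <= c excludes r = a, this time has index at least 1. *)
Lemma grid_dense z a v c r : continuous z -> 0 < v -> a <= r <= a + v ->
  `|z a| <= c -> c < `|z r| ->
  \forall n \near \oo, exists2 j, (j < n.+1)%N & c < `|z (a + v / n.+1%:R * j.+1%:R)|.
Proof.
move=> cz v0 /andP[ar rv] za zr.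
have {}ar : a < r by rewrite lt_neqAle ar andbT; apply: contraTneq zr => <-; rewrite -leNgt.
have : \forall y \near r, c < `|z y|.
  have : `|z y| @[y --> r] --> `|z r| by apply: cvg_norm; exact: cz.
  by move=> /cvgr_gt; exact.
move=> /nbhs_ballP[e /= e0 he].
have m0 : 0 < Num.min e (r - a) / v.
  by rewrite divr_gt0// lt_min e0 subr_gt0.
have := near_infty_natSinv_lt (PosNum m0); apply: filterS => n /=.
rewrite ltr_pdivlMr// mulrC => nm.
have n0 : 0 < n.+1%:R :> R by rewrite ltr0n.
have q0 : 0 < v / n.+1%:R by rewrite divr_gt0.
move: nm; rewrite lt_min => /andP[qe qr].
pose y := (r - a) / (v / n.+1%:R).
have yE : v / n.+1%:R * y = r - a by rewrite /y mulrC divfK// gt_eqF.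
have y1 : 1 <= y by rewrite ler_pdivlMr// mul1r ltW.
have yn : y <= n.+1%:R.
  rewrite ler_pdivrMr// mulrCA divff ?mulr1; last by rewrite gt_eqF.
  lra.
have y0 : 0 <= y by rewrite (le_trans _ y1).
have /andP[k1 k2] := truncn_itv y0.
move: k1 k2; set k := truncn _ => k1 k2.
have k0 : (0 < k)%N.
  by rewrite lt0n; apply: contraTneq k2 => ->; rewrite -leNgt.
exists k.-1; first by rewrite prednK// -(ler_nat R) (le_trans k1).
rewrite prednK//; apply: he; rewrite /ball /= /ball /=.
have -> : r - (a + v / n.+1%:R * k%:R) = v / n.+1%:R * (y - k%:R).
  by rewrite mulrBr yE; ring.
rewrite ger0_norm; last by rewrite mulr_ge0 ?(ltW q0)// subr_ge0.
rewrite (le_lt_trans _ qe)// ger_pMr// lerBlDr.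
by rewrite -natr1 addrC in k2; exact: ltW.
Qed.

Lemma indic_cvg {T : Type} (A_ : nat -> set T) (A : set T) w :
  (A w -> \forall n \near \oo, A_ n w) ->
  (~ A w -> \forall n \near \oo, ~ A_ n w) ->
  (\1_(A_ n) w : R) @[n --> \oo] --> (\1_A w : R).
Proof.
move=> h1 h2; apply: cvg_near_cst; have [Aw|Aw] := pselect (A w).
  by apply: filterS (h1 Aw) => n Anw; rewrite !indicE !mem_set.
by apply: filterS (h2 Aw) => n Anw; rewrite !indicE !memNset.
Qed.

Lemma rcvg_unique (f g : nat -> R) (a b : R) :
  f @ \oo --> a -> g @ \oo --> b -> f =1 g -> a = b.
Proof. by move=> fa + /funext fg; rewrite -fg => fb; exact: (cvg_unique _ fa fb). Qed.

End grid_limits.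

Lemma prob_int_norm_le {R : realType} d (T : measurableType d) (P : probability T R)
  (f : T -> R) M : bmf f -> (forall x, `|f x| <= M) -> `|\int[P]_x f x| <= M.
Proof.
move=> bf fM; rewrite -[M](prob_int_cst P) ler_norml.
have h x : - M <= f x <= M by rewrite -ler_norml.
apply/andP; split.
  rewrite -mulN1r -bmf_intZ; last exact: bmf_cst.
  apply: bmf_le => //; first by apply: bmfZ; exact: bmf_cst.
  by move=> x; rewrite mulN1r; have /andP[] := h x.
apply: bmf_le => //; first exact: bmf_cst.
by move=> x; have /andP[] := h x.
Qed.

(** * Survival events as limits of grid events *)

Section survival.
Context {R : realType} (d : measure_display) (Omega : measurableType d)
  (P : probability Omega R) (W : R -> Omega -> R) (hW : is_std_BM P W).
Implicit Types (s x c v r a b : R) (f g : R -> R) (n m j : nat) (S : set R).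

(** Paths are continuous on [0, +oo) only; the absolute value extends them to the whole line. *)
Lemma continuous_Zs s x w : 0 <= s -> continuous (fun r => Zs W s x `|r| w).
Proof.
move=> s0.
have cW : continuous (fun t : R => W `|t| w : R).
  have [_ [_ [/(_ w)/subspace_continuousP cw _]]] := hW.
  move=> t; have := cw `|t|; rewrite /= in_itv /= normr_ge0 => /(_ isT).
  move=> ct A /ct hA.
  have {}hA : \forall y \near `|t|, `[0, +oo[%classic y -> A (W y w) by exact: hA.
  have nt : `|y| @[y --> t] --> `|t| by exact: (@norm_continuous _ R^o).
  have h2 : \forall y \near t, `[0, +oo[%classic `|y| -> A (W `|y| w) by exact: (nt _ hA).
  change (\forall y \near t, A (W `|y| w)).
  apply: filterS h2 => y; apply.
  by rewrite /= in_itv /= normr_ge0.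
rewrite (_ : (fun r => _) = fun r => (x * Num.sqrt (s + 1) +
    (fun t => W `|t| w) ((s + 1) * (expR `|r| - 1))) *
    (Num.sqrt (s + 1) * expR (`|r| / 2))^-1); last first.
  apply/funext => r; rewrite ZsE// [in W `|_| w]ger0_norm//.
  apply: mulr_ge0; first exact: addr_ge0.
  by rewrite subr_ge0 -[leLHS]expR0 ler_expR.
have cn r : `|y| @[y --> r] --> `|r| by exact: (@norm_continuous _ R^o).
have ce r : (fun y : R => expR `|y|) @ r --> expR `|r|.
  by apply: (cvg_comp (fun y : R => `|y|) expR (cn r)); exact: continuous_expR.
move=> r; apply: cvgM.
  apply: rcvgD; first exact: cvg_cst.
  have c1 : (fun y : R => (s + 1) * (expR `|y| - 1)) @ r --> (s + 1) * (expR `|r| - 1).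
    apply: rcvgZ; apply: rcvgB; last exact: cvg_cst.
    exact: ce.
  exact: (cvg_comp _ _ c1 (cW _)).
apply: cvgV.
  by rewrite gt_eqF// mulr_gt0 ?expR_gt0// sqrtr_gt0 ltr_wpDl.
apply: rcvgZ; have c2 : (fun y : R => `|y| / 2) @ r --> `|r| / 2.
  by apply: cvgM; [exact: cn|exact: cvg_cst].
by apply: (cvg_comp (fun y : R => `|y| / 2) expR c2); exact: continuous_expR.
Qed.

Definition surv s x c a b : set Omega :=
  [set w | forall r, a <= r <= b -> `|Zs W s x r w| <= c].

(** For each path the indicators are eventually constant: a path that exceeds [c] somewhere is
    caught by every fine grid. *)
Lemma grid_surv s x c v w : 0 <= s -> 0 < v -> `|x| <= c ->
  (\1_(grid W s x c v n) w : R) @[n --> \oo] --> (\1_(surv s x c 0 v) w : R).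
Proof.
move=> s0 v0 xc; apply: indic_cvg.
  move=> h; apply: nearW => n j jn; apply: h.
  rewrite mulr_ge0 ?divr_ge0//= ?(ltW v0)// mulrAC ler_pdivrMr ?ltr0n//.
  by rewrite ler_pM2l// ler_nat.
move=> /existsNP[r /not_implyP[/andP[r0 rv] /negP]]; rewrite -ltNge => cr.
have := @grid_dense _ _ 0 v c r (@continuous_Zs s x w s0) v0.
rewrite /= add0r r0 rv normr0 (Zs0 hW)// (ger0_norm r0) => /(_ isT xc cr).
apply: filterS => n [j jn]; have p0 : 0 <= v / n.+1%:R * j.+1%:R.
  by rewrite mulr_ge0// divr_ge0// ltW.
rewrite add0r (ger0_norm p0).
by move=> cz /(_ j jn) /=; rewrite leNgt cz.
Qed.

Lemma grid2_surv s x c v v' w : 0 <= s -> 0 <= v -> 0 < v' -> `|Zs W s x v w| <= c ->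
  (\1_(grid2 W s x c v v' n) w : R) @[n --> \oo] --> (\1_(surv s x c v (v + v')) w : R).
Proof.
move=> s0 v0 v0' zc; apply: indic_cvg.
  move=> h; apply: nearW => n j jn; apply: h.
  rewrite lerDl mulr_ge0 ?divr_ge0//= ?(ltW v0')// lerD2l mulrAC ler_pdivrMr ?ltr0n//.
  by rewrite ler_pM2l// ler_nat.
move=> /existsNP[r /not_implyP[/andP[r0 rv] /negP]]; rewrite -ltNge => cr.
have := @grid_dense _ _ v v' c r (@continuous_Zs s x w s0) v0'.
rewrite /= r0 rv (ger0_norm v0) (ger0_norm (le_trans v0 r0)) => /(_ isT zc cr).
apply: filterS => n [j jn]; have p0 : 0 <= v + v' / n.+1%:R * j.+1%:R.
  by rewrite addr_ge0// mulr_ge0// divr_ge0// ltW.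
rewrite (ger0_norm p0).
by move=> cz /(_ j jn) /=; rewrite leNgt cz.
Qed.

Definition killTc c v f x : R :=
  \int[P]_w (\1_(surv 0 x c 0 v) w * f (Zs W 0 x v w)).

Local Notation Tc := killTc.

Lemma Tc_off c v f x : 0 <= v -> c < `|x| -> Tc c v f x = 0.
Proof.
move=> v0 cx; rewrite /killTc; under eq_Rintegral => w _.
  rewrite indicE memNset; last first.
    by move=> /(_ 0); rewrite lexx v0 (Zs0 hW)// leNgt cx => /(_ isT).
  rewrite mul0r; over.
by rewrite prob_int_cst.
Qed.

Let indic_le1 (A : set Omega) w : `|\1_A w : R| <= 1.
Proof. by rewrite indicE; case: (_ \in _); rewrite ?normr0 ?normr1. Qed.

Let cvg_phase1 s x c v (F : Omega -> R) : 0 <= s -> 0 < v -> `|x| <= c -> bmf F ->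
  bmf (fun w => \1_(surv s x c 0 v) w * F w) /\
  (fun n => \int[P]_w (\1_(grid W s x c v n) w * F w)) @ \oo -->
  \int[P]_w (\1_(surv s x c 0 v) w * F w).
Proof.
move=> s0 v0 xc [mF [M FM]].
apply: (@bmf_cvg _ _ _ P _ _ M) => [n|n w|w].
- by apply: measurable_funM => //; apply: measurable_indic; exact: (measurable_grid hW).
- by rewrite normrM (le_trans (ler_wpM2r _ (indic_le1 _ _)))// mul1r.
- by apply: cvgM; [exact: grid_surv|exact: cvg_cst].
Qed.

Lemma iter_cvg s x c v f : 0 <= s -> 0 < v -> `|x| <= c -> bmf f ->
  iter n.+1 (killK c (v / n.+1%:R)) f x @[n --> \oo] -->
  \int[P]_w (\1_(surv s x c 0 v) w * f (Zs W s x v w)).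
Proof.
move=> s0 v0 xc bf.
have bfZ : bmf (fun w => f (Zs W s x v w)).
  by apply: bmf_comp => //; exact: (measurable_Zs hW x s0 (ltW v0)).
have [_] := cvg_phase1 s0 v0 xc bfZ.
by apply: rcvg_eq => n; rewrite (grid_iter hW).
Qed.

Lemma iter_cvg_Tc x c v f : 0 < v -> `|x| <= c -> bmf f ->
  iter n.+1 (killK c (v / n.+1%:R)) f x @[n --> \oo] --> Tc c v f x.
Proof. exact: iter_cvg. Qed.

(** Both sides are limits of the same iterates of [killK], in which [s] does not occur. *)
Lemma surv_Tc s x c v f : 0 <= s -> 0 < v -> `|x| <= c -> bmf f ->
  \int[P]_w (\1_(surv s x c 0 v) w * f (Zs W s x v w)) = Tc c v f x.
Proof.
move=> s0 v0 xc bf; have h1 := iter_cvg s0 v0 xc bf.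
have h2 := iter_cvg_Tc v0 xc bf.
exact: (cvg_unique _ h1 h2).
Qed.

(** The indicator settles |x| > c, where [killK] ignores the starting point while [killTc]
    vanishes. *)
Lemma seg_iter_cvg x c v f : 0 < v -> bmf f ->
  \1_(seg c) x * iter n.+1 (killK c (v / n.+1%:R)) f x @[n --> \oo] --> Tc c v f x.
Proof.
move=> v0 bf; rewrite indicE; have [/set_mem/segP xc|/negP xc] := boolP (x \in seg c).
  by rewrite -[Tc _ _ _ _]mul1r; apply: rcvgZ; exact: iter_cvg_Tc.
rewrite Tc_off ?(ltW v0)//; last by rewrite ltNge; apply/negP => /segP/mem_set.
by apply: rcvg_eq (cvg_cst _) => n /=; rewrite mul0r.
Qed.

Lemma bmf_Tc c v f : 0 < v -> bmf f -> bmf (Tc c v f).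
Proof.
move=> v0 bf; have [M fM] := bf.2.
have bi n : bmf (iter n.+1 (killK c (v / n.+1%:R)) f) by exact: bmf_iter.
split.
  apply: (measurable_fun_cvg (D := setT)
    (fun n => (bmfM (bmf_indic (measurable_seg c)) (bi n)).1)) => x _.
  exact: seg_iter_cvg.
exists M => x; have [xc|xc] := leP `|x| c; last first.
  by rewrite Tc_off ?(ltW v0)// normr0 (le_trans _ (fM 0)).
have [b1 _] := cvg_phase1 (lexx 0) v0 xc
  (bmf_comp bf (measurable_Zs hW x (lexx 0) (ltW v0))).
apply: (prob_int_norm_le P b1) => w.
by rewrite normrM (le_trans (ler_wpM2r _ (indic_le1 _ _)))// mul1r.
Qed.

Lemma iter_norm_le c v n f x M : 0 < v -> bmf f -> (forall y, `|f y| <= M) ->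
  `|iter n.+1 (killK c (v / n.+1%:R)) f x| <= M.
Proof.
move=> v0 bf fM; rewrite -(grid_iter hW x (lexx 0))//; apply: prob_int_norm_le => [|w].
  apply: bmfM; first by apply: bmf_indic; exact: (measurable_grid hW).
  by apply: (bmf_comp bf); exact: (measurable_Zs hW x (lexx 0) (ltW v0)).
by rewrite normrM (le_trans (ler_wpM2r _ (indic_le1 _ _)))// mul1r.
Qed.

Let indicI (A B : set Omega) w : \1_(A `&` B) w = \1_A w * \1_B w :> R.
Proof. by rewrite indicI. Qed.

Let indicZ s x v S w : \1_[set w | S (Zs W s x v w)] w = \1_S (Zs W s x v w) :> R.
Proof. by rewrite !indicE; congr (nat_of_bool _)%:R. Qed.

Let surv_cat s x c v v' w : 0 <= v -> 0 <= v' ->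
  \1_(surv s x c 0 v) w * \1_(surv s x c v (v + v')) w =
  \1_(surv s x c 0 (v + v')) w :> R.
Proof.
move=> v0 v0'; rewrite -indicI; congr (\1_ _ w); apply/seteqP; split => w'.
  move=> [h1 h2] r /andP[r0 rv]; have [rv'|rv'] := leP r v.
    by apply: h1; rewrite r0.
  by apply: h2; rewrite rv ltW.
move=> h; split => r /andP[r0 rv]; apply: h.
  by rewrite r0 (le_trans rv)// lerDl.
by rewrite rv (le_trans v0).
Qed.

(** Two grid limits: the grid after [v] is refined while the one before [v] is fixed, and then the
    latter. In this order the inner limit can use |Z_v| <= c, since [v] is the last time of the
    first grid. *)
Let markov_c s x c v v' S f : 0 <= s -> 0 < v -> 0 < v' -> `|x| <= c ->
  measurable S -> bmf f ->
  \int[P]_w (\1_(surv s x c 0 (v + v')) w *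
    (\1_S (Zs W s x v w) * f (Zs W s x (v + v') w))) =
  Tc c v (fun y => \1_S y * Tc c v' f y) x.
Proof.
move=> s0 v0 v0' xc mS bf; have [mf [M fM]] := bf.
pose G n := grid W s x c v n `&` [set w | S (Zs W s x v w)].
have mZ r : 0 <= r -> measurable_fun setT (Zs W s x r).
  by move=> r0; exact: (measurable_Zs hW x s0 r0).
have mZv := mZ _ (ltW v0); have mZvv := mZ _ (ltW (addr_gt0 v0 v0')).
have GE n w : \1_(G n) w = \1_(grid W s x c v n) w * \1_S (Zs W s x v w) :> R.
  by rewrite /G indicI indicZ.
have mG n : measurable (G n).
  apply: measurableI; first exact: (measurable_grid hW).
  exact: (measurable_preimT mZv).
have M0 : 0 <= M by rewrite (le_trans _ (fM 0)).
have GzC n w : G n w -> `|Zs W s x v w| <= c.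
  by move=> [/(_ n (ltnSn n))]; rewrite /= divfK// pnatr_eq0.
have step : forall n,
  bmf (fun w => \1_(G n) w * (\1_(surv s x c v (v + v')) w * f (Zs W s x (v + v') w))) /\
  \int[P]_w (\1_(G n) w * (\1_(surv s x c v (v + v')) w * f (Zs W s x (v + v') w))) =
  \int[P]_w (\1_(grid W s x c v n) w * (\1_S (Zs W s x v w) * Tc c v' f (Zs W s x v w))).
  move=> n.
  pose A m := G n `&` grid2 W s x c v v' m.
  have mA m : measurable (A m) by exact: (measurable_grid_and hW).
  have [||| b1 c1] := @bmf_cvg _ _ _ P (fun m w => \1_(A m) w * f (Zs W s x (v + v') w))
    (fun w => \1_(G n) w * (\1_(surv s x c v (v + v')) w * f (Zs W s x (v + v') w))) M.
  - move=> m; apply: measurable_funM; first exact: measurable_indic.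
    exact: measurableT_comp.
  - move=> m w; rewrite normrM (le_trans (ler_wpM2r _ (indic_le1 _ _)))// mul1r.
    exact: fM.
  - move=> w; have [Gw|Gw] := pselect (G n w); last first.
      apply: (rcvg_eq _ (cvg_cst _)) => m.
      by rewrite /A indicI !indicE memNset ?mul0r.
    rewrite mulrA; apply: cvgM; last exact: cvg_cst.
    apply: (rcvg_eq (f := fun m => \1_(G n) w * \1_(grid2 W s x c v v' m) w)).
      by move=> m; rewrite /A indicI.
    by apply: rcvgZ; apply: grid2_surv => //; [exact: ltW|exact: (GzC n)].
  have [||| b2 c2] := @bmf_cvg _ _ _ P
    (fun m w => \1_(G n) w * iter m.+1 (killK c (v' / m.+1%:R)) f (Zs W s x v w))
    (fun w => \1_(G n) w * Tc c v' f (Zs W s x v w)) M.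
  - move=> m; apply: measurable_funM; first exact: measurable_indic.
    apply: measurableT_comp => //.
    exact: (bmf_iter _ _ _ bf).1.
  - move=> m w; rewrite normrM (le_trans (ler_wpM2r _ (indic_le1 _ _)))// mul1r.
    exact: iter_norm_le.
  - move=> w; have [Gw|Gw] := pselect (G n w); last first.
      apply: (rcvg_eq _ (cvg_cst _)) => m.
      by rewrite !indicE memNset ?mul0r.
    by apply: rcvgZ; apply: iter_cvg_Tc => //; exact: (GzC n).
  split => //.
  transitivity (\int[P]_w (\1_(G n) w * Tc c v' f (Zs W s x v w))).
    apply: (rcvg_unique c1 c2) => m.
    by rewrite (grid2_iter hW).
  by apply: eq_Rintegral => w _; rewrite GE mulrA.
have bT := bmf_Tc c v0' bf.
have bg : bmf (fun y => \1_S y * Tc c v' f y) by apply: bmfM => //; exact: bmf_indic.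
have [_ c2] := cvg_phase1 s0 v0 xc (bmf_comp bg mZv).
have [||| _ c1] := @bmf_cvg _ _ _ P
    (fun n w => \1_(G n) w * (\1_(surv s x c v (v + v')) w * f (Zs W s x (v + v') w)))
    (fun w => \1_(surv s x c 0 (v + v')) w *
      (\1_S (Zs W s x v w) * f (Zs W s x (v + v') w))) M.
- by move=> n; exact: (step n).1.1.
- move=> n w; rewrite normrM (le_trans (ler_wpM2r _ (indic_le1 _ _)))// mul1r.
  by rewrite normrM (le_trans (ler_wpM2r _ (indic_le1 _ _)))// mul1r.
- move=> w; rewrite -surv_cat ?ltW//.
  have -> : \1_(surv s x c 0 v) w * \1_(surv s x c v (v + v')) w *
      (\1_S (Zs W s x v w) * f (Zs W s x (v + v') w)) =
    \1_(surv s x c 0 v) w * \1_S (Zs W s x v w) *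
      (\1_(surv s x c v (v + v')) w * f (Zs W s x (v + v') w)) by ring.
  apply: cvgM; last exact: cvg_cst.
  apply: (rcvg_eq (f := fun n => \1_(grid W s x c v n) w * \1_S (Zs W s x v w))).
    by move=> n; rewrite GE.
  by apply: cvgM; [exact: grid_surv|exact: cvg_cst].
rewrite -(surv_Tc s0 v0 xc bg).
by apply: (rcvg_unique c1 c2) => n; rewrite (step n).2.
Qed.

Definition ck k : R := 1 - k.+1%:R^-1.

Definition survo s x v : set Omega :=
  [set w | forall r, 0 <= r <= v -> `|Zs W s x r w| < 1].

(** Compactness: a path that stays in (-1, 1) on [0, v] attains its maximal modulus there, so it
    stays below [ck k] for large [k]. *)
Lemma surv_survo s x v w : 0 <= s -> 0 <= v ->
  (\1_(surv s x (ck k) 0 v) w : R) @[k --> \oo] --> (\1_(survo s x v) w : R).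
Proof.
move=> s0 v0; apply: indic_cvg => h.
  have cz : {within `[0, v]%classic, continuous (fun r => `|Zs W s x `|r| w|)}.
    apply: continuous_subspaceT => r.
    by apply: cvg_norm; exact: (@continuous_Zs s x w s0).
  have [m mv mmax] := EVT_max v0 cz.
  have m1 : `|Zs W s x `|m| w| < 1.
    move: mv; rewrite in_itv /= => /andP[m0 mv].
    by rewrite (ger0_norm m0); apply: h; rewrite m0.
  have e0 : 0 < 1 - `|Zs W s x `|m| w| by rewrite subr_gt0.
  have := near_infty_natSinv_lt (PosNum e0); apply: filterS => k /= hk r /andP[r0 rv].
  have := mmax r; rewrite in_itv /= r0 rv (ger0_norm r0) => /(_ isT).
  by rewrite /ck; move: hk; move: (_^-1) (`|_|) (`|_|) => a b e; lra.
apply: nearW => k hk; apply: h => r rv; rewrite (le_lt_trans (hk r rv))//.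
by rewrite /ck ltrBlDr ltrDl invr_gt0.
Qed.

Definition killT v f x : R :=
  \int[P]_w (\1_(survo 0 x v) w * f (Zs W 0 x v w)).

Local Notation T := killT.

Let bmf_surv s x c v (F : Omega -> R) : 0 <= s -> 0 < v -> bmf F ->
  bmf (fun w => \1_(surv s x c 0 v) w * F w).
Proof.
move=> s0 v0 bF; have [xc|xc] := leP `|x| c.
  exact: (cvg_phase1 s0 v0 xc bF).1.
rewrite (_ : (fun w => _) = fun=> 0); first exact: bmf_cst.
apply/funext => w; rewrite indicE memNset ?mul0r// => /(_ 0).
by rewrite lexx (ltW v0) (Zs0 hW)// leNgt xc => /(_ isT).
Qed.

Let int_survo s x v (F_ : nat -> Omega -> R) (F : Omega -> R) (M : R) : 0 <= s -> 0 < v ->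
  (forall k, measurable_fun setT (F_ k)) -> (forall k w, `|F_ k w| <= M) ->
  (forall w, F_ ^~ w @ \oo --> F w) ->
  bmf (fun w => \1_(survo s x v) w * F w) /\
  (fun k => \int[P]_w (\1_(surv s x (ck k) 0 v) w * F_ k w)) @ \oo -->
  \int[P]_w (\1_(survo s x v) w * F w).
Proof.
move=> s0 v0 mF MF cF; apply: (@bmf_cvg _ _ _ P _ _ M) => [k|k w|w].
- by apply: (bmf_surv _ _ _ _ _).1 => //; split => //; exists M.
- by rewrite normrM (le_trans (ler_wpM2r _ (indic_le1 _ _)))// mul1r.
- by apply: cvgM; [apply: surv_survo => //; exact: ltW|exact: cF].
Qed.

Let int_survo_cst s x v (F : Omega -> R) : 0 <= s -> 0 < v -> bmf F ->
  bmf (fun w => \1_(survo s x v) w * F w) /\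
  (fun k => \int[P]_w (\1_(surv s x (ck k) 0 v) w * F w)) @ \oo -->
  \int[P]_w (\1_(survo s x v) w * F w).
Proof.
move=> s0 v0 [mF [M FM]].
by apply: (@int_survo s x v (fun=> F) F M) => // w; exact: cvg_cst.
Qed.

Lemma bmf_survo s x v : 0 <= s -> 0 < v -> bmf (\1_(survo s x v) : Omega -> R).
Proof.
move=> s0 v0; have := (int_survo_cst x s0 v0 (bmf_cst Omega 1)).1.
by rewrite (_ : (fun w => _) = \1_(survo s x v))//; apply/funext => w; rewrite mulr1.
Qed.

Let bmfZs s x v f : 0 <= s -> 0 < v -> bmf f -> bmf (fun w => f (Zs W s x v w)).
Proof. by move=> s0 v0 bf; apply: (bmf_comp bf); exact: (measurable_Zs hW x s0 (ltW v0)). Qed.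

Let surv_Tc' s x c v f : 0 <= s -> 0 < v -> bmf f ->
  \int[P]_w (\1_(surv s x c 0 v) w * f (Zs W s x v w)) = Tc c v f x.
Proof.
move=> s0 v0 bf; have [xc|xc] := leP `|x| c; first exact: surv_Tc.
rewrite Tc_off ?(ltW v0)// -[RHS](prob_int_cst P); apply: eq_Rintegral => w _.
rewrite indicE memNset ?mul0r// => /(_ 0).
by rewrite lexx (ltW v0) (Zs0 hW)// leNgt xc => /(_ isT).
Qed.

Lemma Tc_cvg x v f : 0 < v -> bmf f -> Tc (ck k) v f x @[k --> \oo] --> T v f x.
Proof.
by move=> v0 bf; exact: (int_survo_cst x (lexx 0) v0 (bmfZs x (lexx 0) v0 bf)).2.
Qed.

Lemma survo_T s x v f : 0 <= s -> 0 < v -> bmf f ->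
  \int[P]_w (\1_(survo s x v) w * f (Zs W s x v w)) = T v f x.
Proof.
move=> s0 v0 bf; have c1 := (int_survo_cst x s0 v0 (bmfZs x s0 v0 bf)).2.
have c2 := @Tc_cvg x v f v0 bf.
apply: (rcvg_unique c1 c2) => k.
exact: surv_Tc'.
Qed.

Lemma T_norm_le v f x M : 0 < v -> bmf f -> (forall y, `|f y| <= M) -> `|T v f x| <= M.
Proof.
move=> v0 bf fM.
apply: (prob_int_norm_le P (int_survo_cst x (lexx 0) v0 (bmfZs x (lexx 0) v0 bf)).1) => w.
by rewrite normrM (le_trans (ler_wpM2r _ (indic_le1 _ _)))// mul1r.
Qed.

Lemma bmf_T v f : 0 < v -> bmf f -> bmf (T v f).
Proof.
move=> v0 bf; split.
  apply: (measurable_fun_cvg (D := setT) (fun k => (bmf_Tc (ck k) v0 bf).1)) => x _.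
  exact: Tc_cvg.
by have [M fM] := bf.2; exists M => x; exact: T_norm_le.
Qed.

Lemma Tc_norm_le c v f x M : 0 < v -> bmf f -> (forall y, `|f y| <= M) -> `|Tc c v f x| <= M.
Proof.
move=> v0 bf fM.
apply: (prob_int_norm_le P (bmf_surv x c (lexx 0) v0 (bmfZs x (lexx 0) v0 bf))) => w.
by rewrite normrM (le_trans (ler_wpM2r _ (indic_le1 _ _)))// mul1r.
Qed.

(** The level [ck k] tends to 1 in the outer and in the inner operator at the same time, which is
    why [int_survo] lets the integrand depend on [k]. *)
Lemma markov s x v v' S f : 0 <= s -> 0 < v -> 0 < v' -> measurable S -> bmf f ->
  \int[P]_w (\1_(survo s x (v + v')) w *
    (\1_S (Zs W s x v w) * f (Zs W s x (v + v') w))) =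
  T v (fun y => \1_S y * T v' f y) x.
Proof.
move=> s0 v0 v0' mS bf; have vv0 := addr_gt0 v0 v0'.
have bS : bmf (\1_S : R -> R) by exact: bmf_indic.
have bL : bmf (fun w => \1_S (Zs W s x v w) * f (Zs W s x (v + v') w)).
  by apply: bmfM; exact: bmfZs.
have [M fM] := bf.2.
have bg g : bmf g -> bmf (fun y => \1_S y * g y) by move=> bg; exact: bmfM.
have [||| _ c2] := @int_survo s x v
    (fun k w => \1_S (Zs W s x v w) * Tc (ck k) v' f (Zs W s x v w))
    (fun w => \1_S (Zs W s x v w) * T v' f (Zs W s x v w)) M s0 v0.
- by move=> k; apply: (bmfZs x s0 v0 (bg _ (bmf_Tc (ck k) v0' bf))).1.
- move=> k w; rewrite normrM (le_trans (ler_wpM2r _ (_ : _ <= 1))) ?mul1r//.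
    by rewrite indicE; case: (_ \in _); rewrite ?normr0 ?normr1.
  exact: Tc_norm_le.
- by move=> w; apply: rcvgZ; exact: Tc_cvg.
rewrite -(survo_T x s0 v0 (bg _ (bmf_T v0' bf))).
have c1 := (int_survo_cst x s0 vv0 bL).2.
apply: (rcvg_unique c1 c2) => k; rewrite (surv_Tc' x (ck k) s0 v0 (bg _ (bmf_Tc (ck k) v0' bf))).
have [xc|xc] := leP `|x| (ck k); first by rewrite markov_c.
rewrite Tc_off ?(ltW v0)// -[RHS](prob_int_cst P); apply: eq_Rintegral => w _.
rewrite indicE memNset ?mul0r// => /(_ 0).
by rewrite lexx (ltW vv0) (Zs0 hW)// leNgt xc => /(_ isT).
Qed.

End survival.

(** * Estimates for the killed semigroup in continuous time *)

Section killed_semigroup.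
Context {R : realType} (d : measure_display) (Omega : measurableType d)
  (P : probability Omega R) (W : R -> Omega -> R) (hW : is_std_BM P W).
Implicit Types (x y c v t e : R) (f g : R -> R) (n k : nat).

Local Notation T := (killT P W).
Local Notation Tc := (killTc P W).
Local Notation ck := (@ck R).

Let Z0 := Zs W 0.

Let bmf_T_int v x f : 0 < v -> bmf f -> bmf (fun w => \1_(survo W 0 x v) w * f (Z0 x v w)).
Proof.
move=> v0 bf; apply: bmfM; first exact: (bmf_survo hW).
by apply: (bmf_comp bf); exact: (measurable_Zs hW x (lexx 0) (ltW v0)).
Qed.

Let surv_lt1 x v w : 0 <= v -> survo W 0 x v w -> `|Z0 x v w| < 1.
Proof. by move=> v0 /(_ v); rewrite lexx v0 => /(_ isT). Qed.

Lemma T_ext v f g x : 0 <= v -> (forall y, `|y| < 1 -> f y = g y) -> T v f x = T v g x.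
Proof.
move=> v0 fg; apply: eq_Rintegral => w _.
rewrite indicE; have [/set_mem wS|] := boolP (w \in _); last by rewrite !mul0r.
by rewrite fg//; exact: surv_lt1.
Qed.

Lemma T_le v f g x : 0 < v -> bmf f -> bmf g -> (forall y, `|y| < 1 -> f y <= g y) ->
  T v f x <= T v g x.
Proof.
move=> v0 bf bg fg; apply: bmf_le => [||w]; [exact: bmf_T_int|exact: bmf_T_int|].
rewrite indicE; have [/set_mem wS|] := boolP (w \in _); last by rewrite !mul0r.
by rewrite !mul1r; apply: fg; apply: surv_lt1 wS; exact: ltW.
Qed.

Lemma T_ge0 v f x : 0 <= v -> (forall y, `|y| < 1 -> 0 <= f y) -> 0 <= T v f x.
Proof.
move=> v0 f0; apply: int_ge0 => w.
rewrite indicE; have [/set_mem wS|] := boolP (w \in _); last by rewrite !mul0r.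
by rewrite mul1r; apply: f0; exact: surv_lt1.
Qed.

Lemma TZ v a f x : 0 < v -> bmf f -> T v (fun y => a * f y) x = a * T v f x.
Proof.
move=> v0 bf; rewrite /killT -bmf_intZ; last exact: bmf_T_int.
by apply: eq_Rintegral => w _; ring.
Qed.

Lemma TD v f g x : 0 < v -> bmf f -> bmf g -> T v (fun y => f y + g y) x = T v f x + T v g x.
Proof.
move=> v0 bf bg; rewrite /killT -bmf_intD; [|exact: bmf_T_int|exact: bmf_T_int].
by apply: eq_Rintegral => w _; ring.
Qed.

Lemma T_off v f x : 0 <= v -> 1 <= `|x| -> T v f x = 0.
Proof.
move=> v0 x1; rewrite -[RHS](prob_int_cst P); apply: eq_Rintegral => w _.
rewrite indicE memNset ?mul0r// => /(_ 0).
by rewrite lexx v0 (Zs0 hW)// ltNge x1 => /(_ isT).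
Qed.

Lemma T_semigroup v v' f x : 0 < v -> 0 < v' -> bmf f -> T v (T v' f) x = T (v + v') f x.
Proof.
move=> v0 v0' bf.
have := markov hW x (lexx 0) v0 v0' measurableT bf.
rewrite (_ : (fun y => _) = T v' f); last by apply/funext => y; rewrite indicT mul1r.
by move=> <-; apply: eq_Rintegral => w _; rewrite indicT mul1r.
Qed.

Lemma ck_lt1 k : ck k < 1.
Proof. by rewrite /ck ltrBlDr ltrDl invr_gt0. Qed.

Lemma ck_near a : a < 1 -> \forall k \near \oo, a <= ck k.
Proof.
move=> a1; have e0 : 0 < 1 - a by rewrite subr_gt0.
have := near_infty_natSinv_lt (PosNum e0); apply: filterS => k /=.
by rewrite /ck; move: (_^-1) => b; lra.
Qed.

Lemma T_le_lim v f x B : 0 < v -> bmf f -> (\forall k \near \oo, Tc (ck k) v f x <= B) ->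
  T v f x <= B.
Proof. by move=> v0 bf h; apply: (cvgr_to_le (Tc_cvg hW v0 bf) h). Qed.

Lemma T_ge_lim v f x B : 0 < v -> bmf f -> (\forall k \near \oo, B <= Tc (ck k) v f x) ->
  B <= T v f x.
Proof. by move=> v0 bf h; apply: (cvgr_to_ge (Tc_cvg hW v0 bf) h). Qed.

Let th v n : R := 1 - expR (- (v / n.+1%:R)).

Let expn v n : expR (- (v / n.+1%:R)) ^+ n.+1 = expR (- v).
Proof. by rewrite -expRM_natl; congr expR; field. Qed.

(** Over the n + 1 steps the variances add up to v and their squares to 0, both up to v^2 / (n +
    1). *)
Let th_bounds v n : 0 < v -> 0 <= th v n /\ n.+1%:R * th v n <= v /\
   n.+1%:R * th v n ^+ 2 <= v ^+ 2 / n.+1%:R /\ v - v ^+ 2 / n.+1%:R <= n.+1%:R * th v n.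
Proof.
move=> v0; have n0 : 0 < n.+1%:R :> R by rewrite ltr0n.
have q0 : 0 < v / n.+1%:R by rewrite divr_gt0.
have E : n.+1%:R * (v / n.+1%:R) = v by field.
have E2 : v ^+ 2 / n.+1%:R = n.+1%:R * (v / n.+1%:R) ^+ 2 by field.
rewrite /th E2 -{3 6}E; move: (v / n.+1%:R) q0 => q q0.
have h1 := expR_ge1Dx (- q); have h2 := expR_ge1Dx q.
have e0 := expR_gt0 (- q).
have h3 : expR (- q) * expR q = 1 by rewrite -expRD addNr expR0.
have t0 : 0 <= 1 - expR (- q) by nra.
split=> //; split; first by rewrite ler_pM2l//; lra.
split; first by rewrite ler_pM2l// ler_sqr ?nnegrE//; lra.
by rewrite -mulrBr ler_pM2l//; nra.
Qed.

Lemma harm_cvg (a b : R) : a + b / n.+1%:R @[n --> \oo] --> a.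
Proof.
rewrite -[X in _ --> X]addr0 -[X in _ + X](mulr0 b).
by apply: rcvgD; [exact: cvg_cst|apply: rcvgZ; exact: cvg_harmonic].
Qed.

Let bmf_hb := @bmf_hb R.

Let e_bound (a b K : R) : 0 <= K -> (forall e, 0 < e -> e < 1 -> a <= b + e * K) -> a <= b.
Proof.
move=> K0 h; apply/ler_addgt0Pr => e e0.
have K1 : 0 < K + 1 by lra.
pose e' := Num.min (1 / 2) (e / (K + 1)).
have e'0 : 0 < e' by rewrite lt_min; apply/andP; split; [lra|exact: divr_gt0].
have e'1 : e' < 1 by rewrite gt_min; apply/orP; left; lra.
have e'e : e' * (K + 1) <= e by rewrite -ler_pdivlMr// ge_min lexx orbT.
have := h e' e'0 e'1; nra.
Qed.

(** Both inequalities take three limits in the same order: the grid, the level, and last the slack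
    [e] of the test functions. *)
Lemma T_h v x : 0 < v -> `|x| < 1 -> T v hb x = expR (- v) * hfun x.
Proof.
move=> v0 x1; have ev := expR_ge0 (- v); apply/eqP; rewrite eq_le; apply/andP; split.
  apply: (@e_bound _ _ (expR (- v) + v)) => [|e e0 _]; first lra.
  have [D D0 HD] := iter_h_le e0.
  apply: T_le_lim => //; apply: filterS (ck_near x1) => k xk.
  have h := iter_cvg_Tc hW v0 xk bmf_hb.
  have h2 := @harm_cvg (expR (- v) * hfun x + e * (expR (- v) + v)) (3 * D * v ^+ 2).
  apply: (ler_cvg_to h h2); apply: nearW => n.
  have d0 : 0 <= v / n.+1%:R by rewrite divr_ge0// ltW.
  apply: (le_trans (HD _ _ n.+1 _ d0 (ltW (ck_lt1 k)) xk)).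
  rewrite expn; have [t0 [t1 [t2 t3]]] := th_bounds n v0; rewrite -/(th v n).
  have p1 : e * (n.+1%:R * th v n) <= e * v by rewrite ler_pM2l.
  have p2 : 3 * D * (n.+1%:R * th v n ^+ 2) <= 3 * D * (v ^+ 2 / n.+1%:R).
    by rewrite ler_wpM2l// mulr_ge0.
  move: p1 p2; move: (n.+1%:R : R) (th v n) => N q p1 p2.
  by lra.
apply: (@e_bound _ _ (expR (- v) + v)) => [|e e0 e1]; first lra.
rewrite -lerBlDr; apply: T_ge_lim => //.
near=> k.
have xk : `|x| <= ck k by near: k; exact: ck_near.
have h := iter_cvg_Tc hW v0 xk bmf_hb.
apply: (cvgr_to_ge h); apply: nearW => n.
have d0 : 0 <= v / n.+1%:R by rewrite divr_ge0// ltW.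
have ce : 1 - e / 2 <= ck k by near: k; apply: ck_near; lra.
have c01 : 0 <= ck k <= 1 by rewrite (le_trans _ xk)//= ltW// ck_lt1.
have ce2 : 1 - e <= ck k ^+ 2 by rewrite expr2; nra.
apply: (le_trans _ (iter_h_ge n.+1 (ltW e0) d0 c01 ce2 xk)).
rewrite expn; have [t0 [t1 [t2 t3]]] := th_bounds n v0; rewrite -/(th v n).
have p1 : e * (n.+1%:R * th v n) <= e * v by rewrite ler_pM2l.
move: p1; move: (n.+1%:R : R) (th v n) => N q p1.
by lra.
Unshelve. all: by end_near. Qed.

Lemma T_1_le v x : 0 < v -> `|x| < 1 -> v * T v (fun=> 1) x <= 3 * hfun x.
Proof.
move=> v0 x1; have b1 : bmf (fun _ : R => 1 : R) by exact: bmf_cst.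
suff : v / 2 * T v (fun=> 1) x <= 3 / 2 * hfun x by lra.
apply: (@e_bound _ _ 1) => // e e0 _; rewrite mulr1.
rewrite mulrC -ler_pdivlMr ?divr_gt0//; apply: T_le_lim => //.
apply: filterS (ck_near x1) => k xk.
rewrite ler_pdivlMr ?divr_gt0// mulrC.
have [D D0 HD] := iter_1_le e0.
have h := iter_cvg_Tc hW v0 xk b1.
have h2 := @harm_cvg (v / 2) (- (v ^+ 2 / 2 + 3 * D * v ^+ 2)).
apply: (cvgr_to_le (rcvgM h2 h)).
near=> n.
have d0 : 0 <= v / n.+1%:R by rewrite divr_ge0// ltW.
have [t0 [t1 [t2 t3]]] := th_bounds n v0.
have tl : th v n <= v / n.+1%:R by rewrite ler_pdivlMr// mulrC.
have D1 : 6 * D * (1 - expR (- (v / n.+1%:R))) <= 1.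
  rewrite -/(th v n); have : 0 + 6 * D * v / n.+1%:R < 1.
    by near: n; apply: (cvgr_lt _ (@harm_cvg 0 (6 * D * v))); exact: ltr01.
  rewrite add0r -(mulrA (6 * D)) => hD; apply: ltW; apply: le_lt_trans hD.
  by rewrite ler_wpM2l// mulr_ge0.
apply: (le_trans _ (HD _ _ n.+1 _ d0 (ltW (ck_lt1 k)) xk D1)).
rewrite -/(th v n); apply: ler_wpM2r; first by apply: iter_killK_ge0 => // y _; exact: ler01.
have p2 : 3 * D * (n.+1%:R * th v n ^+ 2) <= 3 * D * (v ^+ 2 / n.+1%:R).
  by rewrite ler_wpM2l// mulr_ge0.
move: t3 p2; move: (n.+1%:R : R) (th v n) => N q t3 p2.
by lra.
Unshelve. all: by end_near. Qed.

(** The bound for h^2 - 4/5 h, to which 4/5 T h = 4/5 exp (- v) h is added back. *)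
Lemma T_h2_ge v x : 0 < v -> `|x| < 1 ->
  4 / 5 * (expR (- v) - expR (- 8 * v)) * hfun x <= T v (fun y => hb y * hb y) x.
Proof.
move=> v0 x1.
have bh2 : bmf (fun y : R => hb y * hb y) by exact: bmfM.
have bF : bmf (fun y : R => hb y * hb y - 4 / 5 * hb y) by apply: bmfB => //; exact: bmfZ.
suff H : - (expR (- 8 * v) * (4 / 5 * hfun x)) <= T v (fun y => hb y * hb y - 4 / 5 * hb y) x.
  have E : T v (fun y => hb y * hb y) x =
      T v (fun y => hb y * hb y - 4 / 5 * hb y) x + 4 / 5 * T v hb x.
    rewrite -TZ// -TD//; last exact: bmfZ.
    by apply: T_ext => [|y _]; [exact: ltW|ring].
  by rewrite E T_h//; lra.
have ev := expR_ge0 (- 8 * v).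
apply: (@e_bound _ _ (expR (- 8 * v) + 8 * v)) => [|e e0 e1]; first lra.
rewrite -lerBlDr; apply: T_ge_lim => //.
have [D D0 HD] := iter_h2_ge e0.
near=> k.
have xk : `|x| <= ck k by near: k; exact: ck_near.
have h := iter_cvg_Tc hW v0 xk bF.
have h2 := @harm_cvg (- (expR (- 8 * v) * (4 / 5 * hfun x)) - e * (expR (- 8 * v) + 8 * v))
  (- (3 * D * v ^+ 2)).
apply: (ler_cvg_to h2 h); near=> n.
have d0 : 0 <= v / n.+1%:R by rewrite divr_ge0// ltW.
have [t0 [t1 [t2 t3]]] := th_bounds n v0.
have tl : th v n <= v / n.+1%:R by rewrite ler_pdivlMr// mulrC.
have c12 : 1 / 2 <= ck k by near: k; apply: ck_near; lra.
have c01 : 1 / 2 <= ck k <= 1 by rewrite c12 ltW// ck_lt1.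
have D1 : 100 * (1 - expR (- (v / n.+1%:R))) <= 8.
  rewrite -/(th v n); have hD : 0 + v / n.+1%:R < 8 / 100.
    by near: n; apply: (cvgr_lt _ (@harm_cvg 0 v)); lra.
  move: tl hD; move: (th v n) (v / n.+1%:R) => p q p1 q1; lra.
apply: (le_trans _ (HD _ _ n.+1 _ d0 c01 xk D1)).
have -> : expR (- 8 * (v / n.+1%:R)) ^+ n.+1 = expR (- 8 * v).
  by rewrite -expRM_natl; congr expR; field.
rewrite -/(th v n).
have p1 : e * (n.+1%:R * th v n) <= e * v by rewrite ler_pM2l.
have p2 : 3 * D * (n.+1%:R * th v n ^+ 2) <= 3 * D * (v ^+ 2 / n.+1%:R).
  by rewrite ler_wpM2l// mulr_ge0.
move: p1 p2; move: (n.+1%:R : R) (th v n) => N q N1 N2; lra.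
Unshelve. all: by end_near. Qed.

Lemma T_sym v f g : 0 < v -> bmf f -> bmf g ->
  \int[lamI]_x (gam x * g x * T v f x) = \int[lamI]_x (gam x * f x * T v g x).
Proof.
move=> v0 bf bg.
have [Mf fM] := bf.2; have [Mg gM] := bg.2; have [G gG] := (@bmf_gam R).2.
have G0 : 0 <= G by rewrite (le_trans _ (gG 0)).
have Mf0 : 0 <= Mf by rewrite (le_trans _ (fM 0)).
have bd x (p q M N : R) : `|p| <= M -> `|q| <= N -> `|gam x * p * q| <= G * M * N.
  by move=> pM qN; rewrite !normrM ler_pM// ?mulr_ge0// ler_pM.
have c1 (p q : R -> R) k : bmf p -> bmf q ->
    (fun n => \int[lamI]_x (gam x * (\1_(seg (ck k)) x * q x) *
      iter n.+1 (killK (ck k) (v / n.+1%:R)) p x)) @ \oo -->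
    \int[lamI]_x (gam x * q x * Tc (ck k) v p x).
  move=> bp bq; have [Mp pM] := bp.2; have [Mq qM] := bq.2.
  apply: (@bmf_cvg _ _ _ lamI _ _ (G * Mq * Mp) _ _ _).2 => [n|n x|x].
  - apply: (bmfM (bmfM bmf_gam (bmf_restr (ck k) bq)) (bmf_iter _ _ _ bp)).1.
  - apply: bd; last exact: (iter_norm_le hW).
    rewrite indicE; case: (_ \in _); rewrite ?mul1r ?mul0r// normr0.
    exact: le_trans (qM 0).
  - apply: (rcvg_eq (f := fun n => gam x * q x *
      (\1_(seg (ck k)) x * iter n.+1 (killK (ck k) (v / n.+1%:R)) p x))).
      by move=> n; ring.
    by apply: rcvgZ; exact: (seg_iter_cvg hW).
have c2 (p q : R -> R) : bmf p -> bmf q ->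
    (fun k => \int[lamI]_x (gam x * q x * Tc (ck k) v p x)) @ \oo -->
    \int[lamI]_x (gam x * q x * T v p x).
  move=> bp bq; have [Mp pM] := bp.2; have [Mq qM] := bq.2.
  apply: (@bmf_cvg _ _ _ lamI _ _ (G * Mq * Mp) _ _ _).2 => [k|k x|x].
  - by apply: (bmfM (bmfM bmf_gam bq) (bmf_Tc hW _ v0 bp)).1.
  - by apply: bd => //; exact: (Tc_norm_le hW).
  - by apply: rcvgZ; exact: (Tc_cvg hW).
have e1 := c2 f g bf bg; have e2 := c2 g f bg bf.
apply: (rcvg_unique e1 e2) => k.
have e3 := c1 f g k bf bg; have e4 := c1 g f k bg bf.
apply: (rcvg_unique e3 e4) => n.
by apply: iter_killK_sym => //; [rewrite divr_gt0|exact: ck_lt1].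
Qed.

(** The killed paths cost at most [kap] times the integral of [f], which bounds the free operator
    beyond 19/20, and without killing the value is at least twice that. *)
Lemma T_minorization : exists2 kap : R, 0 < kap & forall f x, bmf f -> (forall y, 0 <= f y) ->
  (forall y, 1 / 10 < `|y| -> f y = 0) -> `|x| <= 1 / 2 ->
  kap * \int[lebesgue_measure]_y f y <= T (1 / 20) f x.
Proof.
have v0 : 0 < 1 / 20 :> R by lra.
have [|kap k0 [K1 K2]] := @ouK_free_bounds R _ v0; first lra.
exists kap => // f x bf f0 supp x12.
apply: T_ge_lim => //; near=> k.
have xk : `|x| <= ck k by near: k; apply: ck_near; lra.
have ck9 : 19 / 20 <= ck k by near: k; apply: ck_near; lra.
have h := iter_cvg_Tc hW v0 xk bf.
apply: (cvgr_to_ge h); apply: nearW => n.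
have n0 : 0 < n.+1%:R :> R by rewrite ltr0n.
have q0 : 0 < 1 / 20 / n.+1%:R :> R by rewrite divr_gt0.
set B := kap * _.
have I0 : 0 <= \int[@lebesgue_measure R]_y f y by apply: Rintegral_ge0 => y _.
have := @iter_killK_ge_free R (ck k) (1 / 20 / n.+1%:R) f n.+1 x B q0 bf f0.
have -> : (1 / 20 / n.+1%:R : R) *+ n.+1 = 1 / 20 by rewrite -[LHS]mulr_natr divfK// gt_eqF.
move=> /(_ _ _ _ _ xk)/wrap[a b g y a0 b0 bg| |y cy|j z /andP[j0 jn] cz|].
- exact: (ouK_semigroup hW y (lexx 0)).
- by rewrite mulr_ge0// ltW.
- by apply: supp; lra.
- apply: K2 => //; last lra.
    by rewrite pmulrn_rgt0.
  by rewrite -[leLHS]mulr_natr mulrAC ler_pdivrMr// ler_pM2l// ler_nat.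
apply: le_trans; rewrite lerBrDr; apply: (le_trans _ (K1 f x bf f0 supp x12)).
by rewrite /B; lra.
Unshelve. all: by end_near. Qed.

End killed_semigroup.

(** * Doeblin contraction *)

Section contraction.
Context {R : realType} (d : measure_display) (Omega : measurableType d)
  (P : probability Omega R) (W : R -> Omega -> R) (hW : is_std_BM P W).
Implicit Types (x y c v t e : R) (f g F : R -> R) (n k : nat).

Local Notation T := (killT P W).
Local Notation leb := (@lebesgue_measure R).

Let bmf_hb := @bmf_hb R.
(** Time 1 brings mass to |x| <= 1/2 ([T_seg_ge]), and time 1/20 spreads it over |y| <= 1/10
    ([T_minorization]). *)
Let tau : R := 1 + 1 / 20.

Definition ip f : R := \int[lamI]_x (gam x * hb x * f x).

Lemma hb_off x : 1 <= `|x| -> hb x = 0.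
Proof.
move=> x1; rewrite /hb indic_seg; case: ifPn => x2; last by rewrite mul0r.
rewrite mul1r /hfun -real_normK ?num_real// (_ : `|x| = 1) ?expr1n ?subrr//.
exact/le_anti/andP.
Qed.

Lemma ipZ c f : bmf f -> ip (fun y => c * f y) = c * ip f.
Proof.
move=> bf; rewrite /ip -bmf_intZ; last exact: (bmfM (bmfM (@bmf_gam R) bmf_hb) bf).
by apply: eq_Rintegral => y _; ring.
Qed.

Lemma ip_le f g : bmf f -> bmf g -> (forall y, `|y| < 1 -> f y <= g y) -> ip f <= ip g.
Proof.
move=> bf bg fg; have bgh := bmfM (@bmf_gam R) bmf_hb.
rewrite /ip; apply: bmf_le => [||y]; [exact: (bmfM bgh bf)|exact: (bmfM bgh bg)|].
have [y1|y1] := ltP `|y| 1; last by rewrite hb_off// !mulr0 !mul0r.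
apply: ler_wpM2l; last exact: fg.
by rewrite mulr_ge0 ?expR_ge0//; have /andP[] := hb01 y.
Qed.

Let bI f : R := \int[lamI]_x (\1_(seg (1 / 10)) x * f x).

Let b_seg c : bmf (\1_(seg c) : R -> R).
Proof. by apply: bmf_indic; exact: measurable_seg. Qed.

Let bIE f : bmf f -> bI f = \int[leb]_x (\1_(seg (1 / 10)) x * f x).
Proof.
move=> bf; rewrite /bI lamIE; last exact: bmf_restr.
rewrite [LHS]Rintegral_mkcond; apply: eq_Rintegral => y _.
rewrite patchE; case: ifPn => // /negP yI.
rewrite indic_seg; case: ifPn => yc; last by rewrite mul0r.
by exfalso; apply: yI; apply/mem_set/IP; lra.
Qed.

Let bIB f g : bmf f -> bmf g -> bI (fun x => f x - g x) = bI f - bI g.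
Proof.
move=> bf bg; rewrite /bI -bmf_intB; [|exact: bmf_restr|exact: bmf_restr].
by apply: eq_Rintegral => x _; ring.
Qed.

Let bIZ a f : bmf f -> bI (fun x => a * f x) = a * bI f.
Proof.
move=> bf; rewrite /bI -bmf_intZ; last exact: bmf_restr.
by apply: eq_Rintegral => x _; ring.
Qed.

Let bI_ge0 f : (forall x, `|x| < 1 -> 0 <= f x) -> 0 <= bI f.
Proof.
move=> f0; apply: int_ge0 => x; rewrite indic_seg; case: ifPn => x1; last by rewrite mul0r.
by rewrite mul1r; apply: f0; lra.
Qed.

Let lam_seg c : 0 < c -> c < 1 -> \int[lamI]_x (\1_(seg c) x) = 2 * c.
Proof.
move=> c0 c1; rewrite lamIE; last exact: b_seg.
rewrite /Rintegral integral_indic; [|exact: measurable_I|exact: measurable_seg].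
rewrite setIidl; last by move=> x /segP xc; apply/IP; exact: le_lt_trans c1.
suff E : leb (seg c) = (2 * c)%:E by exact: (congr1 fine E).
have := @lebesgue_measure_itv R `[- c, c]; rewrite /= lte_fin ifT; last lra.
by rewrite -EFinD => ->; congr EFin; ring.
Qed.

Let hb_seg x : `|x| <= 1 / 2 -> 3 / 4 <= hb x.
Proof.
move=> x1; rewrite hbE; last lra.
by rewrite /hfun -real_normK ?num_real//; have := normr_ge0 x; nra.
Qed.

Let bI_h_gt0 : 0 < bI hb.
Proof.
apply: (@lt_le_trans _ _ (3 / 4 * (2 * (1 / 10)))); first lra.
rewrite -lam_seg; [|lra|lra].
rewrite -bmf_intZ; last exact: b_seg.
apply: bmf_le; [by apply: bmfZ; exact: b_seg|exact: bmf_restr|move=> x].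
rewrite indic_seg; case: ifPn => x1; last by rewrite mulr0 mul0r.
by rewrite mulr1 mul1r; apply: hb_seg; lra.
Qed.

Lemma ip_hb_gt0 : 0 < ip hb.
Proof.
have e0 := expR_gt0 (- (1 / 2) : R).
apply: (@lt_le_trans _ _ (expR (- (1 / 2)) * (3 / 4) * (3 / 4) * (2 * (1 / 2)))).
  by rewrite !mulr_gt0//; lra.
rewrite -lam_seg; [|lra|lra].
rewrite -bmf_intZ; last exact: b_seg.
apply: bmf_le => [||x]; [by apply: bmfZ; exact: b_seg|exact: (bmfM (bmfM (@bmf_gam R) bmf_hb) bmf_hb)|].
have g0 : 0 <= gam x by exact: expR_ge0.
have /andP[h0 _] := hb01 x.
rewrite indic_seg; case: ifPn => x1; last first.
  by rewrite mulr0; apply: mulr_ge0 => //; exact: mulr_ge0.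
have hx := hb_seg x1; rewrite mulr1.
have gx : expR (- (1 / 2)) <= gam x.
  rewrite ler_expR; have : x ^+ 2 <= 1; last lra.
  by rewrite -real_normK ?num_real//; have := normr_ge0 x; nra.
have p34 : 0 <= 3 / 4 :> R by lra.
by do 2 (apply: ler_pM => //).
Qed.

(* On [-1, 1], [h^2 <= 3/4 h + 1/4 1_(|x| <= 1/2)], so the lower bound on [T h^2]
   forces mass near the origin. *)
Let T_seg_ge x : `|x| < 1 -> 16 / 100 * expR (- 1) * hb x <= T 1 (\1_(seg (1 / 2))) x.
Proof.
move=> x1; have xh : hb x = hfun x by rewrite hbE// ltW.
have /andP[h0 _] := hb01 x.
have bh2 : bmf (fun y : R => hb y * hb y) by exact: bmfM.
have bR : bmf (fun y : R => 3 / 4 * hb y + 1 / 4 * \1_(seg (1 / 2)) y).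
  by apply: bmfD; apply: bmfZ => //; exact: b_seg.
have := T_h2_ge hW ltr01 x1.
have := @T_le _ _ _ _ _ hW 1 _ _ x ltr01 bh2 bR.
move=> /(_ _)/wrap[y y1|].
  rewrite indic_seg; have /andP[p0 p1] := hb01 y; case: ifPn => hy.
    by have := hb_seg hy; nra.
  have : hb y <= 3 / 4; last by nra.
  rewrite hbE ?ltW// /hfun -real_normK ?num_real//; move: hy; rewrite -ltNge.
  by have := normr_ge0 y; nra.
rewrite (TD hW); [|lra|exact: bmfZ|by apply: bmfZ; exact: b_seg].
rewrite (TZ hW); [|lra|exact: bmf_hb].
rewrite (TZ hW); [|lra|exact: b_seg].
rewrite (T_h hW ltr01 x1).
(* In units of exp (- 1) h there remains 4 (4/5 - 3/4) = 1/5 minus 16/5 exp (- 7), which exceeds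
   16/100 as soon as exp 7 >= 2^7. *)
have e7 : expR (- 8 * 1) <= expR (- 1) * (1 / 128) :> R.
  have -> : - 8 * 1 = - 1 - 7 :> R by ring.
  rewrite expRD ler_wpM2l ?expR_ge0// expRN.
  have h : 128 <= expR 7 :> R.
    rewrite -[X in expR X]mulr1 expRM_natl; have h := expR_ge1Dx (1 : R).
    apply: (@le_trans _ _ (2 ^+ 7)); first by rewrite -natrX ler_nat.
    by apply: lerXn2r; rewrite ?nnegrE ?expR_ge0//; lra.
  have e7 := expR_gt0 (7 : R).
  rewrite ler_pdivlMr; last lra.
  by rewrite mulrC ler_pdivrMr//; lra.
have e1 := expR_gt0 (- 1 : R).
rewrite -xh => h1 h2; have := ler_wpM2r h0 e7; have := mulr_ge0 (ltW e1) h0; lra.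
Qed.

Let doeblin : exists2 del : R, 0 < del & forall f x, bmf f ->
  (forall y, `|y| < 1 -> 0 <= f y) -> `|x| < 1 -> del * bI f * hb x <= T tau f x.
Proof.
have [kap k0 K] := T_minorization hW.
exists (kap * (16 / 100 * expR (- 1))); first by rewrite !mulr_gt0// ?expR_gt0//; lra.
move=> f x bf f0 x1; pose f1 y : R := \1_(seg (1 / 10)) y * f y.
have bf1 : bmf f1 by exact: bmf_restr.
have v20 : 0 < 1 / 20 :> R by lra.
have f1f y : `|y| < 1 -> f1 y <= f y.
  by move=> y1; rewrite /f1 indic_seg; case: ifP => _; rewrite ?mul1r// mul0r f0.
have f10 y : 0 <= f1 y.
  by rewrite /f1 indic_seg; case: ifPn => y1; [rewrite mul1r; apply: f0; lra|rewrite mul0r].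
have f1s y : 1 / 10 < `|y| -> f1 y = 0.
  by rewrite /f1 indic_seg ltNge => /negPf ->; rewrite mul0r.
rewrite /tau -(T_semigroup hW)//.
have bT := bmf_T hW v20 bf.
have I0 : 0 <= bI f by exact: bI_ge0.
apply: (@le_trans _ _ (T 1 (fun y => kap * bI f * \1_(seg (1 / 2)) y) x)).
  rewrite (TZ hW); [|lra|exact: b_seg].
  have := T_seg_ge x1.
  have kI : 0 <= kap * bI f by rewrite mulr_ge0// ltW.
  by move=> /(ler_wpM2l kI); lra.
apply: (T_le hW) => [||//|y y1]; [lra|by apply: bmfZ; exact: b_seg|].
rewrite indic_seg; case: ifPn => hy; last by rewrite mulr0; apply: T_ge0 => //; exact: ltW.
rewrite mulr1; apply: (@le_trans _ _ (T (1 / 20) f1 y)); last exact: (T_le hW).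
by rewrite bIE//; apply: K.
Qed.

Let hb_hfun x : `|x| < 1 -> hb x = hfun x. Proof. by move=> x1; rewrite hbE// ltW. Qed.

Let exp1 r : expR r * expR (- r) = 1 :> R.
Proof. by rewrite -expRD subrr expR0. Qed.

(** The operator exp r T_r preserves order and fixes h on (-1, 1), so it keeps bounds by multiples
    of h. *)
Let sandwich_T F a b r x : 0 < r -> bmf F ->
  (forall y, `|y| < 1 -> a * hb y <= F y <= b * hb y) -> `|x| < 1 ->
  a * hb x <= expR r * T r F x <= b * hb x.
Proof.
move=> r0 bF ab x1.
have e c : expR r * T r (fun y => c * hb y) x = c * hb x.
  by rewrite (TZ hW)// (T_h hW)// hb_hfun// mulrCA; congr (_ * _); rewrite mulrA exp1 mul1r.
rewrite -!e !ler_pM2l ?expR_gt0//; apply/andP; split; apply: (T_le hW) => //;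
  try exact: bmfZ; by move=> y /ab /andP[].
Qed.

(** The minorization applies to F - a h and to b h - F. Their integrals over [-1/10, 1/10] add up to
    b - a times that of h, so the two ends together gain a fixed proportion of b - a, however it is
    shared between them. *)
Let contraction : exists2 rho : R, 0 <= rho < 1 & forall F a b, bmf F -> a <= b ->
  (forall x, `|x| < 1 -> a * hb x <= F x <= b * hb x) ->
  exists a' b', [/\ a' <= b', b' - a' <= rho * (b - a) &
   forall x, `|x| < 1 -> a' * hb x <= expR tau * T tau F x <= b' * hb x].
Proof.
have [del d0 D] := doeblin.
have tau0 : 0 < tau by rewrite /tau; lra.
(* The second term of the minimum keeps [rho] nonnegative. *)
pose del' := Num.min (expR tau * del) (1 / bI hb).
have d'0 : 0 < del' by rewrite lt_min mulr_gt0 ?expR_gt0// divr_gt0.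
have d'1 : del' <= expR tau * del by rewrite ge_min lexx.
have d'2 : del' * bI hb <= 1 by rewrite -ler_pdivlMr// ge_min lexx orbT.
have dI : 0 < del' * bI hb by exact: mulr_gt0.
exists (1 - del' * bI hb); first by apply/andP; split; lra.
move=> F a b bF ab Fab.
have bah c : bmf (fun x => c * hb x) by exact: bmfZ.
have b1 : bmf (fun x => F x - a * hb x) by exact: bmfB.
have b2 : bmf (fun x => b * hb x - F x) by exact: bmfB.
have e c x : `|x| < 1 -> expR tau * T tau (fun y => c * hb y) x = c * hb x.
  move=> x1; rewrite (TZ hW)// (T_h hW)// hb_hfun// mulrCA; congr (_ * _).
  by rewrite mulrA exp1 mul1r.
have TB f g x : bmf f -> bmf g -> T tau (fun y => f y - g y) x = T tau f x - T tau g x.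
  move=> bf bg; rewrite -[- T tau g x]mulN1r -(TZ hW)// -(TD hW)//; last exact: bmfZ.
  by apply: T_ext => [|y _]; [exact: ltW|rewrite mulN1r].
have low f x : bmf f -> (forall y, `|y| < 1 -> 0 <= f y) -> `|x| < 1 ->
    del' * bI f * hb x <= expR tau * T tau f x.
  move=> bf f0 x1; have h1 := D f x bf f0 x1.
  have I0 := bI_ge0 f0; have /andP[h0 _] := hb01 x.
  apply: (@le_trans _ _ (expR tau * (del * bI f * hb x))); last by rewrite ler_pM2l ?expR_gt0.
  have := ler_wpM2r (mulr_ge0 I0 h0) d'1.
  by move: (bI f) (hb x) (del') => i h q; lra.
have p1 y : `|y| < 1 -> 0 <= F y - a * hb y by move=> /Fab /andP[h _]; rewrite subr_ge0.
have p2 y : `|y| < 1 -> 0 <= b * hb y - F y by move=> /Fab /andP[_ h]; rewrite subr_ge0.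
have I1 := bI_ge0 p1; have I2 := bI_ge0 p2.
have I12 : bI (fun x => F x - a * hb x) + bI (fun x => b * hb x - F x) = (b - a) * bI hb.
  by rewrite !bIB// !bIZ//; ring.
exists (a + del' * bI (fun x => F x - a * hb x)), (b - del' * bI (fun x => b * hb x - F x)).
have l1 x (x1 : `|x| < 1) : del' * bI (fun y => F y - a * hb y) * hb x <=
    expR tau * T tau F x - a * hb x.
  by rewrite -(e a x x1) -mulrBr -TB//; exact: low.
have l2 x (x1 : `|x| < 1) : del' * bI (fun y => b * hb y - F y) * hb x <=
    b * hb x - expR tau * T tau F x.
  by rewrite -(e b x x1) -mulrBr -TB//; exact: low.
move: I1 I2 I12 l1 l2.
move: (bI (fun x => F x - a * hb x)) (bI (fun x => b * hb x - F x)) => i1 i2 I1 I2 I12 l1 l2.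
have E : del' * i1 + del' * i2 = del' * bI hb * (b - a) by rewrite -mulrDr I12; ring.
have ba : del' * bI hb * (b - a) <= b - a.
  by rewrite ler_piMl// subr_ge0.
split; [lra|lra|move=> x x1].
by have := l1 x x1; have := l2 x x1; rewrite !mulrDl mulNr => h1 h2; apply/andP; split; lra.
Qed.

(** Up to time 1 this is T_v 1 <= 1. Beyond, T_1 1 <= 3 h puts the function under a multiple of h,
    which the remaining time preserves. *)
Lemma expT_le v x : 0 < v -> `|x| < 1 -> expR v * T v (fun=> 1) x <= 3 * expR 1.
Proof.
move=> v0 x1; have [v1|v1] := leP v 1.
  have h1 : T v (fun=> 1) x <= 1.
    apply: (le_trans (ler_norm _)); apply: (T_norm_le hW) => // [|y]; first exact: bmf_cst.
    by rewrite normr1.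
  have h2 : expR v <= expR 1 by rewrite ler_expR.
  have h3 := expR_gt0 v; have h4 := expR_gt0 (1 : R).
  apply: (@le_trans _ _ (expR v * 1)); first by rewrite ler_pM2l.
  by lra.
have e1 := expR_gt0 (1 : R).
have b1 : bmf (fun _ : R => 1 : R) by exact: bmf_cst.
have r0 : 0 < v - 1 by lra.
have := @sandwich_T (fun y => expR 1 * T 1 (fun=> 1) y) 0 (3 * expR 1) _ x r0.
have bT := bmf_T hW ltr01 b1.
move=> /(_ _ _ x1)/wrap[|y y1|].
- exact: bmfZ.
- rewrite mul0r mulr_ge0 ?expR_ge0//=; last by apply: T_ge0 => // z _; exact: ler01.
  rewrite [leRHS]mulrAC [leRHS]mulrC ler_pM2l//.
  by have := T_1_le hW ltr01 y1; rewrite mul1r hb_hfun.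
rewrite (TZ hW)// (T_semigroup hW)// mulrA -expRD subrK => /andP[_ h].
apply: (le_trans h); have /andP[_ h1] := hb01 x.
by rewrite -[leRHS]mulr1 ler_pM2l// mulr_gt0.
Qed.

(** Time 1 places exp 1 T_1 f between 0 and 3 exp 1 h, [n] contractions bring the gap below [e], and
    the remaining time keeps it. The constant [ip f / ip hb] lies in the gap because the pairing
    with h is invariant under exp t T_t, by symmetry and T_t h = exp (- t) h. *)
Lemma T_hfun_cvg e : 0 < e -> exists2 t1, 0 < t1 & forall t f x, t1 <= t -> bmf f ->
  (forall y, `|y| < 1 -> 0 <= f y <= 1) -> `|x| < 1 ->
  `|expR t * T t f x - hb x * (ip f / ip hb)| <= e * hb x.
Proof.
move=> e0; have [rho /andP[rho0 rho1] C] := contraction.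
have tau0 : 0 < tau by rewrite /tau; lra.
have e1 := expR_gt0 (1 : R); have b0 : 0 < 3 * expR 1 :> R by rewrite mulr_gt0.
have ev : \forall n \near \oo, rho ^+ n * (3 * expR 1) < e.
  have := @cvg_expr R rho; rewrite ger0_norm// => /(_ rho1) c.
  have {}c : (fun n => rho ^+ n * (3 * expR 1)) @ \oo --> (0 : R).
    rewrite -[X in _ --> X](mul0r (3 * expR 1)).
    by apply: rcvgM => //; exact: cvg_cst.
  exact: (cvgr_lt _ c).
have [n rn] := filter_ex ev.
(* The last 1 leaves a positive time after the [n] contractions, as [sandwich_T] requires. *)
exists (1 + n%:R * tau + 1) => [|t f x tn bf f01 x1].
  by rewrite -addrA ltr_pwDl// addr_ge0// mulr_ge0// ltW.
have it m : exists a b, [/\ a <= b, b - a <= rho ^+ m * (3 * expR 1) &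
    forall y, `|y| < 1 -> a * hb y <= expR (1 + m%:R * tau) * T (1 + m%:R * tau) f y <= b * hb y].
  elim: m => [|m [a [b [ab IH1 IH2]]]].
    exists 0, (3 * expR 1); rewrite subr0 expr0 mul1r mul0r addr0; split => //.
    move=> y y1; rewrite mul0r mulr_ge0 ?expR_ge0//=; last first.
      by apply: T_ge0 => // z /f01 /andP[].
    rewrite [leRHS]mulrAC [leRHS]mulrC ler_pM2l//.
    have := T_1_le hW ltr01 y1; rewrite mul1r hb_hfun//; apply: le_trans.
    by apply: (T_le hW) => //; [exact: bmf_cst|move=> z /f01 /andP[]].
  have m0 : 0 < 1 + m%:R * tau by rewrite ltr_pwDl// mulr_ge0// ltW.
  have bF : bmf (fun y => expR (1 + m%:R * tau) * T (1 + m%:R * tau) f y).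
    by apply: bmfZ; exact: (bmf_T hW).
  have [a' [b' [H1 H2 H3]]] := C _ a b bF ab IH2.
  exists a', b'; split => //; first by rewrite exprS -mulrA (le_trans H2)// ler_wpM2l.
  move=> y y1; have := H3 y y1; rewrite (TZ hW)//; last exact: (bmf_T hW).
  rewrite (T_semigroup hW)// mulrA -expRD.
  have -> : tau + (1 + m%:R * tau) = 1 + m.+1%:R * tau by rewrite -natr1; ring.
  by [].
have [a [b [ab ban ABn]]] := it n.
pose tn' := 1 + n%:R * tau; have tn0 : 0 < tn' by rewrite ltr_pwDl// mulr_ge0// ltW.
have t0 : 0 < t by apply: lt_le_trans tn; rewrite addr_gt0.
have bF : bmf (fun y => expR tn' * T tn' f y) by apply: bmfZ; exact: (bmf_T hW).
have r0 : 0 < t - tn' by rewrite subr_gt0; apply: lt_le_trans tn; rewrite ltrDl.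
have {ABn} AB y : `|y| < 1 -> a * hb y <= expR t * T t f y <= b * hb y.
  move=> y1; have := sandwich_T r0 bF ABn y1.
  rewrite (TZ hW)//; last exact: (bmf_T hW).
  by rewrite (T_semigroup hW)// mulrA -expRD subrK.
have ipE : ip (fun y => expR t * T t f y) = ip f.
  rewrite /ip.
  transitivity (expR t * \int[lamI]_y (gam y * hb y * T t f y)).
    rewrite -bmf_intZ; last by apply: bmfM; [exact: (bmfM (@bmf_gam R) bmf_hb)|exact: (bmf_T hW)].
    by apply: eq_Rintegral => y _; ring.
  rewrite (T_sym hW t0 bf bmf_hb) -bmf_intZ; last first.
    by apply: bmfM; [exact: (bmfM (@bmf_gam R) bf)|exact: (bmf_T hW)].
  apply: eq_Rintegral => y _.
  have [y1|y1] := ltP `|y| 1.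
    rewrite (T_h hW)// -hb_hfun//.
    transitivity (expR t * expR (- t) * (gam y * hb y * f y)); first by ring.
    by rewrite exp1 mul1r.
  rewrite (T_off hW) ?(ltW t0)// !mulr0.
  by rewrite hb_off// mulr0 mul0r.
have bT := bmf_T hW t0 bf.
have aI : a * ip hb <= ip f.
  by rewrite -ipE -ipZ//; apply: ip_le => [||y /AB /andP[]//]; exact: bmfZ.
have bI' : ip f <= b * ip hb.
  by rewrite -ipE -ipZ//; apply: ip_le => [||y /AB /andP[]//]; exact: bmfZ.
have H0 := ip_hb_gt0.
have aq : a <= ip f / ip hb by rewrite ler_pdivlMr.
have bq : ip f / ip hb <= b by rewrite ler_pdivrMr.
have /andP[l1 l2] := AB x x1; have /andP[h0 _] := hb01 x.
move: (ip f / ip hb) aq bq => q aq bq.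
have ble : b - a <= e by apply: (le_trans ban); exact: ltW.
have p1 := ler_wpM2r h0 aq; have p2 := ler_wpM2r h0 bq.
have p3 := ler_wpM2r h0 ble.
rewrite ler_norml; move: l1 l2 p1 p2 p3 => h1 h2 h3 h4 h5.
by apply/andP; split; lra.
Qed.

End contraction.

(** * Hitting times and occupation times *)

Section hitting_times.
Context {R : realType} (d : measure_display) (Omega : measurableType d)
  (P : probability Omega R) (W : R -> Omega -> R) (hW : is_std_BM P W).
Implicit Types (a s t x v r : R) (w : Omega).

(** The strict inequality is the delicate point: hitting times after [t] could accumulate at [t].
    The second hypothesis excludes it; continuity of the path provides it. *)
Lemma first_hit_gt (z : R -> R) a t : a <= t ->
  (`|z t| != 1 -> exists2 e, 0 < e & forall r, t <= r < t + e -> `|z r| != 1) ->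
  (t%:E < ereal_inf [set r%:E | r in [set r | (a <= r)%R /\ (`|z r| = 1)%R]])%E <->
  (forall r, a <= r <= t -> `|z r| != 1).
Proof.
move=> at_ rc; split => [h r /andP[ar rt]|h].
  apply/negP => /eqP zr; move: h; rewrite ltNge => /negP; apply.
  apply: (@le_trans _ _ r%:E); last by rewrite lee_fin.
  by apply: ereal_inf_lbound; exists r.
have [|e e0 he] := rc; first by apply: h; rewrite at_ lexx.
apply: (@lt_le_trans _ _ (t + e)%:E); first by rewrite lte_fin ltrDl.
apply: le_ereal_inf_tmp => _ [r [ar zr] <-]; rewrite lee_fin leNgt; apply/negP => rt.
have [tr|tr] := leP t r; first by have := he r; rewrite tr rt zr eqxx => /(_ isT).
by have := h r; rewrite ar (ltW tr) zr eqxx => /(_ isT).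
Qed.

Let abs_cont s x w : 0 <= s -> continuous (fun r => `|Zs W s x `|r| w| : R).
Proof. by move=> s0 r; apply: cvg_norm; exact: (@continuous_Zs _ _ _ _ _ hW s x w s0). Qed.

Let Zs_rc s x v w : 0 <= s -> 0 <= v -> `|Zs W s x v w| != 1 ->
  exists2 e, 0 < e & forall r, v <= r < v + e -> `|Zs W s x r w| != 1.
Proof.
move=> s0 v0 v1.
have : \forall r \near v, `|Zs W s x `|r| w| != 1.
  have c := @abs_cont s x w s0 v.
  move: v1; rewrite neq_lt => /orP[h|h].
    have : \forall r \near v, `|Zs W s x `|r| w| < 1.
      by apply: (cvgr_lt _ c); rewrite /= (ger0_norm v0).
    by apply: filterS => r hr; rewrite lt_eqF.
  have : \forall r \near v, 1 < `|Zs W s x `|r| w|.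
    by apply: (cvgr_gt _ c); rewrite /= (ger0_norm v0).
  by apply: filterS => r hr; rewrite gt_eqF.
move=> /nbhs_ballP[e /= e0 he]; exists e => // r /andP[vr re].
have r0 := le_trans v0 vr.
have := he r; rewrite (ger0_norm r0); apply.
by rewrite /ball /= ltr_distlC; apply/andP; split; lra.
Qed.

(** Intermediate value theorem: a path started in (-1, 1) leaves it only through |Z| = 1. *)
Let survo_hit s x v w : 0 <= s -> 0 <= v -> `|x| < 1 ->
  survo W s x v w <-> (forall r, 0 <= r <= v -> `|Zs W s x r w| != 1).
Proof.
move=> s0 v0 x1; split => [h r rv|h r /andP[r0 rv]]; first by rewrite lt_eqF// h.
rewrite ltNge; apply/negP => zr.
have cz : {within `[0, r]%classic, continuous (fun r => `|Zs W s x `|r| w|)}.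
  by apply: continuous_subspaceT => y; exact: abs_cont.
have [] := @IVT R _ 0 r 1 r0 cz.
  rewrite normr0 (Zs0 hW)// (ger0_norm r0) ge_min le_max.
  by rewrite (ltW x1) zr /= orbT.
move=> y; rewrite in_itv /= => /andP[y0 yr]; rewrite (ger0_norm y0) => /eqP.
by apply/negP; apply: h; rewrite y0 (le_trans yr).
Qed.

Lemma OUproc_Zs x v w : OUproc W x v w = Zs W 0 x v w.
Proof.
rewrite /OUproc ZsE// add0r sqrtr1 mul1r mulr1 mul1r mulrC; congr (_ * _).
by rewrite mulNr expRN.
Qed.

Lemma tauZ_survo x v w : 0 <= v -> `|x| < 1 ->
  (v%:E < tauZ W x w)%E <-> survo W 0 x v w.
Proof.
move=> v0 x1; rewrite survo_hit//.
have -> : tauZ W x w = ereal_inf [set r%:E | r in [set r | (0 <= r)%R /\ (`|Zs W 0 x r w| = 1)%R]].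
  rewrite /tauZ; congr ereal_inf; congr image.
  by apply/seteqP; split => r /=; rewrite OUproc_Zs.
by apply: first_hit_gt => // v1; apply: Zs_rc.
Qed.

Definition logtime s t : R := ln ((t + 1) / (s + 1)).

Lemma logtime_ge0 s t : 0 <= s -> s <= t -> 0 <= logtime s t.
Proof.
move=> s0 st; rewrite /logtime ln_ge0// ler_pdivlMr ?ltr_wpDl//.
by rewrite mul1r lerD2r.
Qed.

Lemma logtime_gt0 s t : 0 <= s -> s < t -> 0 < logtime s t.
Proof. by move=> s0 st; rewrite /logtime ln_gt0// ltr_pdivlMr; lra. Qed.

Lemma Xproc_Zs s x t w : 0 <= s -> s <= t -> Xproc W x s t w = Zs W s x (logtime s t) w.
Proof.
move=> s0 st; rewrite /Zs /logtime lnK; last first.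
  by rewrite posrE divr_gt0// ltr_wpDl// (le_trans s0).
by congr (Xproc W x s _ w); rewrite mulrC divfK ?addrK// gt_eqF// ltr_wpDl.
Qed.

Lemma logtime_le s t t' : 0 <= s -> s <= t -> t <= t' -> logtime s t <= logtime s t'.
Proof.
move=> s0 st tt; have s1 : 0 < s + 1 by rewrite ltr_wpDl.
rewrite ler_ln ?posrE ?divr_gt0//; [|lra|lra].
by rewrite ler_pM2r ?invr_gt0// lerD2r.
Qed.

Lemma logtimeD s u t : 0 <= s -> s <= u -> u <= t -> logtime s u + logtime u t = logtime s t.
Proof.
move=> s0 su ut; rewrite /logtime -lnM ?posrE ?divr_gt0//; try lra.
by congr ln; field; rewrite !gt_eqF//; lra.
Qed.

Lemma tauX_survo s x t w : 0 <= s -> s <= t -> `|x| < 1 ->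
  (t%:E < tauX W x s w)%E <-> survo W s x (logtime s t) w.
Proof.
move=> s0 st x1; have s1 : 0 < s + 1 by rewrite ltr_wpDl.
rewrite survo_hit//; last exact: logtime_ge0.
rewrite /tauX first_hit_gt//; last first.
  rewrite Xproc_Zs// => /(Zs_rc s0 (logtime_ge0 s0 st))[e e0 he].
  exists e => // r /andP[tr re]; have sr := le_trans st tr.
  rewrite Xproc_Zs//; apply: he; rewrite logtime_le//=.
  rewrite -(logtimeD s0 st tr) ltrD2l /logtime.
  have t1 : 0 < t + 1 by lra.
  (* Since ln (1 + y) <= y and t + 1 >= 1, the [e] found in logarithmic time also serves in the
     original time. *)
  have -> : (r + 1) / (t + 1) = 1 + (r - t) / (t + 1) by field; rewrite gt_eqF.
  apply: (@le_lt_trans _ _ ((r - t) / (t + 1))).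
    by apply: le_ln1Dx; apply: (@lt_le_trans _ _ 0) => //; rewrite divr_ge0//; lra.
  rewrite ltr_pdivrMr//; nra.
split => h r /andP[r0 rt].
  rewrite /Zs; apply: h; apply/andP; split.
    by rewrite lerBrDr ler_pMr// -[leLHS]expR0 ler_expR.
  rewrite lerBlDr -ler_pdivlMl// mulrC.
  by rewrite -[leRHS]lnK ?posrE ?divr_gt0// ?ler_expR//; lra.
rewrite Xproc_Zs//; apply: h; rewrite logtime_ge0//=.
exact: logtime_le.
Qed.

End hitting_times.

(** * Occupation identity for the truncated hitting time *)

Section occupation_identity.
Context {R : realType} (d : measure_display) (Omega : measurableType d)
  (P : probability Omega R) (W : R -> Omega -> R) (hW : is_std_BM P W).
Implicit Types (a b s t v r : R) (w : Omega).

Local Notation RT := (measurableTypeR R).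
Local Notation T := (killT P W).
Local Notation leb := (@lebesgue_measure R).

Let measurable_Zs2 v : 0 <= v ->
  measurable_fun setT (fun z : RT * Omega => Zs W 0 z.1 v z.2 : R).
Proof.
move=> v0; rewrite (_ : (fun z => _) = fun z : RT * Omega => (z.1 * Num.sqrt (0 + 1) +
    W ((0 + 1) * (expR v - 1)) z.2) * (Num.sqrt (0 + 1) * expR (v / 2))^-1); last first.
  by apply/funext => z; rewrite ZsE.
apply: measurable_funM => //; apply: measurable_funD.
  by apply: measurable_funM => //; exact: measurable_fst.
apply: measurableT_comp; last exact: measurable_snd.
apply: (BM_measurable hW); rewrite add0r mul1r subr_ge0.
by rewrite -[leLHS]expR0 ler_expR.
Qed.

Let surv_set v : set (RT * Omega) := [set z | `|z.1| < 1 /\ survo W 0 z.1 v z.2].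

(** Tonelli's theorem over starting points and paths needs joint measurability. Survival is
    therefore written with countably many conditions: some level [ck k] is respected at all times of
    all grids. *)
Let measurable_surv_set v : 0 < v -> measurable (surv_set v).
Proof.
move=> v0; have -> : surv_set v = \bigcup_k \bigcap_n
    ([set z : RT * Omega | `|z.1| <= ck k] `&`
     \bigcap_(j in `I_n.+1) [set z | `|Zs W 0 z.1 (v / n.+1%:R * j.+1%:R) z.2| <= ck k]).
  apply/seteqP; split => [z [x1 h]|z [k _ h]].
    have /cvgr_gt c := @surv_survo _ _ _ _ _ hW 0 z.1 v z.2 (lexx 0) (ltW v0).
    have half : (1 / 2 < \1_(survo W 0 z.1 v) z.2 :> R).
      by rewrite indicE mem_set//= mulr1n; lra.
    have [k [xk hk]] := filter_ex (filterI (ck_near x1) (c _ half)).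
    exists k => // n _; split => // j jn.
    have /set_mem sk : z.2 \in surv W 0 z.1 (ck k) 0 v.
      by move: hk; rewrite indicE; case: (_ \in _) => //=; rewrite mulr0n; lra.
    apply: sk; rewrite mulr_ge0 ?divr_ge0//= ?(ltW v0)// mulrAC ler_pdivrMr ?ltr0n//.
    by rewrite ler_pM2l// ler_nat.
  have xk : `|z.1| <= ck k by have [] := h 0%N Logic.I.
  split; first exact: le_lt_trans (ck_lt1 k).
  have c := @grid_surv _ _ _ _ _ hW 0 z.1 (ck k) v z.2 (lexx 0) v0 xk.
  have c1 : (\1_(grid W 0 z.1 (ck k) v n) z.2 : R) @[n --> \oo] --> (1 : R).
    apply: (rcvg_eq _ (cvg_cst _)) => n /=; rewrite indicE mem_set// => j jn.
    by have [_] := h n Logic.I; apply.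
  have /set_mem sk : z.2 \in surv W 0 z.1 (ck k) 0 v.
    have := rcvg_unique c c1 (fun=> erefl).
    by rewrite indicE; case: (_ \in _) => //= /eqP; rewrite eq_sym oner_eq0.
  by move=> r rv; rewrite (le_lt_trans (sk r rv))// ck_lt1.
apply: bigcup_measurable => k _; apply: bigcap_measurable; first by exists 0%N.
move=> n _; apply: measurableI.
  rewrite (_ : [set z | _] = (fun z : RT * Omega => z.1 : R) @^-1` seg (ck k)).
    by apply: measurable_preimT; [exact: measurable_fst|exact: measurable_seg].
  by apply/seteqP; split => z /segP.
apply: bigcap_measurable; first by exists 0%N.
move=> j _.
rewrite (_ : [set z | _] = (fun z : RT * Omega =>
    Zs W 0 z.1 (v / n.+1%:R * j.+1%:R) z.2 : R) @^-1` seg (ck k)).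
  apply: measurable_preimT; last exact: measurable_seg.
  by apply: measurable_Zs2; rewrite mulr_ge0// divr_ge0// ltW.
by apply/seteqP; split => z /segP.
Qed.

Let tauZ_ge0 x w : (0 <= tauZ W x w)%E.
Proof. by apply: le_ereal_inf_tmp => _ [r [r0 _] <-]; rewrite lee_fin. Qed.

(* The hitting time, put to 0 outside (-1, 1) to make it jointly measurable. *)
Definition tauI (z : RT * Omega) : \bar R :=
  if `|z.1| < 1 then tauZ W z.1 z.2 else 0%E.

Lemma tauI_ge0 z : (0 <= tauI z)%E.
Proof. by rewrite /tauI; case: ifP. Qed.

Lemma measurable_tauI : measurable_fun setT tauI.
Proof.
apply: (measurability _ (ErealGenOInfty.measurableE R)) => // _ [_ [v ->] <-].
rewrite setTI (_ : _ @^-1` _ = [set z | v%:E < tauI z]%E); last first.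
  by apply/seteqP; split => z /=; rewrite in_itv/= andbT.
have [v0|v0|v0] := ltrgt0P v.
- rewrite (_ : [set _ | _] = surv_set v); first exact: measurable_surv_set.
  apply/seteqP; split => z /=; rewrite /tauI /surv_set /=.
    by case: ifPn => x1; [move=> /(tauZ_survo hW _ (ltW v0) x1)|rewrite lte_fin ltNge (ltW v0)].
  by move=> [x1 h]; rewrite x1; apply/(tauZ_survo hW _ (ltW v0) x1).
- rewrite (_ : [set _ | _] = setT); first exact: measurableT.
  by apply/seteqP; split => z //= _; apply: lt_le_trans (tauI_ge0 z); rewrite lte_fin.
- rewrite v0 (_ : [set _ | _] = (fun z : RT * Omega => z.1 : R) @^-1` Iopen11).
    by apply: measurable_preimT; [exact: measurable_fst|exact: measurable_I].
  apply/seteqP; split => z /=; rewrite /tauI.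
    by case: ifPn => [x1 _|_]; [apply/IP|rewrite ltxx].
  move=> /IP x1; rewrite x1; apply/(tauZ_survo hW _ (lexx 0) x1) => r /andP[r0 r00].
  by rewrite (_ : r = 0) ?(Zs0 hW)//; apply/le_anti/andP.
Qed.

Definition tauI_min b z : R := fine (mine b%:E (tauI z)).

Lemma tauI_minE b z : 0 <= b -> (tauI_min b z)%:E = mine b%:E (tauI z).
Proof.
move=> b0; rewrite /tauI_min fineK// ge0_fin_numE ?le_min ?lee_fin ?b0 ?tauI_ge0//.
by rewrite gt_min ltry.
Qed.

Lemma tauI_min_itv b z : 0 <= b -> 0 <= tauI_min b z <= b.
Proof.
move=> b0; rewrite -!lee_fin tauI_minE// le_min ge_min lexx /= andbT.
by rewrite lee_fin b0 tauI_ge0.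
Qed.

Lemma bmf_tauI_min b : 0 <= b -> bmf (tauI_min b).
Proof.
move=> b0; apply: (@bmf_itv _ _ _ _ 0 b); last by move=> z; exact: tauI_min_itv.
apply: (measurableT_comp (fine_measurable measurableT)).
by apply: measurable_mine => //; exact: measurable_tauI.
Qed.

Variables (S : set R) (mS : measurable S).

(** The unnormalized density of alpha_OU, restricted to [S]. *)
Definition wgt x : R := gam x * hb x * \1_S x.

Lemma bmf_wgt : bmf wgt.
Proof.
by apply: bmfM; [exact: (bmfM (@bmf_gam R) (@bmf_hb R))|exact: bmf_indic].
Qed.

Lemma wgt_ge0 x : 0 <= wgt x.
Proof.
have /andP[h0 _] := hb01 x.
by rewrite /wgt mulr_ge0// mulr_ge0// expR_ge0.
Qed.

Definition occ b : R := \int[lamI]_x (wgt x * \int[P]_w tauI_min b (x, w)).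

Let int_inv a t : 0 <= a -> a <= t ->
  \int[leb]_(u in `]a, t[) (u + 1)^-1 = ln (t + 1) - ln (a + 1).
Proof.
move=> a0; rewrite le_eqVlt => /predU1P[->|at_].
  by rewrite set_itvoo0// Rintegral_set0 subrr.
have cf : {within `[a, t], continuous (fun u : R => (u + 1)^-1)}.
  apply: continuous_in_subspaceT => u; rewrite inE /= in_itv /= => /andP[au _].
  apply: (@cvgV _ R); first by rewrite gt_eqF//; lra.
  by apply: rcvgD; [exact: cvg_id|exact: cvg_cst].
have icc : leb.-integrable `[a, t] (EFin \o (fun u : R => (u + 1)^-1)).
  by apply: continuous_compact_integrable => //; exact: segment_compact.
have dln u : a <= u -> is_derive u 1 (fun u : R => ln (u + 1)) (u + 1)^-1.
  move=> au; have u1 : 0 < u + 1 by lra.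
  have dl := is_derive1_ln u1.
  have := @is_derive1_comp R (@ln R) (fun u : R => u + 1) u _ _ dl.
  move=> /(_ 1); rewrite mulr1; apply.
  by rewrite -[X in is_derive _ _ _ X]addr0; apply: is_deriveD.
have cln u : a <= u -> {for u, continuous (fun u : R => ln (u + 1))}.
  move=> /dln h; apply: differentiable_continuous; apply/derivable1_diffP.
  by have [] := h.
have sub (A : set R) : measurable A -> A `<=` `[a, t] ->
    leb.-integrable A (EFin \o (fun u : R => (u + 1)^-1)).
  by move=> mA sA; apply: integrableS icc => //; exact: measurable_itv.
rewrite Rintegral_itv_obnd_cbnd; last first.
  by apply: sub => // u /=; rewrite !in_itv/= => /andP[/ltW -> /ltW ->].
rewrite Rintegral_itv_bndo_bndc; last first.
  by apply: sub => // u /=; rewrite !in_itv/= => /andP[-> /ltW ->].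
rewrite /Rintegral (@continuous_FTC2 R _ (fun u : R => ln (u + 1)) _ _ at_ cf)//.
- split.
  + move=> u; rewrite in_itv /= => /andP[au _].
    by have [] := dln u (ltW au).
  + by apply: cvg_at_right_filter; exact: cln.
  + by apply: cvg_at_left_filter; apply: cln; exact: ltW.
- move=> u; rewrite in_itv /= => /andP[au _]; rewrite derive1E.
  by have [_ ->] := dln u (ltW au).
Qed.

(** A bounded measurable function on the whole line that equals 1 / (u + 1) for u >= 0. *)
Let rc (u : R) : R := expR (- ln (`|u| + 1)).

Let rcE u : 0 <= u -> rc u = (u + 1)^-1.
Proof.
by move=> u0; rewrite /rc expRN ger0_norm// lnK// posrE; lra.
Qed.

Let bmf_rc : bmf rc.
Proof.
apply: (@bmf_itv _ _ _ _ 0 1).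
  apply: measurableT_comp => //; apply: measurableT_comp => //.
  apply: (measurableT_comp (@measurable_ln R)); apply: measurable_funD => //.
move=> u; rewrite expR_ge0/= -[leRHS]expR0 ler_expR oppr_le0 ln_ge0//.
by have := normr_ge0 u; lra.
Qed.

Let occB s t : set ((RT * RT) * Omega) :=
  [set z | [&& s < z.1.1, z.1.1 < t &
     ln (t + 1) - ln (z.1.1 + 1) < tauI_min (logtime s t) (z.1.2, z.2)]].

Let measurable_occB s t : 0 <= s -> s <= t -> measurable (occB s t).
Proof.
move=> s0 st; have w0 := logtime_ge0 s0 st.
have mu1 : measurable_fun setT (fun z : (RT * RT) * Omega => z.1.1 : R).
  exact: (measurableT_comp measurable_fst measurable_fst).
rewrite (_ : occB s t = ((fun z => z.1.1 : R) @^-1` `]s, t[) `&`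
  (fun z => ln (t + 1) - ln (z.1.1 + 1) < tauI_min (logtime s t) (z.1.2, z.2)) @^-1` [set true]).
  apply: measurableI; first by apply: (measurable_preimT mu1); exact: measurable_itv.
  rewrite -[X in measurable X]setTI; apply: measurable_fun_ltr => //.
    apply: measurable_funB => //; apply: (measurableT_comp (@measurable_ln R)).
    exact: measurable_funD.
  apply: (bmf_comp (g := fun z : (RT * RT) * Omega => (z.1.2, z.2)) (bmf_tauI_min w0) _).1.
  apply: measurable_fun_pair; last exact: measurable_snd.
  exact: (measurableT_comp measurable_snd measurable_fst).
apply/seteqP; split => z; rewrite /occB /= in_itv /=.
  by move=> /and3P[-> -> ->].
by move=> [/andP[-> ->] ->].
Qed.

(** T_v 1 (x) is the probability that tau_Z > v, so [Psi u] is an integral, over starting points and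
    paths, of the indicator of tau_Z > ln ((t + 1) / (u + 1)). For a fixed path this condition
    selects an interval of u ending at t, whose mass for du / (u + 1) is the minimum of tau_Z and
    [logtime s t]. [Psi] is existential: the double integral is measurable in [u] on the whole line
    and vanishes off (s, t), and its expression by [T] is asserted inside only. *)
Lemma occupation s t : 0 <= s -> s < t -> exists Psi : R -> R,
  [/\ bmf Psi, (forall u, 0 <= Psi u), (forall u, u <= s \/ t <= u -> Psi u = 0),
   (forall u, s < u -> u < t ->
      Psi u = (u + 1)^-1 * ip (fun x => \1_S x * T (logtime u t) (fun=> 1) x)) &
   \int[leb]_(u in `[s, t]) Psi u = occ (logtime s t)].
Proof.
move=> s0 st; have w0 := logtime_ge0 s0 (ltW st).
have mB := measurable_occB s0 (ltW st).
pose phi (z : (RT * RT) * Omega) : R := rc z.1.1 * wgt z.1.2 * \1_(occB s t) z.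
have bphi : bmf phi.
  apply: bmfM; last exact: bmf_indic.
  by apply: bmfM; [apply: (bmf_comp bmf_rc)|apply: (bmf_comp bmf_wgt)];
    [exact: (measurableT_comp measurable_fst measurable_fst)|
     exact: (measurableT_comp measurable_snd measurable_fst)].
have b2 : bmf (fun z : RT * RT => \int[P]_w phi (z, w)) by exact: (bmf_int2 P bphi).
exists (fun u => \int[lamI]_x \int[P]_w phi ((u, x), w)).
have b1 : bmf (fun u : RT => \int[lamI]_x \int[P]_w phi ((u, x), w)).
  exact: (bmf_int2 lamI b2).
have rc0 u : 0 <= rc u by exact: expR_ge0.
split => //.
- move=> u; apply: int_ge0 => x; apply: int_ge0 => w.
  apply: mulr_ge0; first by apply: mulr_ge0; [exact: rc0|exact: wgt_ge0].
  by rewrite indicE.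
- move=> u usr; rewrite -[RHS](mul0r (fine (lamI setT))) -bmf_int_cst; apply: eq_Rintegral => x _.
  rewrite -[RHS](prob_int_cst P); apply: eq_Rintegral => w _.
  rewrite /phi indicE memNset ?mulr0// /occB /= => /and3P[su ut _].
  by case: usr; lra.
- move=> u su ut; have u0 : 0 <= u by lra.
  have v0 : 0 < logtime u t by rewrite /logtime ln_gt0// ltr_pdivlMr; lra.
  have vw : logtime u t < logtime s t.
    rewrite -(logtimeD s0 (ltW su) (ltW ut)) ltrDr /logtime ln_gt0// ltr_pdivlMr; lra.
  have bT1 : bmf (fun x => \1_S x * T (logtime u t) (fun=> 1) x).
    by apply: bmfM; [exact: bmf_indic|apply: (bmf_T hW) => //; exact: bmf_cst].
  rewrite /ip -bmf_intZ; last by apply: bmfM => //; exact: (bmfM (@bmf_gam R) (@bmf_hb R)).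
  apply: eq_Rintegral => x _.
  have vE : logtime u t = ln (t + 1) - ln (u + 1) by rewrite /logtime ln_div ?posrE//; lra.
  have [x1|x1] := ltP `|x| 1; last first.
    rewrite hb_off// mulr0 !mul0r mulr0 -[RHS](prob_int_cst P); apply: eq_Rintegral => w _.
    by rewrite /phi /wgt /= hb_off// !(mulr0, mul0r).
  rewrite -(rcE u0) /killT.
  have bs : bmf (fun w => \1_(survo W 0 x (logtime u t)) w * (1 : R)).
    by apply: bmfM; [exact: (bmf_survo hW)|exact: bmf_cst].
  transitivity (rc u * wgt x * \int[P]_w (\1_(survo W 0 x (logtime u t)) w * 1)); last first.
    by rewrite /wgt; ring.
  rewrite -bmf_intZ//; apply: eq_Rintegral => w _.
  rewrite /phi /=; congr (_ * _); rewrite mulr1 !indicE; congr (nat_of_bool _)%:R.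
  have e : occB s t ((u, x), w) <-> survo W 0 x (logtime u t) w.
    rewrite -(tauZ_survo hW _ (ltW v0) x1) /occB /= su ut /= -vE.
    rewrite -lte_fin tauI_minE// lt_min lte_fin vw /= /tauI x1.
    by split.
  by apply/idP/idP => /set_mem/e h; apply/mem_set.
- have [wst0 st'] : 0 <= s /\ s <= t by split => //; exact: ltW.
  have mst : measurable (`[s, t]%classic : set RT) by exact: measurable_itv.
  have foo : (leb (`[s, t]%classic : set RT) < +oo)%E.
    by rewrite /= lebesgue_measure_itv/=; case: ifPn => _; rewrite ltry.
  rewrite -(@integral_mfrestr R _ RT leb `[s, t]%classic mst foo); last exact: b1.
  have := bmf_Fubini (mfrestr mst foo) lamI b2; rewrite /= => ->.
  rewrite /occ; apply: eq_Rintegral => x _.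
  have bx : bmf (fun z : RT * Omega => phi ((z.1, x), z.2)).
    apply: (bmf_comp (g := fun z : RT * Omega => ((z.1, x), z.2)) bphi).
    apply: measurable_fun_pair; last exact: measurable_snd.
    by apply: measurable_fun_pair; [exact: measurable_fst|exact: measurable_cst].
  have := bmf_Fubini (mfrestr mst foo) P bx; rewrite /= => ->.
  rewrite -bmf_intZ; last exact: (bmf_pair1 (bmf_tauI_min w0) x).
  apply: eq_Rintegral => w _.
  have /andP[y0 yw] := tauI_min_itv (x, w) w0; set y := tauI_min _ _ in y0 yw *.
  rewrite integral_mfrestr; last exact: (bmf_pair2 bx w).
  have t1 : 0 < t + 1 by lra.
  (* The time from which the logarithmic time up to [t] equals [y]; it is at least [s] because
     [y <= logtime s t]. *)
  pose a := (t + 1) * expR (- y) - 1.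
  have ea := expR_gt0 (- y).
  have la : ln (a + 1) = ln (t + 1) - y by rewrite /a subrK lnM ?posrE// expRK.
  have at_ : a <= t.
    rewrite /a lerBlDr ger_pMr// -[leRHS]expR0 ler_expR; lra.
  have sa : s <= a.
    have s1 : 0 < s + 1 by lra.
    rewrite /a lerBrDr -[leLHS](lnK (_ : _ \in Num.pos)) ?posrE//.
    rewrite -[X in X * _](lnK (_ : _ \in Num.pos)) ?posrE// -expRD ler_expR.
    by move: yw; rewrite /logtime ln_div ?posrE//; lra.
  have a0 : 0 <= a by exact: le_trans sa.
  transitivity (wgt x * \int[leb]_(u in `]a, t[) (u + 1)^-1); last first.
    by rewrite int_inv// la; congr (_ * _); ring.
  have mat : measurable (`]a, t[%classic : set RT) by exact: measurable_itv.
  have aoo : (leb (`]a, t[%classic : set RT) < +oo)%E.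
    by rewrite /= lebesgue_measure_itv/=; case: ifPn => _; rewrite ltry.
  have -> : wgt x * \int[leb]_(u in `]a, t[) (u + 1)^-1 =
      \int[leb]_(u in `]a, t[) (wgt x * rc u).
    rewrite -[RHS](@integral_mfrestr R _ RT leb _ mat aoo); last exact: bmfZ.
    rewrite bmf_intZ//; congr (_ * _); rewrite (@integral_mfrestr R _ RT leb _ mat aoo)//.
    apply: eq_Rintegral => u; rewrite inE /= in_itv /= => /andP[au _].
    by rewrite rcE//; lra.
  rewrite (@Rintegral_mkcond _ RT R leb `[s, t]%classic) (@Rintegral_mkcond _ RT R leb `]a, t[%classic).
  apply: eq_Rintegral => u _; rewrite !patchE.
  have e : s <= u <= t -> (occB s t ((u, x), w)) <-> a < u < t.
    move=> /andP[su ut]; rewrite /occB /= -/y.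
    have u1 : 0 < u + 1 by lra.
    have lu : (ln (t + 1) - ln (u + 1) < y) = (a < u).
      rewrite ltrBlDr -ltrBlDl -la ltr_ln ?posrE//; last lra.
      by rewrite ltrD2r.
    rewrite lu; split; first by move=> /and3P[_ -> ->].
    by move=> /andP[au ->]; rewrite au (le_lt_trans sa au).
  case: ifPn => [/set_mem|ust].
    rewrite /= in_itv /= => sut; case: ifPn => [/set_mem|uat].
      rewrite /= in_itv /= => uat; rewrite /phi /= indicE mem_set ?mulr1 1?mulrC//.
      exact/e.
    rewrite /phi /= indicE memNset ?mulr0// => /(e sut) h.
    by move: uat; rewrite mem_set// /= in_itv /=.
  case: ifPn => // /set_mem; rewrite /= in_itv /= => /andP[au ut].
  by move: ust; rewrite mem_set// /= in_itv /= (ltW ut) (ltW (le_lt_trans sa au)).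
Qed.

Lemma occ_le b b' : 0 <= b -> b <= b' -> occ b <= occ b'.
Proof.
move=> b0 bb; have b'0 := le_trans b0 bb.
have bi c : 0 <= c -> bmf (fun x => wgt x * \int[P]_w tauI_min c (x, w)).
  by move=> c0; apply: (bmfM bmf_wgt); exact: (bmf_int2 P (bmf_tauI_min c0)).
rewrite /occ; apply: bmf_le => [||x]; [exact: bi|exact: bi|].
apply: ler_wpM2l; first exact: wgt_ge0.
apply: bmf_le => [||w].
- exact: (bmf_pair1 (bmf_tauI_min b0) x).
- exact: (bmf_pair1 (bmf_tauI_min b'0) x).
by rewrite -lee_fin !tauI_minE// le_min2// lee_fin.
Qed.

Let cvg_mine (y : \bar R) : (0 <= y)%E -> (fun n => mine n%:R%:E y) @ \oo --> y.
Proof.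
case: y => [r _|_|//].
  apply: cvg_near_cst; apply: filterS (nbhs_infty_ger r) => n rn.
  by rewrite min_r// lee_fin.
rewrite (_ : (fun n => _) = EFin \o (fun n => n%:R)); last first.
  by apply/funext => n; rewrite min_l// leey.
by apply/cvgeryP; exact: cvgr_idn.
Qed.

(** Monotone convergence over the paths, then over the starting points. The limit is in the extended
    reals: its finiteness is obtained later, from [occ_bound]. *)
Lemma occ_cvg : (fun n => (occ n%:R)%:E) @ \oo -->
  (\int[lamI]_x ((wgt x)%:E * EtauZ P W x))%E.
Proof.
have n0 n : 0 <= n%:R :> R by [].
have mtI x : measurable_fun setT (fun w => tauI (x, w)).
  by apply: (measurableT_comp measurable_tauI); exact: measurable_pair1.
have inner x : (fun n => (\int[P]_w tauI_min n%:R (x, w))%:E) @ \oo -->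
    (\int[P]_w tauI (x, w))%E.
  have := @cvg_monotone_convergence _ _ _ P setT measurableT
    (fun n w => (tauI_min n%:R (x, w))%:E).
  move=> /(_ _ _ _)/wrap[n|n w _|w _ n m nm|].
  - apply/measurable_EFinP; exact: (bmf_pair1 (bmf_tauI_min (n0 n)) x).1.
  - by rewrite tauI_minE// le_min lee_fin n0 tauI_ge0.
  - by rewrite !tauI_minE// le_min2// lee_fin ler_nat.
  rewrite (_ : (fun n => _) = fun n => (\int[P]_w tauI_min n%:R (x, w))%:E); last first.
    apply/funext => n; rewrite EFin_bmf//.
    exact: (bmf_pair1 (bmf_tauI_min (n0 n)) x).
  congr (_ --> _); apply: eq_integral => w _.
  rewrite (_ : (fun n => _) = fun n => mine n%:R%:E (tauI (x, w))); last first.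
    by apply/funext => n; rewrite tauI_minE.
  by apply/cvg_lim => //; apply: cvg_mine; exact: tauI_ge0.
have bi n : bmf (fun x => wgt x * \int[P]_w tauI_min n%:R (x, w)).
  by apply: (bmfM bmf_wgt); exact: (bmf_int2 P (bmf_tauI_min (n0 n))).
have := @cvg_monotone_convergence _ _ _ lamI setT measurableT
  (fun n x => (wgt x * \int[P]_w tauI_min n%:R (x, w))%:E).
move=> /(_ _ _ _)/wrap[n|n x _|x _ n m nm|].
- by apply/measurable_EFinP; exact: (bi n).1.
- rewrite lee_fin mulr_ge0 ?wgt_ge0//; apply: int_ge0 => w.
  by have /andP[] := tauI_min_itv (x, w) (n0 n).
- rewrite lee_fin; apply: ler_wpM2l; first exact: wgt_ge0.
  apply: bmf_le => [||w].
  + exact: (bmf_pair1 (bmf_tauI_min (n0 n)) x).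
  + exact: (bmf_pair1 (bmf_tauI_min (n0 m)) x).
  + by rewrite -lee_fin !tauI_minE// le_min2// lee_fin ler_nat.
rewrite (_ : (fun n => _) = fun n => (occ n%:R)%:E); last first.
  by apply/funext => n; apply: EFin_bmf; exact: bi.
congr (_ --> _); apply: eq_integral => x _.
transitivity ((wgt x)%:E * \int[P]_w tauI (x, w))%E.
  apply/cvg_lim => //; have wf : (wgt x)%:E \is a fin_num by [].
  rewrite (_ : (fun n => _) = fun n => ((wgt x)%:E * (\int[P]_w tauI_min n%:R (x, w))%:E)%E)//.
  exact: (cvgeZl wf (inner x)).
have [x1|x1] := ltP `|x| 1; last by rewrite /wgt hb_off// mulr0 mul0r !mul0e.
by congr (_ * _)%E; apply: eq_integral => w _; rewrite /tauI /= x1.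
Qed.

End occupation_identity.

(** * Conditional probabilities and their time averages *)

Section monotonicity.
Local Open Scope ereal_scope.
Import HBNNSimple.

(* Monotonicity of the integral of nonnegative functions without measurability:
   the conditional probabilities are not assumed to be measurable. *)
Lemma le_integral_ge0 d (T : measurableType d) (R : realType)
  (m : {measure set T -> \bar R}) (D : set T) (f g : T -> \bar R) :
  (forall x, D x -> 0 <= f x) -> (forall x, D x -> f x <= g x) ->
  \int[m]_(x in D) f x <= \int[m]_(x in D) g x.
Proof.
move=> f0 fg; rewrite !ge0_integralE//; last first.
  by move=> x Dx; rewrite (le_trans (f0 x Dx))// fg.
apply: ereal_sup_le => _ [h hf <-]; exists h => // x; apply: le_trans (hf x) _.
by rewrite !patchE; case: ifPn => // /set_mem; exact: fg.
Qed.

End monotonicity.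

Section conditional_probabilities.
Context {R : realType} (d : measure_display) (Omega : measurableType d)
  (P : probability Omega R) (W : R -> Omega -> R) (hW : is_std_BM P W).
Variables (mu : probability R R) (hmu : mu Iopen11 = 1%E).
Variables (s : R) (s0 : 0 <= s) (S : set R) (mS : measurable S).
Implicit Types (t u v x e : R).

Local Notation T := (killT P W).
Local Notation lt := (logtime s).

Let mu_ae (f g : R -> \bar R) : (forall x, `|x| < 1 -> f x = g x) ->
  ae_eq mu setT f g.
Proof.
move=> fg; exists (~` Iopen11); split.
- by apply: measurableC; exact: measurable_I.
- by have := @probability_setC _ _ _ mu _ (@measurable_I R); rewrite hmu subee.
- move=> x /= h xI; apply: h => _; apply: fg; exact/IP.
Qed.

Let Iset_meas (f : R -> \bar R) (c : \bar R) : measurable_fun setT f ->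
  measurable_fun setT (fun x => if `|x| < 1 then f x else c).
Proof.
move=> mf; apply: measurable_fun_ifT => //; apply: measurable_fun_ltr => //.
Qed.

(** The probabilities are controlled for |x| < 1 only, that is [mu]-almost everywhere. Elsewhere the
    majorant is set to +oo (the minorant of [Pmu_ge] to 0), so that the comparison holds at every
    point. *)
Let Pmu_le (A : R -> set Omega) (g : R -> R) : bmf g -> (forall x, 0 <= g x) ->
  (forall x, `|x| < 1 -> (P (A x) <= (g x)%:E)%E) ->
  (Pmu P mu A <= (\int[mu]_x g x)%:E)%E.
Proof.
move=> bg g0 Ag; rewrite -EFin_bmf//.
have mg : measurable_fun setT (fun x => (g x)%:E) by apply/measurable_EFinP; exact: bg.1.
rewrite -(@ge0_ae_eq_integral _ _ _ mu setT (fun x => if `|x| < 1 then (g x)%:E else +oo%E))//.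
- apply: le_integral_ge0 => x _; first exact: measure_ge0.
  by case: ifPn => [/Ag//|_]; exact: leey.
- exact: Iset_meas.
- by move=> x _; case: ifP => _; rewrite ?lee_fin// leey.
- by move=> x _; rewrite lee_fin.
- by apply: mu_ae => x ->.
Qed.

Let Pmu_ge (A : R -> set Omega) (g : R -> R) : bmf g -> (forall x, 0 <= g x) ->
  (forall x, `|x| < 1 -> ((g x)%:E <= P (A x))%E) ->
  ((\int[mu]_x g x)%:E <= Pmu P mu A)%E.
Proof.
move=> bg g0 Ag; rewrite -EFin_bmf//.
have mg : measurable_fun setT (fun x => (g x)%:E) by apply/measurable_EFinP; exact: bg.1.
rewrite -(@ge0_ae_eq_integral _ _ _ mu setT (fun x => if `|x| < 1 then (g x)%:E else 0%E))//.
- apply: le_integral_ge0 => x _; first by case: ifP => _; rewrite ?lee_fin.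
  by case: ifPn => [/Ag//|_]; exact: measure_ge0.
- exact: Iset_meas.
- by move=> x _; case: ifP => _; rewrite ?lee_fin.
- by move=> x _; rewrite lee_fin.
- by apply: mu_ae => x ->.
Qed.

Let Pmu_eq (A : R -> set Omega) (g : R -> R) : bmf g -> (forall x, 0 <= g x) ->
  (forall x, `|x| < 1 -> P (A x) = (g x)%:E) ->
  Pmu P mu A = (\int[mu]_x g x)%:E.
Proof.
move=> bg g0 Ag; apply/eqP; rewrite eq_le Pmu_le ?Pmu_ge// => x /Ag ->//.
Qed.

Let P_int (A : set Omega) : measurable A -> P A = (\int[P]_w \1_A w)%:E.
Proof.
move=> mA; rewrite -EFin_bmf; last exact: bmf_indic.
by rewrite integral_indic// setIT.
Qed.

Let one := (fun _ : R => 1 : R).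
Let b1 : bmf one. Proof. exact: bmf_cst. Qed.

Let bT1 v : 0 < v -> bmf (T v one). Proof. by move=> v0; exact: (bmf_T hW). Qed.

Let msurvo x v : 0 < v -> measurable (survo W s x v).
Proof.
move=> v0; have [m _] := bmf_survo hW x s0 v0.
rewrite (_ : survo W s x v = (\1_(survo W s x v) : Omega -> R) @^-1` [set 1]).
  by apply: (measurable_preimT m); exact: measurable_set1.
apply/seteqP; split => w; rewrite /= indicE; first by move=> h; rewrite mem_set.
by case: (boolP (w \in _)) => [/set_mem//|_ /= /eqP]; rewrite eq_sym oner_eq0.
Qed.

Let P_den x t : s < t -> `|x| < 1 ->
  P [set w | (t%:E < tauX W x s w)%E] = (T (lt t) one x)%:E.
Proof.
move=> st x1; have v0 := logtime_gt0 s0 st.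
rewrite (_ : [set w | _] = survo W s x (lt t)); last first.
  by apply/seteqP; split => w /= /(tauX_survo hW w s0 (ltW st) x1).
rewrite P_int; last exact: msurvo.
rewrite -(survo_T hW x s0 v0 b1); congr EFin.
by apply: eq_Rintegral => w _; rewrite mulr1.
Qed.

Let P_num_set x u t : s < t -> s <= u -> u <= t -> `|x| < 1 ->
  [set w | S (Xproc W x s u w) /\ (t%:E < tauX W x s w)%E] =
  survo W s x (lt t) `&` Zs W s x (lt u) @^-1` S.
Proof.
move=> st su ut x1; apply/seteqP; split => w /=; rewrite (Xproc_Zs W x w s0 su).
  by move=> [h1 /(tauX_survo hW w s0 (ltW st) x1)].
by move=> [h1 h2]; split => //; apply/(tauX_survo hW w s0 (ltW st) x1).
Qed.

Let P_num x u t : s < u -> u < t -> `|x| < 1 ->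
  P [set w | S (Xproc W x s u w) /\ (t%:E < tauX W x s w)%E] =
  (T (lt u) (fun y => \1_S y * T (logtime u t) one y) x)%:E.
Proof.
move=> su ut x1; have st := lt_trans su ut.
have v0 := logtime_gt0 s0 st.
have u0 := logtime_gt0 s0 su.
have v'0 := logtime_gt0 (le_trans s0 (ltW su)) ut.
rewrite P_num_set ?(ltW su) ?(ltW ut)// P_int; last first.
  apply: measurableI; first exact: msurvo.
  by apply: measurable_preimT => //; exact: (measurable_Zs hW x s0 (ltW u0)).
have M := markov hW x s0 u0 v'0 mS b1.
rewrite (logtimeD s0 (ltW su) (ltW ut)) in M; rewrite -M; apply: (congr1 EFin).
apply: eq_Rintegral => w _; rewrite mulr1 indicI; congr (_ * _).
Qed.

Definition limG v : R := expR v * ip (fun x => \1_S x * T v (fun=> 1) x) / ip (fun=> 1).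

Let b1S v : 0 < v -> bmf (fun x => \1_S x * T v one x).
Proof. by move=> v0; apply: bmfM; [exact: bmf_indic|exact: bT1]. Qed.

Let T1_ge0 v x : 0 <= v -> 0 <= T v one x.
Proof. by move=> v0; apply: T_ge0 => // y _; exact: ler01. Qed.

Let S01 x : 0 <= (\1_S x : R) <= 1.
Proof. by rewrite indicE; case: (_ \in _); rewrite /= ?lexx ler01. Qed.

Let S_T1_ge0 v x : 0 <= v -> 0 <= \1_S x * T v one x.
Proof. by move=> v0; have /andP[h _] := S01 x; rewrite mulr_ge0// T1_ge0. Qed.

Lemma ip1_gt0 : 0 < ip (fun _ : R => 1 : R).
Proof.
apply: lt_le_trans ip_hb_gt0 _; apply: ip_le => [||y _]; [exact: bmf_hb|exact: b1|].
by have /andP[] := hb01 y.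
Qed.

Let ip_bounds v : 0 < v ->
  0 <= ip (fun x => \1_S x * (expR v * T v one x)) <= 3 * expR 1 * ip one.
Proof.
move=> v0; have bF : bmf (fun x => \1_S x * (expR v * T v one x)).
  by apply: bmfM; [exact: bmf_indic|apply: bmfZ; exact: bT1].
rewrite -ipZ; last exact: b1.
apply/andP; split.
  rewrite -[leLHS](mul0r (ip one)) -ipZ; last exact: b1.
  apply: ip_le => // [|y _]; first by apply: bmfZ; exact: b1.
  rewrite mul0r; have /andP[h _] := S01 y; rewrite !mulr_ge0 ?expR_ge0//.
  by apply: T1_ge0; exact: ltW.
apply: ip_le => // [|y y1]; first by apply: bmfZ; exact: b1.
rewrite mulr1; have /andP[h0 h1] := S01 y; apply: le_trans (expT_le hW v0 y1).
by apply: ler_piMl => //; rewrite mulr_ge0 ?expR_ge0//; apply: T1_ge0; exact: ltW.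
Qed.

Let limGE v : 0 < v ->
  limG v = ip (fun x => \1_S x * (expR v * T v one x)) / ip one.
Proof.
move=> v0; rewrite /limG -ipZ; last exact: b1S.
congr (_ / _); apply: (congr1 ip); apply/funext => x; ring.
Qed.

Lemma limG_itv v : 0 < v -> 0 <= limG v <= 3 * expR 1.
Proof.
move=> v0; have /andP[h0 h1] := ip_bounds v0; have i0 := ip1_gt0.
by rewrite limGE// divr_ge0 ?(ltW i0)//= ler_pdivrMr.
Qed.

Let num u t : R := \int[mu]_x T (lt u) (fun y => \1_S y * T (logtime u t) one y) x.
Let den t : R := \int[mu]_x T (lt t) one x.

Let condprobE u t : s < u -> u < t -> condprob P W mu s S u t = num u t / den t.
Proof.
move=> su ut; have st := lt_trans su ut.
have v0 := logtime_gt0 s0 st; have u0 := logtime_gt0 s0 su.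
have v'0 := logtime_gt0 (le_trans s0 (ltW su)) ut.
rewrite /condprob (Pmu_eq (g := T (lt u) (fun y => \1_S y * T (logtime u t) one y))).
- rewrite (Pmu_eq (g := T (lt t) one)) => [//||x|x x1]; first exact: bT1.
  + by apply: T1_ge0; exact: ltW.
  + exact: P_den.
- by apply: (bmf_T hW) => //; exact: b1S.
- by move=> x; apply: T_ge0 => [|y _]; [exact: ltW|apply: S_T1_ge0; exact: ltW].
- by move=> x x1; exact: P_num.
Qed.

Lemma condprob_itv u t : s < t -> s <= u -> u <= t -> 0 <= condprob P W mu s S u t <= 1.
Proof.
move=> st su ut; have v0 := logtime_gt0 s0 st.
have u0 := logtime_ge0 s0 su.
have dE : Pmu P mu (fun x => [set w | (t%:E < tauX W x s w)%E]) = (den t)%:E.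
  apply: Pmu_eq => [|x|x x1]; first exact: bT1.
    by apply: T1_ge0; exact: ltW.
  exact: P_den.
have d0 : 0 <= den t by apply: int_ge0 => x; apply: T1_ge0; exact: ltW.
set N := Pmu P mu (fun x => [set w | S (Xproc W x s u w) /\ (t%:E < tauX W x s w)%E]).
have N0 : (0 <= N)%E by apply: integral_ge0 => x _; exact: measure_ge0.
have Nd : (N <= (den t)%:E)%E.
  apply: Pmu_le => [|x|x x1]; first exact: bT1.
    by apply: T1_ge0; exact: ltW.
  rewrite -P_den// P_num_set// (_ : [set w | _] = survo W s x (lt t)); last first.
    by apply/seteqP; split => w /= /(tauX_survo hW w s0 (ltW st) x1).
  apply: le_measure; rewrite ?inE; last by apply: subIset; left.
    apply: measurableI; first exact: msurvo.
    by apply: measurable_preimT => //; exact: (measurable_Zs hW x s0 u0).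
  exact: msurvo.
have Nf : N \is a fin_num by rewrite ge0_fin_numE// (le_lt_trans Nd)// ltry.
rewrite /condprob -/N dE /=; apply/andP; split; first by rewrite divr_ge0// fine_ge0.
have [d1|d1] := ltP 0 (den t); last first.
  by rewrite (_ : den t = 0) ?invr0 ?mulr0//; apply/le_anti/andP.
by rewrite ler_pdivrMr// mul1r -lee_fin fineK.
Qed.

(** Numerator and denominator, rescaled by exponentials, are both close to a multiple of this mean
    of h under [mu], which therefore cancels: the limit does not depend on [mu]. *)
Let mass : R := \int[mu]_x hb x.

Let mass_gt0 : 0 < mass.
Proof.
rewrite lt_neqAle eq_sym; apply/andP; split; last first.
  by apply: int_ge0 => x; have /andP[] := hb01 x.
apply/eqP => m0.
have mh : measurable_fun setT (EFin \o (hb : R -> R)).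
  by apply/measurable_EFinP; exact: (@bmf_hb R).1.
have E : (\int[mu]_x `|(EFin \o (hb : R -> R)) x| = 0)%E.
  rewrite (eq_integral (fun x => (hb x)%:E)).
    by rewrite EFin_bmf; [rewrite -/mass m0|exact: bmf_hb].
  by move=> x _; rewrite /= ger0_norm//; have /andP[] := hb01 x.
have /(ae_eq_integral_abs mu measurableT mh)[N [mN N0 sub]] := E.
have : (mu Iopen11 <= mu N)%E.
  apply: le_measure; rewrite ?inE//; first exact: measurable_I.
  move=> x /IP x1; apply: sub => /= /(_ Logic.I) [].
  rewrite hbE ?ltW// /hfun -real_normK ?num_real//.
  by have := normr_ge0 x; nra.
by rewrite hmu N0 lee_fin ler10.
Qed.

Let ratio_close (n e A B K eps : R) : 0 < B -> 0 <= A -> A <= K * B -> 1 <= K ->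
  0 < eps -> eps <= B / 2 -> `|n - A| <= K * eps -> `|e - B| <= eps ->
  `|n / e - A / B| <= 4 * K * eps / B.
Proof.
move=> B0 A0 AK K1 e0 eB nA; rewrite ler_norml => /andP[d1 d2].
have e1 : B / 2 <= e by lra.
have ep : 0 < e by lra.
have -> : n / e - A / B = ((n - A) + A / B * (B - e)) / e.
  by field; rewrite !gt_eqF.
have AB : 0 <= A / B <= K by rewrite divr_ge0 ?(ltW B0)//= ler_pdivrMr.
rewrite normrM (gtr0_norm (_ : 0 < e^-1)) ?invr_gt0// ler_pdivrMr//.
have h1 : `|(n - A) + A / B * (B - e)| <= K * eps + K * eps.
  apply: (le_trans (ler_normD _ _)); apply: lerD => //; rewrite normrM.
  case/andP: AB => AB0 ABK; apply: ler_pM => //; first by rewrite ger0_norm.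
  by rewrite ler_norml; apply/andP; split; lra.
apply: (le_trans h1).
have -> : 4 * K * eps / B * e = 2 * (K * eps) * (2 * e / B) by field; rewrite gt_eqF.
have h2 : 1 <= 2 * e / B by rewrite ler_pdivlMr//; lra.
have h3 : 0 <= K * eps by rewrite mulr_ge0 ?(ltW e0)//; lra.
nra.
Qed.

(** The threshold [r] has to be uniform in [t]. The convergence of T is uniform over functions with
    values in [0, 1], and [F], the function exp v 1_S T_v 1 with v = [logtime u t], is bounded by K
    = 3 exp 1 for all v: hence the use of F / K. *)
Lemma condprob_close eps : 0 < eps -> exists2 r, 0 < r & forall u t, s < u -> u < t ->
  r <= lt u -> `|condprob P W mu s S u t - limG (logtime u t)| <= eps.
Proof.
move=> eps0; have H0 := @ip_hb_gt0 R; have i0 := ip1_gt0.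
pose K : R := 3 * expR 1.
have K1 : 1 <= K by have := expR_ge1Dx (1 : R); rewrite /K; lra.
have K0 : 0 < K by lra.
pose B := ip one / ip hb.
have B0 : 0 < B by rewrite divr_gt0.
(* The first term keeps the denominator at least B / 2, the second makes the error 4 K e / B of the
   quotient at most [eps]. *)
pose e := Num.min (B / 2) (eps * B / (4 * K)).
have e0 : 0 < e.
  by rewrite lt_min; apply/andP; split; apply: divr_gt0 => //; exact: mulr_gt0.
have e1 : e <= B / 2 by rewrite ge_min lexx.
have e2 : 4 * K * e / B <= eps.
  have : e <= eps * B / (4 * K) by rewrite ge_min lexx orbT.
  rewrite ler_pdivlMr ?mulr_gt0// => h; rewrite ler_pdivrMr//; lra.
have [r r0 Hr] := T_hfun_cvg hW e0.
exists r => // u t su ut ru; have st := lt_trans su ut.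
have v0 := logtime_gt0 s0 st; have u0 := logtime_gt0 s0 su.
have v'0 := logtime_gt0 (le_trans s0 (ltW su)) ut.
pose F x := \1_S x * (expR (logtime u t) * T (logtime u t) one x).
have bF : bmf F by apply: bmfM; [exact: bmf_indic|apply: bmfZ; exact: bT1].
pose f x := K^-1 * F x.
have bf : bmf f by exact: bmfZ.
have mint (h : R -> R) (q c : R) : bmf h -> 0 <= c ->
    (forall x, `|x| < 1 -> `|h x - hb x * q| <= c * hb x) ->
    (forall x, 1 <= `|x| -> h x = 0) ->
    `|(\int[mu]_x h x) / mass - q| <= c.
  move=> bh c0 hq hoff.
  have bhb : bmf (hb : R -> R) by exact: bmf_hb.
  have E : (\int[mu]_x h x) / mass - q = (\int[mu]_x (h x - q * hb x)) / mass.
    rewrite bmf_intB//; last exact: bmfZ.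
    rewrite bmf_intZ// -/mass; field; rewrite gt_eqF//.
  rewrite E normrM (gtr0_norm (_ : 0 < mass^-1)) ?invr_gt0// ler_pdivrMr//.
  have HH x : - (c * hb x) <= h x - q * hb x <= c * hb x.
    rewrite -ler_norml; have [x1|x1] := ltP `|x| 1; first by rewrite mulrC hq// mulrC.
    by rewrite hoff// hb_off// !mulr0 subrr normr0.
  have bd : bmf (fun x => h x - q * hb x) by apply: bmfB => //; exact: bmfZ.
  have bc : bmf (fun x => c * hb x) by exact: bmfZ.
  have bnc : bmf (fun x => - c * hb x) by exact: bmfZ.
  rewrite ler_norml; apply/andP; split.
    rewrite -mulNr /mass -bmf_intZ//; apply: bmf_le => // x.
    by have /andP[h1 _] := HH x; rewrite mulNr.
  by rewrite /mass -bmf_intZ//; apply: bmf_le => // x; have /andP[] := HH x.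
have bone : bmf (T (lt t) one) by exact: bT1.
have bnum := bmf_T hW u0 (b1S v'0).
have bTF : bmf (T (lt u) F) by exact: (bmf_T hW).
have TFE x : T (lt u) F x = expR (logtime u t) *
    T (lt u) (fun y => \1_S y * T (logtime u t) one y) x.
  rewrite -(TZ hW)//; last exact: b1S.
  by apply: T_ext => [|y _]; [exact: ltW|rewrite /F; ring].
have hn := mint (fun x => expR (lt u) * T (lt u) F x) (ip F / ip hb) (K * e).
have {}hn : `|(\int[mu]_x (expR (lt u) * T (lt u) F x)) / mass - ip F / ip hb| <= K * e.
  apply: hn => [||x x1|x x1]; [exact: bmfZ|by rewrite mulr_ge0 ?ltW| |]; last first.
    by rewrite (T_off hW) ?mulr0// ltW.
  have := Hr (lt u) f x ru bf _ x1; move=> /(_ _)/wrap[y y1|].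
    have /andP[S0 S1] := S01 y; have T0 := T1_ge0 y (ltW v'0).
    have eT0 : 0 <= expR (logtime u t) * T (logtime u t) one y by rewrite mulr_ge0 ?expR_ge0.
    rewrite /f /F mulr_ge0 ?invr_ge0 ?(ltW K0) ?mulr_ge0//=.
    rewrite mulrC ler_pdivrMr// mul1r; apply: le_trans (expT_le hW v'0 y1).
    exact: ler_piMl.
  rewrite (TZ hW)// ipZ//.
  have -> : expR (lt u) * (K^-1 * T (lt u) F x) - hb x * (K^-1 * ip F / ip hb) =
      K^-1 * (expR (lt u) * T (lt u) F x - hb x * (ip F / ip hb)) by ring.
  rewrite normrM gtr0_norm ?invr_gt0// mulrC ler_pdivrMr//.
  by have -> : e * hb x * K = K * e * hb x by ring.
have hd : `|(\int[mu]_x (expR (lt t) * T (lt t) one x)) / mass - B| <= e.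
  apply: mint => [||x x1|x x1]; [exact: bmfZ|exact: ltW| |]; last first.
    by rewrite (T_off hW) ?mulr0// ltW.
  apply: Hr => //; last by move=> y _; rewrite ler01 lexx.
  by apply: (le_trans ru); apply: logtime_le => //; exact: ltW.
rewrite bmf_intZ// in hn; rewrite bmf_intZ// in hd.
have AB : ip F <= K * ip one by have /andP[] := ip_bounds v'0.
have A0 : 0 <= ip F by have /andP[] := ip_bounds v'0.
have := ratio_close B0 (divr_ge0 A0 (ltW H0)) _ K1 e0 e1 hn hd.
move=> /(_ _)/wrap[|h]; first by rewrite /B mulrA ler_pM2r ?invr_gt0.
apply: (le_trans _ e2); apply: le_trans h; rewrite condprobE// limGE//.
have -> : ip F / ip one = ip F / ip hb / B.
  by rewrite /B; field; rewrite !gt_eqF.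
suff -> : num u t / den t = expR (lt u) * (\int[mu]_x T (lt u) F x) / mass /
    (expR (lt t) * (\int[mu]_x T (lt t) one x) / mass) by [].
have -> : \int[mu]_x T (lt u) F x = expR (logtime u t) * num u t.
  by rewrite -bmf_intZ//; apply: eq_Rintegral => x _; rewrite TFE.
rewrite -/(den t) mulrA -expRD (logtimeD s0 (ltW su) (ltW ut)).
have ep := expR_gt0 (lt t); have mp := mass_gt0.
(* If [den t] is 0, both quotients are 0 by the convention on division. *)
have [->|d0] := eqVneq (den t) 0; first by rewrite mulr0 mul0r !invr0 !mulr0.
by field; rewrite d0 !gt_eqF.
Qed.

End conditional_probabilities.

(** [C + l] collects what does not grow with [t]: the error [C], and the difference between (t + 1)
    o and t o. *)
Lemma average_close {R : realType} (t s e l o a C : R) : 0 < t -> 0 <= s -> 0 < e ->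
  C + l < e / 3 * t -> 0 <= o -> l - e / 3 <= o -> o <= l ->
  (t + 1) * o - e / 3 * (t - s) - C <= a ->
  a <= (t + 1) * o + e / 3 * (t - s) + C -> `|l - t^-1 * a| <= e.
Proof.
move=> t0 s0 e0 Dte o0 o1 o2 h1 h2.
have es : 0 <= e / 3 * s by rewrite mulr_ge0// divr_ge0// ltW.
have tp1 : t * (l - e / 3) <= t * o by rewrite ler_pM2l.
have tp2 : t * o <= t * l by rewrite ler_pM2l.
rewrite ler_norml; apply/andP; split.
  rewrite lerBrDr -lerBrDl opprK mulrC ler_pdivrMr//; lra.
rewrite lerBlDr -lerBlDl mulrC ler_pdivlMr//; lra.
Qed.

(** * Averages over time and their limit *)

Section time_averages.
Context {R : realType} (d : measure_display) (Omega : measurableType d)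
  (P : probability Omega R) (W : R -> Omega -> R) (hW : is_std_BM P W).
Variables (mu : probability R R) (hmu : mu Iopen11 = 1%E).
Variables (s : R) (s0 : 0 <= s) (S : set R) (mS : measurable S) (hS : S `<=` Iopen11).
Implicit Types (t u v x e b : R).

Local Notation RT := (measurableTypeR R).
Local Notation T := (killT P W).
Local Notation lt := (logtime s).
Local Notation leb := (@lebesgue_measure R).
Local Notation occ := (occ P W S).
Local Notation limG := (limG P W S).
Local Notation ip1 := (ip (fun _ : R => 1 : R)).
Local Notation K := (3 * expR 1 : R).
Local Notation cp := (condprob P W mu s S).

Let ip1_gt0 : 0 < ip1 := ip1_gt0.

Let K_ge0 : 0 <= K. Proof. by rewrite mulr_ge0 ?expR_ge0. Qed.

Let mit t : measurable (`[s, t]%classic : set RT). Proof. exact: measurable_itv. Qed.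

Let oit t : (leb (`[s, t]%classic : set RT) < +oo)%E.
Proof. by rewrite /= lebesgue_measure_itv/=; case: ifPn => _; rewrite ltry. Qed.

Let lam t := mfrestr (mit t) (oit t).

Let lamE t f : bmf f -> \int[lam t]_u f u = \int[leb]_(u in `[s, t]) f u.
Proof. exact: integral_mfrestr. Qed.

Let lam_cst t c : s <= t -> \int[lam t]_u c = c * (t - s).
Proof.
move=> st; rewrite bmf_int_cst; congr (_ * _).
suff E : lam t setT = (t - s)%:E by exact: (congr1 fine E).
rewrite /lam /mfrestr /mrestr setTI.
rewrite /= lebesgue_measure_itv/= lte_fin -EFinD; case: ifPn => //.
by rewrite -leNgt => ts; rewrite (_ : t = s) ?subrr//; apply/le_anti; rewrite ts st.
Qed.

(** As exp (logtime u t) = (t + 1) / (u + 1), the function (t + 1) / ip1 times [Psi] of [occupation]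
    extends [limG (logtime u t)] from (s, t) to a bounded measurable function on the line, with a
    known integral. *)
Let limG_avg t : s < t -> exists g : R -> R,
  [/\ bmf g, (forall u, 0 <= g u <= K), g t = 0, (forall u, s < u -> u < t -> g u = limG (logtime u t)) &
      \int[lam t]_u g u = (t + 1) / ip1 * occ (lt t)].
Proof.
move=> st; have s0' := s0; have [Psi [bP P0 Poff PE Pint]] := occupation hW mS s0 st.
have c0 : 0 < (t + 1) / ip1 by rewrite divr_gt0//; lra.
have gE u : s < u -> u < t -> (t + 1) / ip1 * Psi u = limG (logtime u t).
  move=> su ut; rewrite PE// /limG /logtime lnK ?posrE ?divr_gt0//; last 2 first.
  - by have := s0; lra.
  - by have := s0; lra.
  by rewrite -mulrA mulrC; ring.
exists (fun u => (t + 1) / ip1 * Psi u); split => //.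
- exact: bmfZ.
- move=> u; rewrite mulr_ge0 ?(ltW c0)//=.
  have [us|su] := leP u s; first by rewrite Poff ?mulr0 ?mulr_ge0 ?expR_ge0//; left.
  have [tu|ut] := leP t u; first by rewrite Poff ?mulr0 ?mulr_ge0 ?expR_ge0//; right.
  rewrite gE//; have v0 := logtime_gt0 (le_trans s0 (ltW su)) ut.
  by have /andP[] := limG_itv hW mS v0.
- by rewrite Poff ?mulr0//; right.
- by rewrite -Pint -(lamE t bP); exact: (bmf_intZ (lam t) _ bP).
Qed.

Let occ_ge0 b : 0 <= b -> 0 <= occ b.
Proof.
move=> b0; apply: int_ge0 => x; rewrite mulr_ge0 ?wgt_ge0//; apply: int_ge0 => w.
by have /andP[] := tauI_min_itv W (x, w) b0.
Qed.

(** The bound of [limG] by K gives (t + 1) / ip1 times [occ (lt t)] at most K (t - s) <= K (t + 1),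
    and [t] is free. It is chosen with [lt t = b + 1] rather than [b], since s < t is required. *)
Let occ_bound b : 0 <= b -> occ b <= K * ip1.
Proof.
move=> b0; apply: (@le_trans _ _ (occ (b + 1))); first by apply: (occ_le hW mS) => //; lra.
have s1 : 0 < s + 1 by have := s0; lra.
have e1 : 1 < expR (b + 1) by rewrite -[ltLHS]expR0 ltr_expR; lra.
pose t := (s + 1) * expR (b + 1) - 1.
have st : s < t by rewrite /t ltrBrDr ltr_pMr.
have wE : lt t = b + 1 by rewrite /logtime /t subrK mulrC mulKf ?expRK// gt_eqF.
have [g [bg gK _ _ gint]] := limG_avg st.
have t1 : 0 < t + 1 by have := s0; lra.
have h : \int[lam t]_u g u <= K * (t - s).
  rewrite -(@lam_cst t K (ltW st)).
  apply: (@bmf_le _ _ _ (lam t)) => //; first exact: bmf_cst.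
  by move=> u; have /andP[] := gK u.
rewrite gint wE in h.
have h2 : (t + 1) / ip1 * occ (b + 1) <= (t + 1) / ip1 * (K * ip1).
  apply: (le_trans h); rewrite [leRHS](_ : _ = K * (t + 1)); last first.
    by field; rewrite gt_eqF.
  apply: (ler_wpM2l K_ge0); rewrite lerD2l; apply: (@le_trans _ _ 0) => //.
  by rewrite oppr_le0.
by rewrite ler_pM2l ?divr_gt0// in h2.
Qed.

(** The estimate of [condprob_close] holds for u0 < u < t with u0 independent of t. On [s, u0] both
    functions are bounded, which costs the constant [C], and the single time [t] has measure 0. The
    conditional probability is enclosed between the measurable functions [lo] and [up]. *)
Let avg_close e : 0 < e -> exists2 C, 0 <= C & forall t, s < t ->
  (((t + 1) / ip1 * occ (lt t) - e * (t - s) - C)%:E <=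
     \int[leb]_(u in `[s, t]) (cp u t)%:E)%E /\
  (\int[leb]_(u in `[s, t]) (cp u t)%:E <=
     ((t + 1) / ip1 * occ (lt t) + e * (t - s) + C)%:E)%E.
Proof.
move=> e0; have [r r0 close] := condprob_close hW hmu s0 mS e0.
have s1 : 0 < s + 1 by have := s0; lra.
have K1 : 1 <= K by have := expR_ge1Dx (1 : R); lra.
pose u0 := (s + 1) * expR r - 1.
have su0 : s < u0.
  by rewrite /u0 ltrBrDr ltr_pMr// -[ltLHS]expR0 ltr_expR.
have u0E u : u0 < u -> r <= lt u.
  move=> uu; rewrite /logtime -[leLHS]expRK ler_ln ?posrE ?expR_gt0//; last first.
    by rewrite divr_gt0//; have := s0; lra.
  by rewrite ler_pdivlMr// mulrC; move: uu; rewrite /u0; lra.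
exists (K * (u0 - s)); first by apply: (mulr_ge0 K_ge0); rewrite subr_ge0 ltW.
move=> t st; have [g [bg gK gt gE gint]] := limG_avg st.
have mu0 : measurable (`[s, u0]%classic : set RT) by exact: measurable_itv.
have bI : bmf (\1_(`[s, u0]%classic) : RT -> R) by exact: bmf_indic.
have bt : bmf (\1_[set t] : RT -> R) by exact: bmf_indic.
have Eint (f : RT -> R) : bmf f ->
    (\int[leb]_(u in `[s, t]) (f u)%:E = (\int[lam t]_u f u)%:E)%E.
  move=> bf; rewrite lamE// /Rintegral fineK//; apply: integrable_fin_num => //.
  have [mf [M fM]] := bf; apply: measurable_bounded_integrable => //.
  - exact: oit.
  - exact: measurable_funTS.
  - exists M; split; first exact: num_real.
    by move=> N MN x _ /=; rewrite (le_trans (fM x))// ltW.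
have st' := ltW st.
have Iind (A : set RT) : measurable A ->
    (\int[lam t]_u (\1_A u : R))%:E = leb (A `&` `[s, t]%classic).
  move=> mA; rewrite -EFin_bmf; last exact: bmf_indic.
  by rewrite integral_indic// setIT.
have Ifin (A : set RT) c : measurable A -> (leb A <= c%:E)%E ->
    \int[lam t]_u (\1_A u : R) <= c.
  move=> mA Ac; rewrite -lee_fin Iind//; apply: le_trans Ac.
  apply: le_measure; rewrite ?inE//; first exact: measurableI.
have int_u0 : \int[lam t]_u (\1_(`[s, u0]%classic) u : R) <= u0 - s.
  apply: Ifin => //.
  by rewrite lebesgue_measure_itv/= lte_fin su0 -EFinD.
have int_t : \int[lam t]_u (\1_[set t] u : R) <= 0.
  by apply: Ifin => //; rewrite lebesgue_measure_set1.
have eqi u : \1_(`[s, u0]%classic) u = (if s <= u <= u0 then 1 else 0) :> R.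
  by rewrite indicE; case: ifPn => h; [rewrite mem_set//= in_itv/= h|
    rewrite memNset//= in_itv/=; exact/negP].
have eqt u : \1_[set t] u = (if u == t then 1 else 0) :> R.
  by rewrite indicE; case: eqVneq => [->|/eqP h]; [rewrite mem_set|rewrite memNset].
have cpb u : s <= u <= t -> 0 <= cp u t <= 1.
  by move=> /andP[su ut]; exact: (condprob_itv hW hmu).
split.
  (* The maximum with 0 makes [le_integral_ge0] applicable. At u = t it equals 0, because g t =
     0. *)
  pose lo u := Num.max 0 (g u - e - K * \1_(`[s, u0]%classic) u).
  have bL : bmf (fun u : RT => g u - e - K * \1_(`[s, u0]%classic) u).
    by apply: bmfB; [apply: bmfB => //; exact: bmf_cst|exact: bmfZ].
  have blo : bmf (lo : RT -> R).
    have [mL [M LM]] := bL; split; first exact: measurable_maxr.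
    exists M => u; rewrite /lo; have := LM u; have := normr_ge0 (g u - e - K * \1_(`[s, u0]%classic) u).
    by move=> p q; rewrite maxEge; case: ifP => _ //; rewrite normr0 (le_trans p).
  apply: (@le_trans _ _ (\int[leb]_(u in `[s, t]) (lo u)%:E)%E).
    rewrite Eint// lee_fin.
    apply: (@le_trans _ _ (\int[lam t]_u (g u - e - K * \1_(`[s, u0]%classic) u))); last first.
      by apply: bmf_le => // u; rewrite /lo le_max lexx orbT.
    rewrite bmf_intB; [|by apply: bmfB => //; exact: bmf_cst|exact: bmfZ].
    rewrite bmf_intB//; last exact: bmf_cst.
    rewrite bmf_intZ// lam_cst// gint.
    by have := ler_wpM2l K_ge0 int_u0; lra.
  apply: le_integral_ge0 => u; first by move=> _; rewrite lee_fin /lo le_max lexx.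
  rewrite /= in_itv /= => sut; have /andP[su ut] := sut.
  have /andP[c0 c1] := cpb u sut.
  rewrite lee_fin /lo ge_max c0 /= eqi su /=.
  have /andP[g0 gK1] := gK u.
  have [uu|uu] := leP u u0.
    by rewrite mulr1; move: c0 gK1 e0; lra.
  rewrite mulr0 subr0; move: ut; rewrite le_eqVlt => /predU1P[ut|ut].
    have gu : g u = 0 by rewrite ut.
    by rewrite gu; move: c0 e0; lra.
  have := close u t (lt_trans su0 uu) ut (u0E u uu).
  by rewrite ler_norml gE ?(lt_trans su0)// => /andP[]; lra.
(* The indicator of [t] covers the endpoint, where [g] is 0 while the conditional probability is
   only known to be at most 1. *)
pose up u := g u + e + \1_(`[s, u0]%classic) u + \1_[set t] u.
have bge : bmf (fun u : RT => g u + e) by apply: bmfD => //; exact: bmf_cst.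
have bup1 : bmf (fun u : RT => g u + e + \1_(`[s, u0]%classic) u) by exact: bmfD.
have bup : bmf (up : RT -> R) by exact: bmfD.
apply: (@le_trans _ _ (\int[leb]_(u in `[s, t]) (up u)%:E)%E); last first.
  rewrite Eint// lee_fin /up.
  rewrite bmf_intD// bmf_intD// bmf_intD//; last exact: bmf_cst.
  rewrite lam_cst// gint.
  have : u0 - s <= K * (u0 - s) by apply: ler_peMl => //; rewrite subr_ge0 ltW.
  by lra.
apply: le_integral_ge0 => u; rewrite /= in_itv /= => sut; have /andP[su ut] := sut.
  by rewrite lee_fin; have /andP[] := cpb u sut.
have /andP[c0 c1] := cpb u sut; have /andP[g0 gK1] := gK u.
rewrite lee_fin /up eqi eqt su /=.
have [uu|uu] := leP u u0.
  by case: ifP => _; move: c1 g0 e0; lra.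
case: eqVneq => [_|ut']; first by move: c1 g0 e0; lra.
have utl : u < t by rewrite lt_neqAle ut'.
have := close u t (lt_trans su0 uu) utl (u0E u uu).
by rewrite ler_norml gE ?(lt_trans su0)// => /andP[]; lra.
Qed.

Let occ_lim : exists L : R, [/\ (\int[lamI]_x ((wgt S x)%:E * EtauZ P W x) = L%:E)%E,
  0 <= L, forall b, 0 <= b -> occ b <= L &
  forall e, 0 < e -> exists2 b, 0 <= b & forall b', b <= b' -> L - e < occ b'].
Proof.
have c := occ_cvg hW mS; set V := (\int[lamI]_x _)%E in c *.
have VE := cvg_lim (@ereal_hausdorff R) c.
have V0 : (0 <= V)%E.
  rewrite -VE; apply: lime_ge; first by apply/cvg_ex; exists V.
  by apply: nearW => n; rewrite lee_fin occ_ge0.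
have VK : (V <= (K * ip1)%:E)%E.
  rewrite -VE; apply: lime_le; first by apply/cvg_ex; exists V.
  by apply: nearW => n; rewrite lee_fin occ_bound.
have Vf : V \is a fin_num by rewrite ge0_fin_numE// (le_lt_trans VK)// ltry.
have cr : (fun n => occ n%:R) @ \oo --> fine V.
  by apply: (@fine_cvg _ _ _ _ (fun n => (occ n%:R)%:E)); rewrite fineK.
exists (fine V); split; [by rewrite fineK|exact: fine_ge0|move=> b b0|move=> e e0].
  apply: (cvgr_to_ge cr); apply: filterS (nbhs_infty_ger b) => n bn.
  exact: (occ_le hW mS b0 bn).
have eL : fine V - e < fine V by rewrite gtrBl.
have [n nL] := filter_ex (cvgr_gt _ cr _ eL).
exists n%:R; [exact: ler0n|move=> b nb].
by apply: (lt_le_trans nL); exact: (occ_le hW mS (ler0n R n) nb).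
Qed.

Let alphaOU_KE : alphaOU_K = ip1^-1.
Proof.
rewrite /alphaOU_K /ip lamIE; last first.
  by apply: (bmfM (bmfM (@bmf_gam R) (@bmf_hb R))); exact: bmf_cst.
rewrite /Rintegral; congr ((fine _)^-1); apply: eq_integral => x /set_mem/IP x1.
by rewrite /alphaOU_unnorm hbE ?ltW// mulr1 mulrC.
Qed.

(** Measurability in [x] is known for the integral [J] of [tauI], which agrees with [EtauZ] on (-1,
    1); both sides see only points of [S], inside that interval. *)
Let limit_value L : (\int[lamI]_x ((wgt S x)%:E * EtauZ P W x) = L%:E)%E ->
  (\int[leb]_(x in S) (EtauZ P W x * (alphaOU_density x)%:E) = (L / ip1)%:E)%E.
Proof.
pose J (x : RT) := (\int[P]_w tauI W (x, w))%E.
have J0 x : (0 <= J x)%E.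
  by apply: integral_ge0 => w _; exact: tauI_ge0.
have mJ : measurable_fun setT J.
  apply: (measurable_fun_fubini_tonelli_F (m2 := P) (tauI W)).
    exact: (measurable_tauI hW).
  by move=> z; exact: tauI_ge0.
have JE x : `|x| < 1 -> J x = EtauZ P W x.
  by move=> x1; apply: eq_integral => w _; rewrite /tauI /= x1.
have -> : (\int[lamI]_x ((wgt S x)%:E * EtauZ P W x) = \int[lamI]_x ((wgt S x)%:E * J x))%E.
  apply: eq_integral => x _; have [x1|x1] := ltP `|x| 1; first by rewrite JE.
  by rewrite /wgt hb_off// mulr0 mul0r !mul0e.
have mw : measurable_fun setT (fun x : RT => ((wgt S x)%:E * J x)%E).
  by apply: emeasurable_funM => //; apply/measurable_EFinP; exact: (bmf_wgt mS).1.
have w0 x : (0 <= (wgt S x)%:E * J x)%E by rewrite mule_ge0// lee_fin wgt_ge0.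
have i0 : 0 <= ip1^-1 by rewrite invr_ge0 ltW.
rewrite mulrC EFinM => <-; rewrite -ge0_integralZl//.
have g0 (x : RT) : 0 <= (\1_Iopen11 x : R) by rewrite indicE.
have mg : measurable_fun setT (\1_Iopen11 : RT -> R).
  by apply: measurable_indic; exact: measurable_I.
have lamIint A : measurable A -> lamI A = (\int[leb]_(x in A) (\1_(Iopen11 : set RT) x)%:E)%E.
  by move=> mA; rewrite integral_indic//; [rewrite setIC|exact: measurable_I].
have mcw : measurable_fun setT (fun x : RT => ((ip1^-1)%:E * ((wgt S x)%:E * J x))%E).
  exact: emeasurable_funM.
have cw0 x : (0 <= (ip1^-1)%:E * ((wgt S x)%:E * J x))%E by rewrite mule_ge0.
rewrite (ge0_integral_density g0 mg lamIint mcw cw0) [LHS]integral_mkcond.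
apply: eq_integral => x _; rewrite patchE.
case: ifPn => [/set_mem Sx|/negP xS]; last first.
  by rewrite /wgt [\1_S x]indicE memNset ?mulr0 ?mul0e ?mule0 ?mul0e// => /mem_set.
have xI := hS Sx; have /IP x1 := xI.
rewrite JE// [\1_Iopen11 x]indicE mem_set// mule1 /wgt indicE mem_set// mulr1.
have -> : alphaOU_density x = ip1^-1 * (gam x * hb x).
  rewrite /alphaOU_density; move: xI; rewrite /Iopen11 /= in_itv /= => ->.
  by rewrite alphaOU_KE /alphaOU_unnorm hbE ?ltW// [gam x * _]mulrC.
by rewrite muleC EFinM -muleA.
Qed.

Lemma time_average_cvg :
  (fun t : R => ((t^-1)%:E * \int[leb]_(u in `[s, t]) (cp u t)%:E)%E) @ +oo%R -->
  (\int[leb]_(x in S) (EtauZ P W x * (alphaOU_density x)%:E))%E.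
Proof.
have [L [LE L0 Lub Lcvg]] := occ_lim.
rewrite (limit_value LE).
have Afin t : s < t -> (\int[leb]_(u in `[s, t]) (cp u t)%:E \is a fin_num)%E.
  move=> st; have [C C0 /(_ t st)[h1 h2]] := avg_close ltr01.
  rewrite fin_real// (lt_le_trans _ h1) ?ltNyr//=.
  by rewrite (le_lt_trans h2)// ltry.
apply: cvg_EFin.
  apply: filterS (nbhs_pinfty_gt (num_real s)) => t st.
  by rewrite fin_numM// Afin.
apply/cvgrPdist_le => e e0.
have e3 : 0 < e / 3 by rewrite divr_gt0.
have [C C0 close] := avg_close e3.
(* The tolerance is multiplied by [ip1] because [occ] is divided by it below. *)
have [b b0 Lb] := Lcvg (ip1 * (e / 3)) (mulr_gt0 ip1_gt0 e3).
pose tb := (s + 1) * expR b - 1.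
pose D := C + L / ip1.
have D0 : 0 <= D by rewrite addr_ge0// divr_ge0// ltW.
near=> t.
have st : s < t by near: t; apply: nbhs_pinfty_gt; exact: num_real.
have tbt : tb < t by near: t; apply: nbhs_pinfty_gt; exact: num_real.
have Dt : 3 * D / e < t by near: t; apply: nbhs_pinfty_gt; exact: num_real.
have t0 : 0 < t by apply: le_lt_trans st.
have [h1 h2] := close t st.
set A := (\int[leb]_(u in `[s, t]) _)%E in h1 h2 *.
have Af : A \is a fin_num by exact: Afin.
have {h1} h1 : (t + 1) / ip1 * occ (lt t) - e / 3 * (t - s) - C <= fine A.
  by rewrite -lee_fin fineK.
have {h2} h2 : fine A <= (t + 1) / ip1 * occ (lt t) + e / 3 * (t - s) + C.
  by rewrite -lee_fin fineK.
have s1 : 0 < s + 1 by rewrite ltr_wpDl.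
have t1 : 0 < t + 1 by rewrite ltr_wpDl// ltW.
have bt : b <= lt t.
  rewrite /logtime -[leLHS]expRK ler_ln ?posrE ?expR_gt0//; last exact: divr_gt0.
  by rewrite (ler_pdivlMr _ _ s1) mulrC -lerBlDr ltW.
have o1 := Lb _ bt; have o2 := Lub _ (le_trans b0 bt).
have o3 := occ_ge0 (le_trans b0 bt).
rewrite /= fineM//= -/A.
have Dte : D < e / 3 * t by move: Dt; rewrite ltr_pdivrMr//; lra.
have oE : (t + 1) / ip1 * occ (lt t) = (t + 1) * (occ (lt t) / ip1).
  by rewrite mulrAC mulrA.
rewrite oE in h1 h2.
have o1' : L / ip1 - e / 3 <= occ (lt t) / ip1.
  rewrite (ler_pdivlMr _ _ ip1_gt0) mulrBl (divfK (lt0r_neq0 ip1_gt0)) [e / 3 * _]mulrC.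
  exact: ltW.
have o2' : occ (lt t) / ip1 <= L / ip1 by rewrite ler_pM2r ?invr_gt0.
have o3' : 0 <= occ (lt t) / ip1 := divr_ge0 o3 (ltW ip1_gt0).
by apply: average_close o1' o2' h1 h2.
Unshelve. all: by end_near. Qed.

End time_averages.

Theorem theorem3 (R : realType) (d : measure_display) (Omega : measurableType d)
  (P : probability Omega R) (W : R -> Omega -> R) (hW : is_std_BM P W)
  (mu : probability R R) (hmu : mu Iopen11 = 1%E)
  (s : R) (hs : 0 <= s) (S : set R) (mS : measurable S) (hS : S `<=` Iopen11) :
  (fun t : R => ((t^-1)%:E *
     \int[@lebesgue_measure R]_(u in `[s, t]) (condprob P W mu s S u t)%:E)%E)
    @ +oo%R --> (\int[@lebesgue_measure R]_(x in S)
                 (EtauZ P W x * (alphaOU_density x)%:E))%E.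
Proof. exact: (time_average_cvg hW hmu hs mS hS). Qed.
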